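(* Let $q=p^r$ be a prime power and $G=H(\mathbb{F}_q)$, where $H$ is one of the split semisimple groups $\mathrm{SL}_m,\mathrm{SO}_{2m+1},\mathrm{Sp}_{2m}$ with $m\geq2$, or $\mathrm{SO}_{2m}$ with $m\geq4$. Let $\rho:H\to\mathrm{GL}(V)$ be the standard representation of $H$ over $\mathbb{F}_q$. Then there exists a parabolic $P(W)\subset\mathrm{GL}(V)$ with unipotent radical $U$ such that $\dim_{\mathbb{F}_q}W=\lfloor\frac{\dim V}{2}\rfloor$ and $r'_p(G):=\dim_{\mathbb{F}_q}G\cap U$ satisfies: - if $G=\mathrm{SL}_m(\mathbb{F}_q)$, then $r'_p(G)=\lfloor\frac{m^2}{4}\rfloor$; - if $G=\mathrm{Sp}_{2m}(\mathbb{F}_q)$, then $r'_p(G)=\frac{m(m+1)}{2}$; - if $G=\mathrm{SO}_{2m}(\mathbb{F}_q)$, then $r'_p(G)=\frac{m(m-1)}{2}$; - if $G=\mathrm{SO}_{2m+1}(\mathbb{F}_q)$, then $r'_p(G)=\frac{m(m-1)}{2}$. Moreover $r\cdot r'_p(G)=r_p(G)$ in all cases except if $G=\mathrm{SO}_{2m+1}(\mathbb{F}_q)$, in which case $r_p(G)/r=\frac{m(m+1)}{2}$ if $q$ is even, and $r_p(G)/r=\frac{m(m-1)}{2}+1$ (resp. $5$, resp. $3$) if $q$ is odd and $m\geq4$ (resp. $m=3$, resp. $m=2$).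
   Context: For a subspace $W\subset V$, $P(W)\subset\mathrm{GL}(V)$ is the stabilizer of $W$; its unipotent radical $U$ consists of the elements acting trivially on $W$ and on $V/W$, and $U(\mathbb{F}_q)\cong\mathrm{Hom}_{\mathbb{F}_q}(V/W,W)$. $G\cap U$ means the $\mathbb{F}_q$-subspace $\rho(G)\cap U(\mathbb{F}_q)$. For a finite group $G$, $r_p(G):=\max_{H'\subset G}\dim_{\mathbb{F}_p}H'$, the maximum over all elementary abelian $p$-subgroups $H'\subset G$. *)

(* Defs.v *)
From mathcomp Require Import all_boot all_order all_algebra.
From mathcomp Require Import all_fingroup all_solvable.

Set Implicit Arguments.
Unset Strict Implicit.
Unset Printing Implicit Defensive.

Import GRing.Theory.
Local Open Scope ring_scope.

(* Elements of {'GL_n[F]} are matrices of size n.-1.+1, i.e. n for n > 0; they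
   act on row vectors by v |-> v *m g. *)

Section SplitForms.
Variables (F : finFieldType) (n : nat).
Implicit Types x y : 'rV[F]_n.

(* x_1 x_n + x_2 x_(n-1) + ..., ending with x_m x_(m+1) for n = 2m and with
   x_(m+1)^2 for n = 2m+1; it is split, and nondegenerate (as a form over the
   base scheme) in every characteristic, including 2. *)
Definition split_quad x : F :=
  \sum_(i < n | (i <= rev_ord i)%N) x 0 i * x 0 (rev_ord i).

(* For even n; alternating and nondegenerate in every characteristic. *)
Definition split_alt x y : F :=
  \sum_(i < n | (i < rev_ord i)%N)
    (x 0 i * y 0 (rev_ord i) - x 0 (rev_ord i) * y 0 i).

End SplitForms.

Section SplitGroups.
Variables (F : finFieldType) (n : nat).

Definition SLgroup : {set {'GL_n[F]}} := [set g | \det (GLval g) == 1].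

Definition Spgroup : {set {'GL_n[F]}} :=
  [set g | [forall x, forall y,
     split_alt (x *m GLval g) (y *m GLval g) == split_alt x y]].

Definition Ogroup : {set {'GL_n[F]}} :=
  [set g | [forall x, split_quad (x *m GLval g) == split_quad x]].

(* The F-points of the algebraic group SO_n. If n is even and F has
   characteristic 2 then det = 1 holds on all of O_n, and SO_n is the kernel of
   the Dickson invariant g |-> rank (g - 1) mod 2. In all other cases SO_n is
   the determinant 1 subgroup of the isometry group of the quadratic form. *)
Definition SOgroup : {set {'GL_n[F]}} :=
  [set g in Ogroup | (\det (GLval g) == 1)
     && ((2%N \in [pchar F]) && ~~ odd n ==> ~~ odd (\rank (GLval g - 1)))].

End SplitGroups.

Section Parabolic.
Variables (F : finFieldType) (n : nat).
Implicit Types (G : {set {'GL_n[F]}}) (W : {vspace 'rV[F]_(n.-1.+1)}).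

Definition parabolic W : {set {'GL_n[F]}} :=
  [set g | [forall v in W, v *m GLval g \in W]].

Definition unipotent_radical W : {set {'GL_n[F]}} :=
  [set g in parabolic W | [forall v in W, v *m GLval g == v]
                       && [forall v, v *m GLval g - v \in W]].

(* The F-linear structure on the unipotent radical is the one transported from
   Hom(V/W, W), seen inside End(V), by g |-> g - 1. The relation asserts that
   G :&: U is an F-subspace for this structure and that its dimension is d. *)
Definition dim_cap_radical G W (d : nat) : Prop :=
  exists2 S : {vspace 'M[F]_(n.-1.+1)},
    [set GLval g - 1 | g in G :&: unipotent_radical W] = [set N in S]
    & \dim S = d.

End Parabolic.

Arguments SLgroup F n : clear implicits.
Arguments Spgroup F n : clear implicits.
Arguments Ogroup F n : clear implicits.
Arguments SOgroup F n : clear implicits.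

(* Main.v *)
(* Upper bounds.  Let A be an abelian p-subgroup of the isometry group of V, and
   let Z be an A-stable totally singular subspace.  By induction on the dimension
   of perp Z / Z one bounds the index in A of the subgroup C(Z) acting trivially
   on perp Z / Z.  Pick a singular vector v of perp Z fixed by A modulo Z and put
   Z1 = Z + v: the group C(Z1) / C(Z) embeds in perp Z1 / Z1 by g |-> w (g - 1),
   where B(v, w) <> 0, and its image spans a space U, of dimension j, of vectors
   fixed by A modulo Z1.  So the next step of the induction knows that A fixes a
   space of dimension j, and a group with a fixed space of dimension k in a
   section of dimension N has at most q ^ C(N - k, 2) elements.  These two
   constraints define the function orth_bound.  A radical of dimension 1 (odd
   orthogonal groups in characteristic 2) raises N by 1, and the symplectic form
   raises N by 2 and k by 1, in accordance with the embeddings of SO_(2m+1) and,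
   for even q, of Sp_2m in SO_(2m+2).  In characteristic 2 and even dimension,
   the even rank of g - 1 rules out transvections on perp Z / Z.  For SL_m the same
   induction uses the sections V / Z.

   Lower bounds.  In the basis adapted to the split form, W is spanned by the
   first half of the basis, and the radical consists of the matrices that are
   symmetric or antisymmetric about the antidiagonal.  The larger subgroups of
   SO_(2m+1) are exponentials of abelian Lie algebras for odd q, and come from
   symmetric matrices with the square roots of their diagonals for even q. *)

Require Import Defs.
From mathcomp Require Import all_boot all_order all_algebra.
From mathcomp Require Import all_fingroup all_solvable.
From mathcomp Require Import finfield zify ring.

Set Implicit Arguments.
Unset Strict Implicit.
Unset Printing Implicit Defensive.

Import GRing.Theory.
Local Open Scope ring_scope.

(** * Counting modulo subspaces and common fixed vectors *)

(** [A] is only a group, so the displacements w (g - 1) need not form an [F]-space: cardinalities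
    are compared with powers of [#|F|], and a set of displacements is replaced by its span. A step
    in dimension N can gain up to N - 2, and gains N - 2, N - 4, ... would add up to twice C(m, 2).
    But a gain j is paid for later: it leaves j fixed dimensions, hence at most C(N - 2 - j, 2) for
    the rest. The other constraint, k + j <= N - 1 for j > 0, holds because fixed vectors are
    orthogonal to U; it matters in small dimension, where without it [orth_bound] would give 4
    instead of 3 for Sp_4 and 8 instead of 7 for SO_9. The small values of m are genuine exceptions:
    SO_6 is isogenous to SL_4 and reaches 4 > C(3, 2), and for odd q the radical of the stabiliser
    of a singular line in SO_(2m+1), of dimension 2m - 1, exceeds C(m, 2) + 1 for m = 2, 3 and
    equals it for m = 4. *)

Lemma notsub_rV (K : fieldType) m1 m2 n (X : 'M[K]_(m1, n)) (Y : 'M[K]_(m2, n)) :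
  ~~ (X <= Y)%MS -> exists2 v : 'rV[K]_n, (v <= X)%MS & ~~ (v <= Y)%MS.
Proof. by case/row_subPn=> i Hi; exists (row i X) => //; apply: row_sub. Qed.

Lemma mxrank_adds_rV (K : fieldType) m n (X : 'M[K]_(m, n)) (v : 'rV[K]_n) :
  ~~ (v <= X)%MS -> \rank (X + v)%MS = (\rank X).+1.
Proof.
move=> vX; apply/eqP; rewrite eqn_leq; apply/andP; split.
  have := mxrank_sum_cap X v; rewrite rank_rV.
  have ->: v != 0 by apply: contra vX => /eqP->; apply: sub0mx.
  by move=> h; rewrite -[X in (_ <= X)%N]addn1 -h leq_addr.
by rewrite (ltn_leqif (mxrank_leqif_sup (addsmxSl _ _))) addsmx_sub submx_refl.
Qed.

Lemma mxrank_mul_coker (K : fieldType) m1 m2 n (X : 'M[K]_(m1, n)) (Z : 'M[K]_(m2, n)) :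
  (Z <= X)%MS -> (\rank (X *m cokermx Z) = \rank X - \rank Z)%N.
Proof.
move=> ZX; rewrite -(mxrank_mul_ker X (cokermx Z)).
suff ->: \rank (X :&: kermx (cokermx Z))%MS = \rank Z by rewrite addnK.
apply: eqmx_rank; apply/rV_eqP => u; rewrite sub_capmx sub_kermx -submxE.
by apply: andb_idl => uZ; apply: submx_trans ZX.
Qed.

Lemma card_submx_le (F : finFieldType) r m n (W : 'M[F]_(m, n)) :
  (#|[set X : 'M[F]_(r, n) | (X <= W)%MS]| <= #|F| ^ (r * \rank W))%N.
Proof.
rewrite -card_mx -cardsT.
apply: leq_trans (leq_imset_card (fun Y : 'M[F]_(r, \rank W) => Y *m row_base W) _).
apply: subset_leq_card; apply/subsetP=> X; rewrite inE -(eq_row_base W) => /submxP[D ->].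
exact: imset_f.
Qed.

(** Each fibre of [f] in [D] lies in one right coset of [H]. Working with plain sets allows [D] and
    [H] to be cut out of [A] by membership conditions. *)
Lemma card_fiber_le (gT : finGroupType) (T : finType) (D H : {set gT}) (S : {set T})
    (f : gT -> T) :
  (forall g, g \in D -> f g \in S) ->
  (forall g h, g \in D -> h \in D -> f g = f h -> (g * h^-1)%g \in H) ->
  (#|D| <= #|H| * #|S|)%N.
Proof.
move=> fS fH; rewrite mulnC -sum_nat_const -sum1_card.
rewrite (partition_big f (mem S)) //=; apply: leq_sum => s _; rewrite sum1_card.
case: (pickP [pred g | (g \in D) && (f g == s)]) => [h /andP[hD /eqP fh]|h0]; last first.
  by rewrite eq_card0.
rewrite -(card_rcoset H h); apply: subset_leq_card; apply/subsetP=> g /andP[gD /eqP fg].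
by rewrite mem_rcoset fH ?fg.
Qed.

(* Taking [f g = w (g - 1)] bounds the index of a pointwise stabiliser modulo [Z]. *)
Lemma card_submod_le (F : finFieldType) r n (gT : finGroupType) (D H : {set gT})
    (R Z : 'M[F]_n) (f : gT -> 'M[F]_(r, n)) :
  (Z <= R)%MS ->
  (forall g, g \in D -> (f g <= R)%MS) ->
  (forall g h, g \in D -> h \in D -> (f g - f h <= Z)%MS -> (g * h^-1)%g \in H) ->
  (#|D| <= #|H| * #|F| ^ (r * (\rank R - \rank Z)))%N.
Proof.
move=> ZR fR fH; rewrite -(mxrank_mul_coker ZR).
apply: leq_trans (leq_mul (leqnn _) (card_submx_le r (R *m cokermx Z))).
apply: (@card_fiber_le _ _ _ _ _ (fun g => f g *m cokermx Z)) => [g gD|g h gD hD e].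
  by rewrite inE submxMr ?fR.
by apply: fH => //; rewrite submxE mulmxBl e subrr.
Qed.

(** A vector killed modulo [Z] by the matrices already treated is multiplied by the last power of
    the new matrix that keeps it outside [Z]; commutation preserves what was achieved. *)
Lemma common_kernel (K : fieldType) n (s : seq 'M[K]_n.+1) (Y Z : 'M[K]_n.+1) :
  {in s &, forall X X', X *m X' = X' *m X} ->
  {in s, forall X : 'M_n.+1, exists N, X ^+ N = 0} ->
  {in s, forall X : 'M_n.+1, (Y *m X <= Y)%MS} -> {in s, forall X, (Z *m X <= Z)%MS} ->
  ~~ (Y <= Z)%MS ->
  exists v : 'rV[K]_n.+1,
    [/\ (v <= Y)%MS, ~~ (v <= Z)%MS & {in s, forall X, (v *m X <= Z)%MS}].
Proof.
elim: s => [|X s IH] cs ns Ys Zs YZ.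
  by have [v vY vZ] := notsub_rV YZ; exists v; split.
have sub_s X' : X' \in s -> X' \in X :: s by rewrite inE orbC => ->.
case: IH => //.
- by move=> X1 X2 h1 h2; apply: cs; apply: sub_s.
- by move=> X1 h1; apply: ns; apply: sub_s.
- by move=> X1 h1; apply: Ys; apply: sub_s.
- by move=> X1 h1; apply: Zs; apply: sub_s.
move=> v [vY vZ vs]; have Xs : X \in X :: s by rewrite mem_head.
have powS (W : 'M_n.+1) (u : 'rV_n.+1) j :
    (W *m X <= W)%MS -> (u <= W)%MS -> (u *m X ^+ j <= W)%MS.
  move=> WX uW; elim: j => [|j IHj]; first by rewrite expr0 mulmx1.
  rewrite exprSr -[_ * X]/(_ *m X) mulmxA; exact: submx_trans (submxMr _ IHj) WX.
have ex : exists j, (v *m X ^+ j <= Z)%MS.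
  by have [N XN] := ns X Xs; exists N; rewrite XN mulmx0 sub0mx.
case: (ex_minnP ex) => -[|j]; first by rewrite expr0 mulmx1 (negPf vZ).
move=> vj minj; exists (v *m X ^+ j); split.
- by apply: powS => //; apply: Ys.
- by apply/negP => /minj; rewrite ltnn.
move=> X'; rewrite inE => /predU1P[->|X's].
  by rewrite -mulmxA (_ : X ^+ j *m X = X ^+ j.+1) // exprSr.
rewrite -mulmxA (_ : X ^+ j *m X' = X' *m X ^+ j) ?mulmxA.
  by apply: powS; [apply: Zs | apply: vs].
by apply/esym/(@commrX _ X' X); apply: cs; rewrite ?mem_head ?sub_s.
Qed.

Section Unipotent.
Variables (F : finFieldType) (n p : nat).
Hypothesis pF : p \in [pchar F].

Lemma pchar_mx : p \in [pchar 'M[F]_n.+1].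
Proof.
rewrite inE (pcharf_prime pF) /=; apply/eqP.
by rewrite -[p%:R]/((p%:R) : 'M_n.+1) -(scaler_nat p 1) (pcharf0 pF) scale0r.
Qed.

(** Frobenius for the commuting pair [X], 1. It turns an order that is a power of p into nilpotency
    of g - 1. *)
Lemma subr1_expp (X : 'M[F]_n.+1) e : (X - 1) ^+ (p ^ e)%N = X ^+ (p ^ e)%N - 1.
Proof.
elim: e => [|e IH]; first by rewrite !expr1.
rewrite expnSr exprM IH -!(pFrobenius_autE pchar_mx) pFrobenius_autB_comm ?pFrobenius_aut1 //.
  by rewrite pFrobenius_autE -exprM.
exact: commr1.
Qed.

End Unipotent.

(** * Abelian p-subgroups of the general linear group *)

Section Displacement.
Variables (F : finFieldType) (n : nat).
Implicit Types (g h : {'GL_n.+1[F]}) (A : {set {'GL_n.+1[F]}}).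

Definition displ g : 'M[F]_n.+1 := GLval g - 1.

Lemma displM g h : displ (g * h)%g = displ g + displ h + displ g *m displ h.
Proof.
rewrite /displ [GLval (g * h)]/(GLval g * GLval h) -[(_ - 1) *m _]/((_ - 1) * _).
by rewrite mulrBl mul1r -addrA [GLval h - 1 + _]addrC subrK mulrBr mulr1 [RHS]addrC addrA subrK.
Qed.

Lemma displ_div g h : displ (g * h^-1)%g = (displ g - displ h) *m GLval h^-1%g.
Proof.
rewrite /displ opprB addrA subrK mulmxBl [GLval (g * _)%g]/(GLval g *m GLval h^-1%g); congr (_ - _).
by rewrite -[RHS]/(GLval (h * h^-1)%g) mulgV.
Qed.

Lemma GLvalE g : GLval g = displ g + 1. Proof. by rewrite subrK. Qed.

Lemma mulmx_GLval m (X : 'M[F]_(m, n.+1)) g : X *m GLval g = X *m displ g + X.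
Proof. by rewrite /displ mulmxBr mulmx1 subrK. Qed.

Definition stable_under A (Z : 'M[F]_n.+1) :=
  {in A, forall g, (Z *m displ g <= Z)%MS}.

(* The elements of [A] acting trivially on [(Y + Z) / Z]. *)
Definition section_cent A m (Y : 'M[F]_(m, n.+1)) (Z : 'M[F]_n.+1) : {set {'GL_n.+1[F]}} :=
  [set g in A | (Y *m displ g <= Z)%MS].

Lemma section_centP A m (Y : 'M_(m, n.+1)) Z g :
  reflect (g \in A /\ (Y *m displ g <= Z)%MS) (g \in section_cent A Y Z).
Proof. by rewrite inE; apply: andP. Qed.

(** The injectivity behind every later count: equal displacements modulo [Z] make the quotient
    trivial modulo [Z], the factor [h^-1] being absorbed by stability. *)
Lemma sub_displ_div (A : {group {'GL_n.+1[F]}}) m (X : 'M_(m, n.+1)) Z g h :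
  stable_under A Z -> h \in A ->
  (X *m displ g - X *m displ h <= Z)%MS -> (X *m displ (g * h^-1)%g <= Z)%MS.
Proof.
move=> Zs hA; rewrite displ_div -mulmxBr mulmxA => XZ.
apply: submx_trans (submxMr _ XZ) _.
rewrite GLvalE mulmxDr mulmx1 addmx_sub ?submx_refl ?Zs ?groupV //.
Qed.

Lemma sub_sections (A : {group {'GL_n.+1[F]}}) m (X : 'M_(m, n.+1)) Z g h :
  stable_under A Z -> h \in A ->
  (X *m displ g <= Z)%MS -> (X *m displ h <= Z)%MS -> (X *m displ (g * h^-1)%g <= Z)%MS.
Proof.
move=> Zs hA Xg Xh; apply: (sub_displ_div Zs hA).
by rewrite addmx_sub // eqmx_opp.
Qed.

Lemma displV_sub (A : {group {'GL_n.+1[F]}}) m (X : 'M_(m, n.+1)) Z g :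
  stable_under A Z -> g \in A ->
  (X *m displ g <= Z)%MS -> (X *m displ g^-1%g <= Z)%MS.
Proof.
move=> Zs gA Xg; rewrite -[(g^-1)%g]mul1g.
apply: (sub_sections Zs gA) => //.
by rewrite /displ subrr mulmx0 sub0mx.
Qed.

Lemma section_cent_group_set (A : {group {'GL_n.+1[F]}}) m (Y : 'M_(m, n.+1)) Z :
  stable_under A Z -> group_set (section_cent A Y Z).
Proof.
move=> Zs; apply/group_setP; split.
  by apply/section_centP; split; rewrite ?group1 // /displ subrr mulmx0 sub0mx.
move=> g h /section_centP[gA Yg] /section_centP[hA Yh]; apply/section_centP.
split; first by rewrite groupM.
by rewrite -[h]invgK; apply: (sub_sections Zs); rewrite ?groupV // (displV_sub Zs hA Yh).
Qed.

End Displacement.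

Section AbelianPGroup.
Variables (F : finFieldType) (n p : nat) (A : {group {'GL_n.+1[F]}}).
Hypotheses (pF : p \in [pchar F]) (pA : (p.-group A)%g) (cA : abelian A).

Lemma displC : {in A &, forall g h, displ g *m displ h = displ h *m displ g}.
Proof.
move=> g h gA hA; have /(congr1 (@displ F n)) : (g * h = h * g)%g := centsP cA g gA h hA.
by rewrite !displM [displ h + _]addrC => /addrI.
Qed.

Lemma displ_nilp g : g \in A -> exists N, displ g ^+ N = 0.
Proof.
move=> gA; have /p_natP[e Ae] := pA; exists (p ^ e)%N.
rewrite (subr1_expp pF) -Ae.
suff -> : GLval g ^+ #|A| = 1 by rewrite subrr.
have : (g ^+ #|A|)%g = 1%g by apply/expg_cardG.
move/(congr1 GLval) => /= <-.
elim: {Ae}(#|A|) => [|j IH]; first by rewrite expr0.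
by rewrite expgS exprS IH.
Qed.

Lemma fixed_vector (Y Z : 'M[F]_n.+1) :
  stable_under A Y -> stable_under A Z -> ~~ (Y <= Z)%MS ->
  exists v : 'rV[F]_n.+1,
    [/\ (v <= Y)%MS, ~~ (v <= Z)%MS & {in A, forall g, (v *m displ g <= Z)%MS}].
Proof.
move=> Ys Zs YZ; have memA X : X \in [seq displ g | g in A] -> exists2 g, g \in A & X = displ g.
  by case/imageP=> g gA ->; exists g.
have [||||v [vY vZ vA]] := @common_kernel F n [seq displ g | g in A] Y Z _ _ _ _ YZ.
- by move=> _ _ /memA[g gA ->] /memA[h hA ->]; apply: displC.
- by move=> _ /memA[g gA ->]; apply: displ_nilp.
- by move=> _ /memA[g gA ->]; apply: Ys.
- by move=> _ /memA[g gA ->]; apply: Zs.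
by exists v; split=> // g gA; apply: vA; apply: image_f.
Qed.

Lemma stable_adds_rV (Z : 'M[F]_n.+1) (v : 'rV[F]_n.+1) :
  stable_under A Z -> {in A, forall g, (v *m displ g <= Z)%MS} ->
  stable_under A (Z + v)%MS.
Proof.
move=> Zs vs g gA; rewrite addsmxMr addsmx_sub.
by rewrite !(submx_trans _ (addsmxSl Z v)) ?Zs ?vs.
Qed.

(* [A] acts trivially on [S], so modulo the line [Z1 / Z] an element of the
   centraliser of [V / Z1] is a linear form on [V / (Z + S)]. *)
Lemma abelian_GL_section s (Z : 'M[F]_n.+1) (S := (\sum_(g in A) displ g)%MS) :
  stable_under A Z -> (\rank (Z + S)%MS - \rank Z)%N = s ->
  exists2 z, (z <= s)%N &
   (#|A| <= #|section_cent A 1%:M Z| * #|F| ^ (z * (n.+1 - \rank Z - z)))%N.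
Proof.
elim: s Z => [|s IH] Z Zs rs.
  exists 0%N => //; rewrite muln1; apply: subset_leq_card; apply/subsetP=> g gA.
  apply/section_centP; split=> //; rewrite mul1mx.
  have : (Z + S <= Z)%MS.
    by rewrite -(geq_leqif (mxrank_leqif_sup (addsmxSl Z S))) -subn_eq0 rs.
  by rewrite addsmx_sub submx_refl => /sumsmx_subP/(_ g gA).
have ZS g : g \in A -> (displ g <= Z + S)%MS.
  by move=> gA; apply: submx_trans (addsmxSr _ _); apply: (sumsmx_sup g).
have nZ : ~~ (Z + S <= Z)%MS.
  by rewrite -(geq_leqif (mxrank_leqif_sup (addsmxSl Z S))) -subn_eq0 rs.
have [|v [vI vZ vA]] := fixed_vector _ Zs nZ.
  by move=> g gA; apply: mulmx_sub; apply: ZS.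
set Z1 := (Z + v)%MS.
have Z1s : stable_under A Z1 by apply: stable_adds_rV.
have rZ1 : \rank Z1 = (\rank Z).+1 by apply: mxrank_adds_rV.
have eI : (Z1 + S :=: Z + S)%MS.
  apply/eqmxP; rewrite !addsmx_sub vI addsmxSl addsmxSr /=.
  by rewrite (submx_trans (addsmxSl Z v)) ?addsmxSl ?addsmxSr.
have [|z zs cz] := IH Z1 Z1s.
  by rewrite eI rZ1 subnS rs.
exists z.+1; first by [].
apply: leq_trans cz _.
have rI : (\rank (Z + S)%MS <= n.+1)%N by apply: rank_leq_row.
have rS : (\rank (Z + S)%MS = s.+1 + \rank Z)%N.
  by rewrite -rs subnK // mxrankS ?addsmxSl.
(* [g] sends everything into [Z1], which every [h] moves into [Z]; since [g] and [h] commute, [g]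
   moves the displacements of [h] into [Z] as well. *)
have I0 g : g \in section_cent A 1%:M Z1 -> ((Z + S)%MS *m displ g <= Z)%MS.
  case/section_centP=> gA; rewrite mul1mx => gZ1.
  rewrite addsmxMr addsmx_sub Zs //= (sumsmxMr _ (fun g => displ g)).
  apply/sumsmx_subP=> h hA; rewrite displC //; apply: submx_trans (submxMr _ gZ1) _.
  by rewrite addsmxMr addsmx_sub Zs ?vA.
(* Modulo the smaller centraliser, an element is determined by the images of a complement of
   [Z + S], each taken in the line [Z1 / Z]. *)
have := @card_submod_le F _ n.+1 _ (section_cent A 1%:M Z1) (section_cent A 1%:M Z) Z1 Z
   (fun g => row_base (Z + S)^C%MS *m displ g).
rewrite rZ1 subSn // subnn muln1 => cnt.
apply: leq_trans (leq_mul (cnt _ _ _) (leqnn _)) _.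
- exact: addsmxSl.
- by move=> g /section_centP[gA]; rewrite mul1mx => gZ1; rewrite mulmx_sub.
- move=> g h gD hD; have /section_centP[gA _] := gD; have /section_centP[hA _] := hD.
  rewrite -mulmxBr => gh; apply/section_centP; split; first by rewrite groupM ?groupV.
  apply: (sub_displ_div Zs hA); rewrite -mulmxBr.
  have full : (1%:M <= (Z + S) + row_base (Z + S)^C)%MS.
    by rewrite sub1mx (eq_row_full (adds_eqmx (eqmx_refl _) (eq_row_base _))) addsmx_compl_full.
  apply: submx_trans (submxMr _ full) _; rewrite addsmxMr addsmx_sub gh andbT.
  by rewrite mulmxBr addmx_sub ?eqmx_opp ?I0.
rewrite mxrank_compl -mulnA -expnD leq_mul2l leq_pexp2l ?orbT ?cardG_gt0 //.
  by apply/card_gt0P; exists 0.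
(* The complement has dimension n - rank Z - s. The exponents for z + 1 and z differ by n - rank Z -
   z, so z <= s is enough. *)
rewrite rS -[(n.+1 - _ - z)%N]subnDA -[(_ - z.+1)%N]subnDA addnS -addSn mulSn leq_add2r.
by rewrite leq_sub2l // addSn addnC -addSn leq_add2r.
Qed.

Lemma abelian_GL_card : (#|A| <= #|F| ^ (n.+1 ^ 2 %/ 4))%N.
Proof.
have Zs : stable_under A (0 : 'M_n.+1) by move=> g _; rewrite mul0mx.
have [z _] := abelian_GL_section Zs erefl; rewrite mxrank0 subn0.
have /subset_leq_card : section_cent A 1%:M 0 \subset [set 1%g].
  apply/subsetP=> g /section_centP[_]; rewrite mul1mx submx0 subr_eq0 inE => /eqP g1.
  by apply/eqP/val_inj.
rewrite cards1 => c1 /leq_trans; apply.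
apply: leq_trans (leq_mul c1 (leqnn _)) _; rewrite mul1n leq_pexp2l //.
  by apply/card_gt0P; exists 0.
(* Truncated subtraction makes the product 0 for z > n + 1; otherwise the arithmetic-geometric
   inequality applies. *)
rewrite leq_divRL //; case: (leqP z n.+1) => [zn|/ltnW]; last by rewrite -subn_eq0 => /eqP->; rewrite muln0.
by have := leq_of_leqif (nat_AGM2 z (n.+1 - z)); rewrite subnKC // mulnC.
Qed.

End AbelianPGroup.

(** * Rank parity and the numerical bound *)

(* Equal ranks may differ by canonical structure paths, which [lia] does not see through. *)
Ltac rank_lia :=
  repeat match goal with
  | H : @eq ?T ?a ?b |- _ => lazymatch T with nat => fail | _ => change (@eq nat a b) in H end
  | |- @eq ?T ?a ?b => lazymatch T with nat => fail | _ => change (@eq nat a b) end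
  end;
  repeat match goal with
  | H : @eq nat _ _ |- _ => revert H
  | H : is_true (leq _ _) |- _ => revert H
  end;
  repeat match goal with |- context [@mxrank.body ?K ?m ?n ?X] =>
    let r := fresh "r" in move: (@mxrank.body K m n X) => r end;
  clear; intros; lia.

Section SymmetricParity.
Variable F : finFieldType.

Lemma isotropic_sub m1 m2 n (S : 'M[F]_n) (U : 'M_(m1, n)) (C : 'M_(m2, n)) :
  (U <= C)%MS -> C *m S *m C^T = 0 -> U *m S *m U^T = 0.
Proof.
move=> /submxP[D ->] C0.
by rewrite trmx_mul mulmxA -(mulmxA D) -(mulmxA D) C0 mulmx0 mul0mx.
Qed.

Lemma isotropic_adds_rV n (S W : 'M[F]_n) (x : 'rV_n) :
  W *m S *m W^T = 0 -> W *m S *m x^T = 0 -> x *m S *m W^T = 0 -> x *m S *m x^T = 0 ->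
  (W + x)%MS *m S *m (W + x)%MS^T = 0.
Proof.
move=> WW Wx xW xx; apply: (@isotropic_sub _ _ _ _ _ (col_mx W x)); first by rewrite addsmxE.
by rewrite tr_col_mx mul_col_mx mul_col_row WW Wx xW xx -[RHS]block_mx0.
Qed.

(* A maximal isotropic subspace equals its orthogonal, so the rank is twice its
   codimension. *)
Lemma alternating_rank_even n (S : 'M[F]_n) :
  S^T = - S -> (forall x : 'rV_n, x *m S *m x^T = 0) -> ~~ odd (\rank S).
Proof.
move=> St alt.
have Sflip m1 m2 (X : 'M_(m1, n)) (Y : 'M_(m2, n)) : X *m S *m Y^T = - (Y *m S *m X^T)^T.
  by rewrite !trmx_mul trmxK St mulNmx mulmxN opprK mulmxA.
pose P (W : 'M[F]_n) := W *m S *m W^T == 0.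
have P0 : P 0 by rewrite /P !mul0mx.
case: (@arg_maxnP _ 0 P (fun W => \rank W) P0) => W /eqP WW maxW.
have eK : \rank (kermx (S *m W^T)) = \rank W.
  apply: eqmx_rank; apply/andP; split; last by apply/sub_kermxP; rewrite mulmxA.
  apply/rV_subP=> x /sub_kermxP; rewrite mulmxA => xW; apply/negPn/negP => xnW.
  have /maxW : P (W + x)%MS.
    by apply/eqP/isotropic_adds_rV; rewrite // Sflip xW trmx0 oppr0.
  by rewrite mxrank_adds_rV // /= ltnn.
have := mxrank_mul_ker W S.
have -> : \rank (W :&: kermx S)%MS = \rank (kermx S).
  apply: eqmx_rank; rewrite capmxSr sub_capmx submx_refl andbT.
  apply/rV_subP => x /sub_kermxP xS; apply/negPn/negP => xnW.
  have /maxW : P (W + x)%MS.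
    by apply/eqP/isotropic_adds_rV; rewrite // ?[W *m _ *m _]Sflip xS !mul0mx // trmx0 oppr0.
  by rewrite mxrank_adds_rV // /= ltnn.
have rWS : \rank (S *m W^T) = \rank (W *m S).
  by rewrite -mxrank_tr trmx_mul trmxK St mulmxN mxrank_opp.
move: eK; rewrite !mxrank_ker rWS => eW eS.
have : (\rank W + \rank S + \rank W = n + n)%N.
  have := rank_leq_row W; have := rank_leq_row S; rank_lia.
move/(congr1 odd); rewrite !oddD; case: (odd (\rank S)) => //=.
by case: (odd _); case: (odd _).
Qed.

(** On [K], the orthogonal of [Y], the hypothesis makes the form alternating, hence of even rank.
    The ranks on [K] and on [Y] add up to that of [S] up to twice the dimensions of [Y :&: K] and
    [Y :&: N]. This carries the Dickson invariant from the whole space to a section. *)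
Lemma symmetric_rank_parity m n (S : 'M[F]_n) (Y : 'M_(m, n)) :
  2%N \in [pchar F] -> S^T = S ->
  (forall h : 'rV_n, h *m S *m Y^T = 0 -> h *m S *m h^T = 0) ->
  odd (\rank (Y *m S *m Y^T)) = odd (\rank S).
Proof.
move=> F2 St isoY.
have mxN m1 m2 (X : 'M[F]_(m1, m2)) : - X = X by apply/matrixP=> i j; rewrite !mxE (oppr_pchar2 F2).
have flip m1 m2 (X : 'M_(m1, n)) (Y' : 'M_(m2, n)) : (X *m S *m Y'^T)^T = Y' *m S *m X^T.
  by rewrite !trmx_mul trmxK St mulmxA.
move eK: (kermx (S *m Y^T)) => K; move eN: (kermx S) => N.
have KY : K *m S *m Y^T = 0 by rewrite -eK -mulmxA mulmx_ker.
have NS : N *m S = 0 by rewrite -eN mulmx_ker.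
have evK : ~~ odd (\rank (K *m S *m K^T)).
  apply: alternating_rank_even; first by rewrite mxN flip.
  move=> x; rewrite -!mulmxA -trmx_mul !mulmxA; apply: isoY.
  by rewrite -(mulmxA x) -(mulmxA x) KY mulmx0.
have NK : (N <= K)%MS by rewrite -eK; apply/sub_kermxP; rewrite mulmxA NS mul0mx.
have rT m1 (X : 'M_(m1, n)) : \rank (S *m X^T) = \rank (X *m S).
  by rewrite -mxrank_tr trmx_mul trmxK St.
have rN : (\rank N + \rank S = n)%N by rewrite -eN mxrank_ker subnK ?rank_leq_row.
have rY : (\rank (Y *m S) + \rank (Y :&: N)%MS = \rank Y)%N by rewrite -eN; apply: mxrank_mul_ker.
have rK : (\rank K + \rank (Y *m S) = n)%N by rewrite -eK mxrank_ker rT subnK // -rT rank_leq_row.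
have rYY : (\rank (Y *m S *m Y^T) + \rank (Y :&: K)%MS = \rank Y)%N.
  by rewrite -eK -mulmxA mxrank_mul_ker.
have rKS : (\rank (K *m S) + \rank N = \rank K)%N.
  by rewrite -(mxrank_mul_ker K S) eN (capmx_idPr NK).
have rKK : (\rank (K *m S *m K^T) + \rank (K :&: kermx (S *m K^T))%MS = \rank K)%N.
  by rewrite -mulmxA mxrank_mul_ker.
have rL : (\rank (kermx (S *m K^T)) + \rank (K *m S) = n)%N.
  by rewrite mxrank_ker rT subnK // -rT rank_leq_row.
have rYN := mxrank_sum_cap Y N.
(* Double orthogonality: the orthogonal of [K] is [Y] enlarged by the radical [N] of [S]. *)
have eL : (kermx (S *m K^T) :=: N + Y)%MS.
  apply/eqmx_sym/eqmxP; rewrite -(geq_leqif (mxrank_leqif_eq _)).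
    by rewrite addsmxC; rank_lia.
  rewrite addsmx_sub; apply/andP; split; apply/sub_kermxP; rewrite mulmxA.
    by rewrite NS mul0mx.
  by rewrite -[LHS]trmxK flip KY trmx0.
have rcap : \rank (K :&: kermx (S *m K^T))%MS = \rank (N + (Y :&: K))%MS.
  by rewrite (cap_eqmx (eqmx_refl K) eL) capmxC (matrix_modl _ NK).
have rsum := mxrank_sum_cap N (Y :&: K)%MS.
have rint : \rank (N :&: (Y :&: K))%MS = \rank (Y :&: N)%MS.
  apply: eqmx_rank; rewrite !sub_capmx !capmxSl capmxSr /=.
  rewrite (submx_trans (capmxSr _ _)) ?capmxSl //=.
  by rewrite (submx_trans _ NK) ?capmxSr.
move: evK; have : (\rank (K *m S *m K^T) + \rank (Y *m S *m Y^T) + (\rank (Y :&: K)%MS).*2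
   = \rank S + (\rank (Y :&: N)%MS).*2)%N by rank_lia.
move/(congr1 odd); rewrite !oddD !odd_double !addbF => <- /negPf->.
by rewrite addFb.
Qed.

End SymmetricParity.

(* Bounds the q-logarithm of the order of an abelian group of isometries with a
   fixed space of dimension [k] in a quadratic space of dimension [N]; [j] is the
   dimension contributed by the stabiliser of a singular line. *)
Fixpoint orth_bound N k : nat :=
  match N with
  | N'.+2 => if N' is 0 then 0%N else
      minn 'C(N'.+2 - k, 2)
        (foldr maxn 0%N [seq (j + orth_bound N' j)%N | j <- iota 0 N'.+1 & (j == 0%N) || (k + j <= N'.+1)%N])
  | _ => 0%N
  end.

Lemma orth_boundE N k :
  orth_bound N.+3 k = minn 'C(N.+3 - k, 2) (foldr maxn 0%N
    [seq (j + orth_bound N.+1 j)%N | j <- iota 0 N.+2 & (j == 0%N) || (k + j <= N.+2)%N]).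
Proof. by []. Qed.

Lemma foldr_maxn_ge (s : seq nat) x : x \in s -> (x <= foldr maxn 0%N s)%N.
Proof.
elim: s => //= y s IH; rewrite inE => /predU1P[->|/IH xs]; first exact: leq_maxl.
by rewrite (leq_trans xs) ?leq_maxr.
Qed.

Lemma foldr_maxn_le (s : seq nat) e : {in s, forall x, (x <= e)%N} -> (foldr maxn 0%N s <= e)%N.
Proof.
elim: s => //= y s IH se; rewrite geq_max se ?mem_head //= IH // => x xs.
by rewrite se // inE xs orbT.
Qed.

Lemma orth_bound_rec N k j : (j <= N.+1)%N -> (j == 0%N) || (k + j <= N.+2)%N ->
  (minn 'C(N.+3 - k, 2) (j + orth_bound N.+1 j) <= orth_bound N.+3 k)%N.
Proof.
move=> jN jk; rewrite orth_boundE leq_min geq_minl.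
apply: (leq_trans (geq_minr _ _)); apply: foldr_maxn_ge.
by apply/mapP; exists j => //; rewrite mem_filter jk mem_iota add0n ltnS jN.
Qed.

Lemma orth_bound_le N k e : (forall j, (j <= N.+1)%N -> (j + orth_bound N.+1 j <= e)%N) ->
  (orth_bound N.+3 k <= e)%N.
Proof.
move=> je; rewrite orth_boundE (leq_trans (geq_minr _ _)) // foldr_maxn_le //.
move=> x /mapP[j]; rewrite mem_filter mem_iota => /andP[_ jN] ->; exact: je.
Qed.

Lemma orth_bound_bin N k : (orth_bound N k <= 'C(N - k, 2))%N.
Proof. by case: N => [|[|[|N]]] //; apply: geq_minl. Qed.

(** This compares values of x (x - 3) / 2, which vanishes at 0 and 3 and is negative in between; for
    m = 1, 2 the comparison with i = 0 fails. *)
Lemma add_bin2_mono i m : (i <= m)%N -> (3 <= m)%N -> (m + 'C(i, 2) <= 'C(m, 2) + i)%N.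
Proof.
move=> im; have : (i == 0%N) || (0 < i)%N by case: i {im}.
case/orP=> [/eqP->|i0] m3.
  rewrite bin0n !addn0 -(subnKC m3); elim: (m - 3)%N => // d IH.
  by rewrite addnS binS bin1; rank_lia.
rewrite -(subnKC im); elim: (m - i)%N => [|d IH]; first by rewrite addn0 addnC.
by rewrite addnS binS bin1; rank_lia.
Qed.

(** A gain j <= m is covered by the induction hypothesis; a larger one leaves so many fixed
    dimensions that C(2m - j, 2) takes over. At m = 3 the bound fails, [orth_bound 6 0] being 4, so
    the induction starts by evaluation at m = 4. *)
Lemma orth_bound_even m k : (4 <= m)%N -> (orth_bound m.*2 k <= 'C(m, 2))%N.
Proof.
move=> m4; elim: m m4 k => // m IH; rewrite leq_eqVlt => /predU1P[<- k|m4 k].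
  by apply: orth_bound_le => j; do 7?[case: j => [|j]] => // _; vm_compute.
have [N eN] : exists N, m.*2 = N.+1 by case: m m4 {IH} => // m _; exists m.*2.+1.
rewrite doubleS eN; apply: orth_bound_le; rewrite -eN => j jm; rewrite binS bin1.
case: (leqP j m) => jm'; first by rewrite addnC leq_add // IH.
have h := @add_bin2_mono (m.*2 - j) m.
by have := orth_bound_bin m.*2 j; lia.
Qed.

(** The gains are split as in even dimension. At m = 4 the extreme gain j = 7 already attains C(4,
    2) + 1, with nothing left for the remaining section. *)
Lemma orth_bound_odd m k : (4 <= m)%N -> (orth_bound m.*2.+1 k <= ('C(m, 2)).+1)%N.
Proof.
move=> m4; elim: m m4 k => // m IH; rewrite leq_eqVlt => /predU1P[<- k|m4 k].
  by apply: orth_bound_le => j; do 8?[case: j => [|j]] => // _; vm_compute.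
rewrite doubleS; apply: orth_bound_le => j jm; rewrite binS bin1.
case: (leqP j m) => jm'; first by rewrite addnC -addSn leq_add // IH.
have h := @add_bin2_mono (m.*2.+1 - j) m.
by have := orth_bound_bin m.*2.+1 j; lia.
Qed.

(** * Sections of a reflexive form *)

Section Perp.
Variables (F : finFieldType) (n : nat) (G : 'M[F]_n.+1) (eps : F).
Hypotheses (eps0 : eps != 0) (Gsym : G^T = eps *: G).

Definition perp m (W : 'M[F]_(m, n.+1)) : 'M[F]_n.+1 := kermx (G *m W^T).

Lemma perpP m1 m2 (X : 'M_(m1, n.+1)) (W : 'M_(m2, n.+1)) :
  reflect (X *m G *m W^T = 0) (X <= perp W)%MS.
Proof. by rewrite -mulmxA; apply: sub_kermxP. Qed.

Lemma form_tr m1 m2 (X : 'M_(m1, n.+1)) (Y : 'M_(m2, n.+1)) :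
  (X *m G *m Y^T)^T = eps *: (Y *m G *m X^T).
Proof. by rewrite !trmx_mul trmxK Gsym mulmxA -scalemxAr -scalemxAl. Qed.

(** A nonzero [eps] makes orthogonality symmetric, so that alternating and symmetric forms share the
    same lemmas. *)
Lemma form_flip m1 m2 (X : 'M_(m1, n.+1)) (Y : 'M_(m2, n.+1)) :
  X *m G *m Y^T = 0 -> Y *m G *m X^T = 0.
Proof.
move/(congr1 trmx)/eqP; rewrite form_tr trmx0 scaler_eq0 (negPf eps0) /=.
by move/eqP.
Qed.

Lemma sub_perpC m1 m2 (X : 'M_(m1, n.+1)) (Y : 'M_(m2, n.+1)) :
  (X <= perp Y)%MS -> (Y <= perp X)%MS.
Proof. by move/perpP/form_flip/perpP. Qed.

Lemma perpS m1 m2 (X : 'M_(m1, n.+1)) (Y : 'M_(m2, n.+1)) :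
  (X <= Y)%MS -> (perp Y <= perp X)%MS.
Proof.
move=> XY; apply: sub_perpC; apply: submx_trans XY _; apply: sub_perpC.
exact: submx_refl.
Qed.

Lemma ker_sub_perp m (X : 'M_(m, n.+1)) : (kermx G <= perp X)%MS.
Proof. by apply/perpP; rewrite mulmx_ker mul0mx. Qed.

Lemma mxrank_perp m (X : 'M_(m, n.+1)) :
  (\rank (perp X) + \rank X = n.+1 + \rank (X :&: kermx G)%MS)%N.
Proof.
have := mxrank_mul_ker X G.
have -> : \rank (X *m G) = \rank (G *m X^T).
  rewrite -mxrank_tr trmx_mul Gsym -scalemxAl mxrank_scale_nz //.
rewrite /perp mxrank_ker; have := rank_leq_row (G *m X^T).
rank_lia.
Qed.

Lemma perp_perp (X : 'M_n.+1) : (kermx G <= X)%MS -> (perp (perp X) :=: X)%MS.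
Proof.
move=> kX; apply/eqmx_sym/eqmxP; rewrite -(geq_leqif (mxrank_leqif_eq _)).
  have := mxrank_perp X; have := mxrank_perp (perp X).
  rewrite (capmx_idPr kX) (capmx_idPr (ker_sub_perp X)); rank_lia.
exact/sub_perpC/submx_refl.
Qed.

Lemma sub_perp_adds m m1 m2 (X : 'M_(m, n.+1)) (Y : 'M_(m1, n.+1)) (Z : 'M_(m2, n.+1)) :
  (X <= perp (Y + Z)%MS)%MS = (X <= perp Y)%MS && (X <= perp Z)%MS.
Proof.
apply/idP/andP => [h | [XY XZ]].
  by split; apply: submx_trans h _; rewrite perpS ?addsmxSl ?addsmxSr.
by apply: sub_perpC; rewrite addsmx_sub; apply/andP; split; apply: sub_perpC.
Qed.

(* [Z] lies in the orthogonal of [w], whose complement is spanned by [v]. *)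
Lemma sub_adds_perp m m1 (X : 'M_(m, n.+1)) (Z : 'M_(m1, n.+1)) (v w : 'rV_n.+1) :
  (Z <= perp w)%MS -> ~~ (v <= perp w)%MS -> (X <= Z + v)%MS -> (X <= perp w)%MS ->
  (X <= Z)%MS.
Proof.
move=> Zw vw /sub_addsmxP[[D1 D2] /= ->].
rewrite addrC => Dw; suff D20: D2 = 0 by rewrite D20 mul0mx add0r submxMl.
have {Dw} Dw: (D2 *m v <= perp w)%MS.
  have := addmx_sub Dw (submx_trans (submxMl (- D1) Z) Zw).
  by rewrite mulNmx addrK.
apply/row_matrixP=> i; rewrite row0; apply/eqP; apply: contraNT vw => D2i.
have Di : row i D2 = (row i D2 0 0)%:M by rewrite -mx11_scalar.
have : (row i D2 *m v <= perp w)%MS.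
  by rewrite -row_mul (submx_trans (row_sub _ _)).
rewrite Di mul_scalar_mx => h; have c0 : row i D2 0 0 != 0.
  by apply: contraNneq D2i => e; rewrite Di e -scalemx1 scale0r.
by rewrite -[v]scale1r -(mulVf c0) -scalerA scalemx_sub.
Qed.

End Perp.

Section Isometries.
Variables (F : finFieldType) (n p : nat) (G : 'M[F]_n.+1) (eps : F).
Hypotheses (eps0 : eps != 0) (Gsym : G^T = eps *: G).
Variable A : {group {'GL_n.+1[F]}}.
Hypotheses (pF : p \in [pchar F]) (pA : (p.-group A)%g) (cA : abelian A).
Hypothesis GA : {in A, forall g : {'GL_n.+1[F]}, GLval g *m G *m (GLval g)^T = G}.

Local Notation perp := (perp G).

(** Invariance of [G] says that the adjoint of [g] is its inverse, so the adjoint of g - 1 is g^-1 -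
    1. *)
Lemma displ_adjoint g : g \in A -> displ g *m G = G *m (displ g^-1%g)^T.
Proof.
move=> gA.
have gVT : (GLval g)^T *m (GLval g^-1%g)^T = 1%:M.
  by rewrite -trmx_mul -[X in X^T]/(GLval (g^-1 * g)%g) mulVg trmx1.
have gG : GLval g *m G = G *m (GLval g^-1%g)^T.
  by rewrite -[in RHS](GA gA) -[RHS]mulmxA gVT mulmx1.
by rewrite /displ mulmxBl mul1mx linearB /= mulmxBr trmx1 mulmx1 gG.
Qed.

Lemma displ_form m1 m2 (X : 'M_(m1, n.+1)) (Y : 'M_(m2, n.+1)) g : g \in A ->
  (X *m displ g) *m G *m Y^T = X *m G *m (Y *m displ g^-1%g)^T.
Proof. by move=> gA; rewrite trmx_mul !mulmxA -(mulmxA X) displ_adjoint // mulmxA. Qed.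

(** Obtained by passing to adjoints. With [Y] equal to [Z] it gives the stability of [perp Z]; with
    [Y] a space fixed modulo [Z] it confines displacements to the orthogonal of that space. *)
Lemma displ_perp m1 m2 (X : 'M_(m1, n.+1)) (Y : 'M_(m2, n.+1)) Z g :
  stable_under A Z -> g \in A -> (Y *m displ g <= Z)%MS -> (X <= perp Z)%MS ->
  (X *m displ g <= perp Y)%MS.
Proof.
move=> Zs gA YZ XZ; apply/perpP; rewrite displ_form //; apply/perpP.
by apply: submx_trans XZ _; apply: (perpS eps0 Gsym); exact: (displV_sub Zs gA YZ).
Qed.

Lemma stable_perp Z : stable_under A Z -> stable_under A (perp Z).
Proof. by move=> Zs g gA; apply: (displ_perp Zs gA (Zs g gA)). Qed.

(** Multiplication by [cokermx Z] turns being fixed modulo [Z] into a kernel condition, so that the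
    fixed part of [perp Z / Z] is given by a single matrix. *)
Definition fixmx (Z : 'M[F]_n.+1) : 'M[F]_n.+1 :=
  (perp Z :&: \bigcap_(g in A) kermx (displ g *m cokermx Z))%MS.

Lemma fixmxP m (X : 'M_(m, n.+1)) Z :
  reflect ((X <= perp Z)%MS /\ {in A, forall g, (X *m displ g <= Z)%MS}) (X <= fixmx Z)%MS.
Proof.
rewrite sub_capmx; apply: (iffP andP) => -[XZ Xg]; split=> //.
  move=> g gA; rewrite submxE -mulmxA; apply/eqP/sub_kermxP.
  by have /sub_bigcapmxP/(_ g gA) := Xg.
apply/sub_bigcapmxP=> g gA; apply/sub_kermxP; rewrite mulmxA; apply/eqP.
by rewrite -submxE Xg.
Qed.

Section LineStep.
Variables (Z : 'M[F]_n.+1) (v : 'rV[F]_n.+1).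
Let Z1 := (Z + v)%MS.
Hypotheses (Zs : stable_under A Z) (ZZ : (Z <= perp Z)%MS) (vv : (v <= perp v)%MS).
Hypotheses (vfix : (v <= fixmx Z)%MS) (vZ : ~~ (v <= Z)%MS) (kZ1 : (Z1 :&: kermx G)%MS = 0).

Let D := section_cent A (perp Z1) Z1.

(** The step stops at elements moving [w] into [Z1], because the two kinds of form diverge there:
    modulo [Z], the value of w (g - 1) in the line [Z1 / Z] is free for an alternating form and
    forced to vanish for a quadratic one. *)
Lemma line_step : exists (w : 'rV[F]_n.+1) (U : 'M[F]_n.+1),
  [/\ [/\ (w <= perp Z)%MS, ~~ (w <= perp v)%MS & ~~ (v <= perp w)%MS],
      [/\ (Z1 <= U)%MS, (U <= fixmx Z1)%MS, (U <= perp Z1)%MS &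
          (\rank U = \rank Z1) \/ (\rank (fixmx Z) + \rank U <= n.+1 + \rank (kermx G))%N],
      (#|D| <= #|[set g in A | (perp Z1 *m displ g <= Z)%MS && (w *m displ g <= Z1)%MS]| *
              #|F| ^ (\rank U - \rank Z1))%N
    & {in A, forall g, (w *m displ g <= perp Z1)%MS}].
Proof.
have /fixmxP[vperp vdispl] := vfix.
have Z1s : stable_under A Z1 by apply: stable_adds_rV.
have rZ1 : \rank Z1 = (\rank Z).+1 by apply: mxrank_adds_rV.
have kZ : (Z :&: kermx G)%MS = 0.
  by apply/eqP; rewrite -submx0 -kZ1 capmxS ?addsmxSl.
have Z1iso : (Z1 <= perp Z1)%MS.
  by rewrite (sub_perp_adds eps0 Gsym) // !addsmx_sub ZZ vperp vv (sub_perpC eps0 Gsym vperp).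
(* Since [Z1] meets the radical trivially, [perp Z1] is strictly smaller than [perp Z]. *)
have [w wZ wv] : exists2 w : 'rV_n.+1, (w <= perp Z)%MS & ~~ (w <= perp v)%MS.
  apply: notsub_rV; apply/negP => Zv.
  have : (perp Z <= perp Z1)%MS by rewrite (sub_perp_adds eps0 Gsym) // submx_refl.
  move/mxrankS; have := mxrank_perp eps0 Gsym Z1; have := mxrank_perp eps0 Gsym Z.
  by rewrite kZ kZ1 mxrank0 rZ1; rank_lia.
have vw : ~~ (v <= perp w)%MS by apply: contra wv; apply: (sub_perpC eps0 Gsym).
have Zw : (Z <= perp w)%MS by apply: (sub_perpC eps0 Gsym).
have wg g : g \in A -> (w *m displ g <= perp Z1)%MS.
  move=> gA; rewrite (sub_perp_adds eps0 Gsym) // (displ_perp Zs gA (@Zs g gA) wZ).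
  by rewrite (displ_perp Zs gA (vdispl g gA) wZ).
pose U := (Z1 + \sum_(g in D) <<w *m displ g>>)%MS.
have Z1U : (Z1 <= U)%MS by apply: addsmxSl.
have wU g : g \in D -> (w *m displ g <= U)%MS.
  move=> gD; apply: submx_trans (addsmxSr _ _); apply: (sumsmx_sup g) => //.
  by rewrite genmxE.
have Uperp : (U <= perp Z1)%MS.
  rewrite addsmx_sub Z1iso; apply/sumsmx_subP=> g /section_centP[gA _].
  by rewrite genmxE wg.
exists w, U; split=> //; first split=> //.
- apply/fixmxP; split=> // g gA; rewrite addsmxMr addsmx_sub Z1s //=.
  rewrite (sumsmxMr _ (fun h => <<w *m displ h>>%MS)); apply/sumsmx_subP=> h /section_centP[hA hD].
  rewrite (eqmxMr _ (genmxE _)) -mulmxA (displC cA hA gA) mulmxA.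
  exact: submx_trans (submxMr _ (wg g gA)) hD.
- have [UZ1|nUZ1] := boolP (U <= Z1)%MS; first by left; apply: eqmx_rank; rewrite UZ1.
  right; have [h hD wh] : exists2 h, h \in D & ~~ (w *m displ h <= Z1)%MS.
    apply/exists_inP; apply: contraNT nUZ1 => /exists_inPn allD.
    rewrite addsmx_sub submx_refl; apply/sumsmx_subP=> g gD; rewrite genmxE.
    by have := allD g gD; rewrite negbK.
  have /section_centP[hA hZ1] := hD.
  (* If a fixed [y] were not orthogonal to [v], a combination of [w] and [y] with nonzero
     coefficient at [w] would lie in [perp Z1]; [h] moves it into [Z1] and [y] into [Z], so it would
     move [w] into [Z1], against the choice of [h]. Orthogonality to the displacements of [w] is
     duality. *)
  have fixU : (fixmx Z <= perp U)%MS.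
    have /fixmxP[fixp fixd] := submx_refl (fixmx Z).
    rewrite (sub_perp_adds eps0 Gsym) //; apply/andP; split.
      rewrite (sub_perp_adds eps0 Gsym) // fixp; apply/rV_subP=> y yfix.
      apply: contraNT wh => yv.
      have yp : (y <= perp Z)%MS := submx_trans yfix fixp.
      have yh : (y *m displ h <= Z)%MS by apply: submx_trans (submxMr _ yfix) (fixd h hA).
      pose a := (y *m G *m v^T) 0 0; pose b := (w *m G *m v^T) 0 0.
      have ea : y *m G *m v^T = a%:M by apply: mx11_scalar.
      have eb : w *m G *m v^T = b%:M by apply: mx11_scalar.
      have a0 : a != 0 by apply: contraNneq yv => e; apply/perpP; rewrite ea e -scalemx1 scale0r.
      have y'Z1 : (a *: w - b *: y <= perp Z1)%MS.
        rewrite (sub_perp_adds eps0 Gsym) // addmx_sub ?eqmx_opp ?scalemx_sub //=; apply/perpP.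
        by rewrite !mulmxBl -!scalemxAl ea eb !scale_scalar_mx (mulrC b) subrr.
      have : (a *: (w *m displ h) <= Z1)%MS.
        rewrite scalemxAl -[a *: w](subrK (b *: y)) mulmxDl addmx_sub //.
          exact: submx_trans (submxMr _ y'Z1) hZ1.
        by rewrite -scalemxAl scalemx_sub // (submx_trans yh) ?addsmxSl.
      move/(scalemx_sub a^-1); by rewrite scalerA mulVf // scale1r.
    apply: (sub_perpC eps0 Gsym) => //; apply/sumsmx_subP=> g /section_centP[gA _]; rewrite genmxE.
    exact: (displ_perp Zs gA (fixd g gA) wZ).
  have := mxrankS fixU; have := mxrank_perp eps0 Gsym U.
  have := mxrankS (capmxSr U (kermx G)); rank_lia.
rewrite -[(\rank U - \rank Z1)%N]mul1n.
apply: (card_submod_le Z1U wU) => g h gD hD gh.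
have /section_centP[gA gZ1] := gD; have /section_centP[hA hZ1] := hD.
have ghA : (g * h^-1)%g \in A by rewrite groupM ?groupV.
have wgh : (w *m displ (g * h^-1)%g <= Z1)%MS by apply: (sub_displ_div Z1s hA).
(* The quotient moves [perp Z1] into [Z1] and, by duality with [w], into [perp w]; as [v] is not
   orthogonal to [w], only [Z] remains. *)
rewrite inE ghA wgh andbT; apply: (sub_adds_perp Zw vw).
  exact: (sub_sections Z1s hA).
exact: (displ_perp Z1s ghA wgh).
Qed.

End LineStep.

End Isometries.

(** * Symplectic groups *)

Section SectionBounds.
Variables (F : finFieldType) (n p : nat) (G : 'M[F]_n.+1) (eps : F).
Hypotheses (eps0 : eps != 0) (Gsym : G^T = eps *: G).
Variable A : {group {'GL_n.+1[F]}}.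
Hypotheses (pF : p \in [pchar F]) (pA : (p.-group A)%g) (cA : abelian A).
Hypothesis GA : {in A, forall g : {'GL_n.+1[F]}, GLval g *m G *m (GLval g)^T = G}.

Local Notation perp := (perp G).
Local Notation fixmx := (fixmx G A).
Local Notation cent Z := (section_cent A (perp Z) Z).

Lemma card_scale_min (c a b : nat) :
  (#|A| <= c * #|F| ^ a)%N -> (#|A| <= c * #|F| ^ b)%N -> (#|A| <= c * #|F| ^ minn a b)%N.
Proof. by move=> ha hb; case: (leqP a b). Qed.

Lemma card_scale_mono (c a b : nat) : (a <= b)%N ->
  (#|A| <= c * #|F| ^ a)%N -> (#|A| <= c * #|F| ^ b)%N.
Proof.
move=> ab /leq_trans; apply; rewrite leq_mul2l leq_pexp2l ?orbT //.
by apply/card_gt0P; exists 0.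
Qed.

Lemma fixmx_full Z : (perp Z <= fixmx Z)%MS -> A \subset cent Z.
Proof.
move=> /(fixmxP G) [_ h]; apply/subsetP=> g gA; apply/section_centP; split=> //; exact: h.
Qed.

Lemma sub_fixmx Z : stable_under A Z -> (Z <= perp Z)%MS -> (Z <= fixmx Z)%MS.
Proof. by move=> Zs ZZ; apply/fixmxP. Qed.

Lemma fixmx_stable Z : stable_under A Z -> (Z <= perp Z)%MS -> stable_under A (fixmx Z).
Proof.
move=> Zs ZZ g gA; have /(fixmxP G)[_ h] := submx_refl (fixmx Z).
exact: submx_trans (h g gA) (sub_fixmx Zs ZZ).
Qed.

Lemma trivial_section_card (B : {group {'GL_n.+1[F]}}) Z e :
  B \subset A -> {in B, forall g, (perp Z *m displ g <= Z)%MS} ->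
  (#|B| <= #|cent Z| * #|F| ^ e)%N.
Proof.
move=> BA BZ; apply: leq_trans (leq_pmulr _ _); last by rewrite expn_gt0; apply/orP; left; apply/card_gt0P; exists 0.
apply: subset_leq_card; apply/subsetP=> g gB; apply/section_centP; split; last exact: BZ.
exact: (subsetP BA).
Qed.

Lemma cent0_card : (#|section_cent A (perp (0 : 'M_n.+1)) 0| <= 1)%N.
Proof.
rewrite -(cards1 (1%g : {'GL_n.+1[F]})); apply: subset_leq_card.
apply/subsetP=> g /section_centP[_]; rewrite submx0 => /eqP h.
have full : (1%:M <= perp (0 : 'M_n.+1))%MS by apply/perpP; rewrite trmx0 mulmx0.
have := submxMr (displ g) full; rewrite h mul1mx submx0 subr_eq0 => /eqP g1.
by rewrite inE; apply/eqP/val_inj.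
Qed.

Section Symplectic.
Hypotheses (kG : kermx G = 0) (alt : forall v : 'rV_n.+1, (v <= perp v)%MS).

Let rank_perp m (X : 'M_(m, n.+1)) : (\rank (perp X) + \rank X = n.+1)%N.
Proof. by rewrite (mxrank_perp eps0 Gsym) kG capmx0 mxrank0 addn0. Qed.

(** Adding a vector to [U] costs the dimension of [perp U] over [Z], which is the codimension of [U]
    in [perp Z]; the costs s, s - 1, ..., 1 are summed. *)
Lemma symplectic_fix_bound Z s (B : {group {'GL_n.+1[F]}}) (U : 'M_n.+1) :
  stable_under A Z -> B \subset A -> (Z <= U)%MS -> (U <= perp Z)%MS ->
  {in B, forall g, (U *m displ g <= Z)%MS} -> (s + \rank U = \rank (perp Z))%N ->
  (#|B| <= #|cent Z| * #|F| ^ 'C(s.+1, 2))%N.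
Proof.
move=> Zs; elim: s B U => [|s IH] B U BA ZU UZ BU rU.
  apply: trivial_section_card => // g gB; apply: submx_trans (submxMr _ _) (BU g gB).
  by rewrite -(geq_leqif (mxrank_leqif_sup UZ)) -rU.
have ZsB : stable_under B Z by move=> g gB; apply: Zs; apply: (subsetP BA).
have [w wZ wU] : exists2 w : 'rV_n.+1, (w <= perp Z)%MS & ~~ (w <= U)%MS.
  by apply: notsub_rV; apply/negP => /mxrankS; rank_lia.
pose H := Group (section_cent_group_set w ZsB).
have : (#|B| <= #|H| * #|F| ^ (1 * (\rank (perp U) - \rank Z)))%N.
  apply: (@card_submod_le F 1 n.+1 _ _ _ _ _ (fun g => w *m displ g)).
  - exact: (sub_perpC eps0 Gsym).
  - by move=> g gB; apply: (displ_perp eps0 Gsym GA Zs (subsetP BA g gB) (BU g gB)).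
  - move=> g h gB hB gh; apply/section_centP; split; first by rewrite groupM ?groupV.
    exact: (sub_displ_div ZsB hB).
have -> : (1 * (\rank (perp U) - \rank Z) = s.+1)%N.
  by have := rank_perp U; have := rank_perp Z; rank_lia.
move/leq_trans; apply; rewrite binS bin1 expnD mulnA leq_mul2r; apply/orP; right.
apply: (IH H (U + w)%MS).
- by apply: subset_trans BA; apply/subsetP=> g /section_centP[].
- exact: submx_trans ZU (addsmxSl _ _).
- by rewrite addsmx_sub UZ.
- by move=> g /section_centP[gB wg]; rewrite addsmxMr addsmx_sub BU.
- by rewrite mxrank_adds_rV //; rank_lia.
Qed.

(** A step gains j + 1 instead of j, the value in [Z1 / Z] being free. The shifts s + 2 and k + 1
    absorb this into the recursion of [orth_bound], and the fixed-space bound C(s - k + 1, 2)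
    becomes its binomial. *)
Lemma symplectic_bound_section s Z k :
  stable_under A Z -> (Z <= perp Z)%MS -> (\rank Z + \rank Z + s = n.+1)%N ->
  (k + \rank Z <= \rank (fixmx Z))%N ->
  (#|A| <= #|cent Z| * #|F| ^ orth_bound s.+2 k.+1)%N.
Proof.
elim/ltn_ind: s Z k => s IH Z k Zs ZZ rs kZ.
have [full|nfull] := boolP (perp Z <= fixmx Z)%MS.
  apply: trivial_section_card => // g gA.
  by have /section_centP[] := subsetP (fixmx_full full) g gA.
have Zfix := sub_fixmx Zs ZZ.
have [v [vperp vZ vdispl]] : exists v : 'rV_n.+1,
    [/\ (v <= perp Z)%MS, ~~ (v <= Z)%MS & {in A, forall g, (v *m displ g <= Z)%MS}].
  apply: (fixed_vector pF pA cA) => //; first exact: (stable_perp eps0 Gsym GA Zs).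
  by apply: contra nfull => /submx_trans; apply.
have vfix : (v <= fixmx Z)%MS by apply/fixmxP.
have kZ1 : ((Z + v)%MS :&: kermx G)%MS = 0 by rewrite kG capmx0.
have [w [U [[wZ wv vw] [Z1U Ufix Uperp Urank] cD wg]]] :=
  line_step eps0 Gsym cA GA Zs ZZ (alt v) vfix vZ kZ1.
have rZ1 : \rank (Z + v)%MS = (\rank Z).+1 by apply: mxrank_adds_rV.
have rpZ1 := rank_perp (Z + v)%MS; have rpZ := rank_perp Z; have rUp := mxrankS Uperp.
have rZU := mxrankS Z1U.
have rfix : (\rank (fixmx Z) < \rank (perp Z))%N.
  have sub : (fixmx Z <= perp Z)%MS by apply: capmxSl.
  rewrite ltn_neqAle mxrankS // andbT; apply: contra nfull => /eqP e.
  by rewrite -(geq_leqif (mxrank_leqif_sup sub)) e.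
pose j := (\rank U - \rank (Z + v)%MS)%N.
have e2 : (s = (s - 2).+2)%N by move: rpZ1 rpZ rUp rZU; rewrite rZ1; rank_lia.
have Z1s : stable_under A (Z + v)%MS by apply: stable_adds_rV.
have Z1Z1 : (Z + v <= perp (Z + v)%MS)%MS.
  by apply: submx_trans Z1U Uperp.
have /(IH (s - 2)%N) : (s - 2 < s)%N by rewrite {2}e2 ltnS leqnSn.
move/(_ (Z + v)%MS j Z1s Z1Z1); rewrite -e2 => cA1.
have {cA1} cA1 : (#|A| <= #|section_cent A (perp (Z + v)%MS) (Z + v)%MS| * #|F| ^ orth_bound s j.+1)%N.
  apply: cA1; first by rewrite rZ1; rank_lia.
  by rewrite /j subnK // mxrankS.
set H := [set g in A | _] in cD.
have cH : (#|H| <= #|cent Z| * #|F| ^ (1 * (\rank (Z + v)%MS - \rank Z)))%N.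
  apply: (@card_submod_le F 1 n.+1 _ _ _ _ _ (fun g => w *m displ g)).
  - exact: addsmxSl.
  - by move=> g; rewrite inE => /and3P[].
  - move=> g h; rewrite !inE => /and3P[gA gZ _] /and3P[hA hZ _] gh.
    rewrite groupM ?groupV //=; have gwh := sub_displ_div Zs hA gh.
    have sub : (perp (Z + v)%MS + w <= perp Z)%MS.
      by rewrite addsmx_sub wZ (perpS eps0 Gsym) ?addsmxSl.
    have full : (perp Z <= perp (Z + v)%MS + w)%MS.
      rewrite -(geq_leqif (mxrank_leqif_sup sub)) mxrank_adds_rV; first by rank_lia.
      by rewrite (sub_perp_adds eps0 Gsym) negb_and wv orbT.
    apply: submx_trans (submxMr _ full) _; rewrite addsmxMr addsmx_sub gwh andbT.
    exact: (sub_sections Zs hA).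
rewrite rZ1 subSn // subnn muln1 in cH.
rewrite -/j in cD.
have cstep : (#|A| <= #|cent Z| * #|F| ^ (j.+1 + orth_bound s j.+1))%N.
  apply: leq_trans cA1 _; apply: leq_trans (leq_mul cD (leqnn _)) _.
  apply: leq_trans (leq_mul (leq_mul cH (leqnn _)) (leqnn _)) _.
  by rewrite -!mulnA -!expnD add1n addSn.
have cfix := symplectic_fix_bound (s := (\rank (perp Z) - \rank (fixmx Z))%N) Zs (subxx A) Zfix (capmxSl _ _) _ _.
have {cfix} cfix : (#|A| <= #|cent Z| * #|F| ^ 'C((\rank (perp Z) - \rank (fixmx Z)).+1, 2))%N.
  apply: cfix; last by rewrite subnK // ltnW.
  by have /fixmxP[] := submx_refl (fixmx Z).
have js : (j.+1 <= s)%N by rewrite /j; rank_lia.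
have kjs : (j.+1 == 0)%N || (k.+1 + j.+1 <= s.+1)%N.
  by rewrite orFb /j; case: Urank; rewrite ?kG ?mxrank0; rank_lia.
have := @orth_bound_rec (s - 2).+1 k.+1 j.+1; rewrite -e2 => /(_ js kjs) rec.
apply: card_scale_mono rec _.
apply: card_scale_min cstep; apply: card_scale_mono cfix; apply: leq_bin2l; rank_lia.
Qed.

Lemma symplectic_abelian_card : (#|A| <= #|F| ^ orth_bound n.+3 2)%N.
Proof.
have Zs : stable_under A (0 : 'M_n.+1) by move=> g _; rewrite mul0mx.
have ZZ : ((0 : 'M_n.+1) <= perp (0 : 'M_n.+1))%MS by apply: sub0mx.
have nz : ~~ ((1%:M : 'M[F]_n.+1) <= (0 : 'M[F]_n.+1))%MS.
  by apply/negP => /mxrankS; rewrite mxrank1 mxrank0.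
(* A single nonzero fixed vector gives k = 1, whence the second argument 2. *)
have [|v [_ v0 vfix]] := fixed_vector pF pA cA _ Zs nz; first by move=> g _; apply: submx1.
have {}vfix : (v <= fixmx 0)%MS by apply/fixmxP; split=> //; apply/perpP; rewrite trmx0 mulmx0.
have := @symplectic_bound_section n.+1 0 1 Zs ZZ.
rewrite mxrank0 !add0n addn0 => /(_ erefl) h; apply: leq_trans (h _) _.
  by apply: leq_trans (mxrankS vfix); rewrite rank_rV; case: eqP v0 => // ->; rewrite sub0mx.
by rewrite -[X in (_ <= X)%N]mul1n leq_mul2r cent0_card orbT.
Qed.

End Symplectic.
End SectionBounds.

(** * Quadratic forms *)

Lemma pchar2_sqrt (F : finFieldType) : 2%N \in [pchar F] -> forall a : F, exists c, c ^+ 2 = a.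
Proof.
move=> F2 a; have inj : injective (fun c : F => c ^+ 2).
  move=> x y /eqP; rewrite -subr_eq0 subr_sqr mulf_eq0 subr_eq0 => /orP[/eqP //|].
  by rewrite addr_eq0 (oppr_pchar2 F2) => /eqP.
by exists (invF inj a); rewrite (f_invF inj).
Qed.

Section Quadratic.
Variables (F : finFieldType) (n : nat) (G : 'M[F]_n.+1) (Q : 'rV[F]_n.+1 -> F).
Hypotheses (Gsym : G^T = G).
Hypothesis QZ : forall c x, Q (c *: x) = c ^+ 2 * Q x.
Hypothesis QD : forall x y, Q (x + y) = Q x + Q y + (x *m G *m y^T) 0 0.

Local Notation perp := (perp G).

Lemma Gsym1 : G^T = 1 *: G. Proof. by rewrite scale1r. Qed.

Lemma form_symE (x y : 'rV[F]_n.+1) : (x *m G *m y^T) 0 0 = (y *m G *m x^T) 0 0.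
Proof.
have := congr1 (fun M : 'M_1 => M 0 0) (form_tr Gsym1 x y).
by rewrite scale1r mxE.
Qed.

Lemma quad0 : Q 0 = 0. Proof. by rewrite -(scale0r 0) QZ expr0n mul0r. Qed.

Lemma quadN x : Q (- x) = Q x.
Proof. by rewrite -scaleN1r QZ sqrrN expr1n mul1r. Qed.

Lemma form_mx11 (x y : 'rV[F]_n.+1) : x *m G *m y^T = ((x *m G *m y^T) 0 0)%:M.
Proof. exact: mx11_scalar. Qed.

Lemma perp_rVE (x y : 'rV[F]_n.+1) : (x <= perp y)%MS = ((x *m G *m y^T) 0 0 == 0).
Proof.
apply/perpP/eqP => [->|e]; first by rewrite mxE.
by rewrite form_mx11 e -scalemx1 scale0r.
Qed.

Lemma quadD_perp x y : (x <= perp y)%MS -> Q (x + y) = Q x + Q y.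
Proof. by rewrite perp_rVE QD => /eqP->; rewrite addr0. Qed.

Lemma quadB_perp x y : (x <= perp y)%MS -> Q (x - y) = Q x + Q y.
Proof.
by move=> xy; rewrite quadD_perp ?quadN // perp_rVE linearN /= mulmxN mxE oppr_eq0 -perp_rVE.
Qed.

Lemma form_quad x : (x *m G *m x^T) 0 0 = Q x *+ 2.
Proof.
have := QD x x; rewrite -mulr2n -scaler_nat QZ -[_ + Q x]mulr2n => /eqP.
rewrite addrC -subr_eq => /eqP<-; rewrite -natrX mulr_natl -mulrnBr //.
Qed.

Lemma singular_self_perp x : Q x = 0 -> (x <= perp x)%MS.
Proof. by move=> Qx; rewrite perp_rVE form_quad Qx mul0rn. Qed.

Definition totally_singular m (Z : 'M[F]_(m, n.+1)) :=
  forall z : 'rV_n.+1, (z <= Z)%MS -> Q z = 0.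

Lemma totally_singular_perp m (Z : 'M_(m, n.+1)) : totally_singular Z -> (Z <= perp Z)%MS.
Proof.
move=> Zsing; apply/rV_subP => x xZ; apply: (sub_perpC (oner_neq0 F) Gsym1).
apply/rV_subP => y yZ; rewrite perp_rVE.
by have := QD y x; rewrite !Zsing ?addmx_sub // !add0r => <-.
Qed.

Hypothesis Qker : forall x, (x <= kermx G)%MS -> Q x = 0 -> x = 0.

Lemma totally_singular_ker m (Z : 'M_(m, n.+1)) : totally_singular Z -> (Z :&: kermx G)%MS = 0.
Proof.
move=> Zsing; apply/eqP; rewrite -submx0; apply/rV_subP => x; rewrite sub_capmx => /andP[xZ xk].
by rewrite (Qker xk) ?sub0mx ?Zsing.
Qed.

Lemma totally_singular_adds (Z : 'M_n.+1) (v : 'rV_n.+1) :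
  totally_singular Z -> (v <= perp Z)%MS -> Q v = 0 -> totally_singular (Z + v)%MS.
Proof.
move=> Zsing vZ Qv z /sub_addsmxP[[D1 D2] /= ->].
have -> : D2 *m v = D2 0 0 *: v by rewrite [D2]mx11_scalar mul_scalar_mx -mx11_scalar.
rewrite addrC quadD_perp ?QZ ?Qv ?mulr0 ?Zsing ?addr0 ?submxMl //.
by rewrite scalemx_sub // (submx_trans vZ) // (perpS (oner_neq0 F) Gsym1) ?submxMl.
Qed.

(** On [Z + t] the form is c ^ 2 Q(t), where c is the coefficient of [t]. *)
Lemma singular_sub_adds (Z : 'M_n.+1) (t x : 'rV_n.+1) :
  totally_singular Z -> (t <= perp Z)%MS -> Q t != 0 -> (x <= Z + t)%MS -> Q x = 0 -> (x <= Z)%MS.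
Proof.
move=> Zsing tZ Qt /sub_addsmxP[[D1 D2] /= ->].
have -> : D2 *m t = D2 0 0 *: t by rewrite [D2]mx11_scalar mul_scalar_mx -mx11_scalar.
rewrite addrC quadD_perp ?QZ; last first.
  by rewrite scalemx_sub // (submx_trans tZ) // (perpS (oner_neq0 F) Gsym1) ?submxMl.
rewrite [Q (D1 *m Z)]Zsing ?submxMl // addr0 => /eqP; rewrite mulf_eq0 (negPf Qt) orbF sqrf_eq0 => /eqP->.
by rewrite scale0r add0r submxMl.
Qed.

(* In characteristic 2 the quadratic form is semilinear on isotropic planes. *)
Lemma singular_combination (t u : 'rV_n.+1) : 2%N \in [pchar F] ->
  (u <= perp t)%MS -> Q t != 0 -> exists c, Q (u - c *: t) = 0.
Proof.
move=> F2 ut Qt; have [c ec] := pchar2_sqrt F2 (Q u / Q t); exists c.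
rewrite quadB_perp ?QZ ?ec ?divfK ?addrr_pchar2 //.
rewrite perp_rVE linearZ /= -scalemxAr mxE mulf_eq0 -perp_rVE ut orbT //.
Qed.

End Quadratic.

Lemma bilinear_ext (K : fieldType) n (M N : 'M[K]_n) :
  (forall x y : 'rV_n, (x *m M *m y^T) 0 0 = (x *m N *m y^T) 0 0) -> M = N.
Proof.
move=> e; apply/matrixP=> i j; have := e (delta_mx 0 i) (delta_mx 0 j).
by rewrite -!rowE trmx_delta -!colE !mxE.
Qed.

Lemma mulr2n_eq0_pchar2 (F : fieldType) (a : F) : a != 0 -> a *+ 2 = 0 -> 2%N \in [pchar F].
Proof.
by move=> a0 /eqP; rewrite -mulr_natl mulf_eq0 (negPf a0) orbF inE.
Qed.

(** * Abelian groups of isometries of a quadratic form *)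

Section Orthogonal.
Variables (F : finFieldType) (n p : nat) (G : 'M[F]_n.+1) (Q : 'rV[F]_n.+1 -> F).
Hypotheses (Gsym : G^T = G).
Hypothesis QZ : forall c x, Q (c *: x) = c ^+ 2 * Q x.
Hypothesis QD : forall x y, Q (x + y) = Q x + Q y + (x *m G *m y^T) 0 0.
Hypothesis Qker : forall x, (x <= kermx G)%MS -> Q x = 0 -> x = 0.
Variable A : {group {'GL_n.+1[F]}}.
Hypotheses (pF : p \in [pchar F]) (pA : (p.-group A)%g) (cA : abelian A).
Hypothesis QA : {in A, forall (g : {'GL_n.+1[F]}) x, Q (x *m GLval g) = Q x}.
Hypothesis dickson : 2%N \in [pchar F] -> kermx G = 0 ->
  {in A, forall g, (g^-1 = g)%g /\ ~~ odd (\rank (displ g))}.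

Local Notation perp := (perp G).
Local Notation fixmx := (fixmx G A).
Local Notation cent Z := (section_cent A (perp Z) Z).
Let eps0 := oner_neq0 F.
Let Gs := Gsym1 Gsym.

Lemma form_invariant : {in A, forall g : {'GL_n.+1[F]}, GLval g *m G *m (GLval g)^T = G}.
Proof.
move=> g gA; apply: bilinear_ext => x y.
have := QD (x *m GLval g) (y *m GLval g); rewrite -mulmxDl !QA // QD => /addrI->.
by rewrite trmx_mul !mulmxA.
Qed.
Let GA := form_invariant.

(** Hence x (g - 1) is singular exactly when it is orthogonal to [x]; this removes the parameter
    that stays free in the symplectic case. *)
Lemma quad_displ g x : g \in A -> Q (x *m displ g) = - (x *m G *m (x *m displ g)^T) 0 0.
Proof.
move=> gA; apply/eqP; rewrite -addr_eq0; apply/eqP.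
have : Q (x + x *m displ g) = Q x by rewrite -(QA gA x) mulmx_GLval addrC.
by rewrite QD -addrA -[RHS]addr0 => /addrI.
Qed.

Lemma quad_displ_perp g x : g \in A -> (x *m displ g <= perp x)%MS -> Q (x *m displ g) = 0.
Proof.
move=> gA /(sub_perpC eps0 Gs); rewrite quad_displ // perp_rVE // => /eqP->; exact: oppr0.
Qed.

Lemma singular_displ_perp g x : g \in A -> Q (x *m displ g) = 0 -> (x *m displ g <= perp x)%MS.
Proof.
move=> gA; rewrite quad_displ // => /eqP; rewrite oppr_eq0 => e; apply: (sub_perpC eps0 Gs).
by rewrite perp_rVE.
Qed.

(** The displacement of a radical vector is again in the radical and, being orthogonal to that
    vector, singular; so it is 0. *)
Lemma ker_sub_fixmx Z : (kermx G <= fixmx Z)%MS.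
Proof.
apply/fixmxP; split; first exact: ker_sub_perp.
move=> g gA; apply/rV_subP => x /submxP[D ->].
rewrite mulmxA; set e := D *m _; have ek : (e <= kermx G)%MS by apply: submxMl.
have perpe m (y : 'M_(m, n.+1)) : (e <= perp y)%MS by apply: submx_trans ek (ker_sub_perp _ _).
suff -> : e *m displ g = 0 by apply: sub0mx.
apply: Qker.
  by apply/sub_kermxP; rewrite -mulmxA (displ_adjoint GA) // mulmxA (sub_kermxP ek) mul0mx.
by apply: quad_displ_perp => //; apply: (sub_perpC eps0 Gs).
Qed.

Section SingularSection.
Variable Z : 'M[F]_n.+1.
Hypotheses (Zs : stable_under A Z) (Zsing : totally_singular Q Z).

Let ZZ : (Z <= perp Z)%MS := totally_singular_perp Gsym QD Zsing.
Let kZ : (Z :&: kermx G)%MS = 0 := totally_singular_ker Qker Zsing.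

Let rank_perpZ : (\rank (perp Z) + \rank Z = n.+1)%N.
Proof. by rewrite (mxrank_perp eps0 Gs) kZ mxrank0 addn0. Qed.

Lemma perp_perp_singular (x : 'rV_n.+1) : (perp Z <= perp x)%MS -> (x <= Z + kermx G)%MS.
Proof.
move=> h; rewrite -(perp_perp eps0 Gs (addsmxSr Z (kermx G))); apply: (sub_perpC eps0 Gs).
by apply: submx_trans h; rewrite (perpS eps0 Gs) ?addsmxSl.
Qed.

Lemma singular_mod_ker (x : 'rV_n.+1) : (x <= Z + kermx G)%MS -> Q x = 0 -> (x <= Z)%MS.
Proof.
move=> /sub_addsmxP[[D1 D2] /= ->] Qx; suff -> : D2 *m kermx G = 0 by rewrite addr0 submxMl.
have kp m (y : 'M_(m, n.+1)) : (D2 *m kermx G <= perp y)%MS.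
  by apply: submx_trans (submxMl _ _) (ker_sub_perp _ _).
apply: (Qker (submxMl _ _)); rewrite -Qx addrC (quadD_perp QD) ?kp //.
by rewrite (Zsing (submxMl _ _)) addr0.
Qed.

(* An involution with even Dickson invariant cannot act on [perp Z / Z] as a
   transvection. *)
Lemma involution_section (U : 'M[F]_n.+1) g : 2%N \in [pchar F] -> kermx G = 0 ->
  g \in A -> (U <= perp Z)%MS -> (\rank (perp Z) <= (\rank U).+1)%N ->
  (U *m displ g <= Z)%MS -> (perp Z *m displ g <= Z)%MS.
Proof.
move=> F2 kG gA UZ rU Ug; have [gV rg] := dickson F2 kG gA.
(* [S] is symmetric because [g] is an involution, and it has the rank of g - 1 because [G] is
   invertible here. *)
pose S := displ g *m G.
have St : S^T = S by rewrite trmx_mul Gsym /S (displ_adjoint GA) // gV.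
have pp : (perp (perp Z) <= Z)%MS by rewrite (perp_perp eps0 Gs) ?kG ?sub0mx.
have rS : ~~ odd (\rank S) by rewrite /S mxrankMfree // -kermx_eq0 kG.
have := symmetric_rank_parity (Y := perp Z) F2 St; rewrite (negPf rS) => par.
have {par} ev : odd (\rank (perp Z *m S *m (perp Z)^T)) = false.
  apply: par => h; rewrite /S [h *m _]mulmxA => /perpP hZ.
  have hsing : Q (h *m displ g) = 0 by apply/Zsing/(submx_trans hZ).
  by apply/perpP; apply: singular_displ_perp.
have := mxrank_mul_ker (perp Z) (S *m (perp Z)^T); rewrite mulmxA => rYY.
have Uk : (U <= perp Z :&: kermx (S *m (perp Z)^T))%MS.
  rewrite sub_capmx UZ; apply/sub_kermxP; rewrite !mulmxA; apply/perpP.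
  by apply: submx_trans Ug _; apply: (sub_perpC eps0 Gs).
(* [U] lies in the radical of the form induced on [perp Z] and has codimension at most 1; parity
   then makes the rank 0. *)
have r1 : (\rank (perp Z *m S *m (perp Z)^T) <= 1)%N.
  have := mxrankS Uk; rank_lia.
have : \rank (perp Z *m S *m (perp Z)^T) == 0%N by case: (\rank _) ev r1 => [|[|]].
rewrite mxrank_eq0 /S [perp Z *m (_ *m _)]mulmxA => /eqP/perpP h; exact: submx_trans h pp.
Qed.

(* The displacements [t] of [w] satisfy [Q t + B (t, w) = 0]; subtracting
   [B (t, w) m0] for a singular [m0] with [B (m0, w) = 1] moves them into the
   orthogonal of [w] without losing information. *)
Lemma singular_step_card (B : {group {'GL_n.+1[F]}}) (U : 'M[F]_n.+1) (m0 w : 'rV[F]_n.+1) :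
  B \subset A -> (Z <= U)%MS -> (U <= perp Z)%MS -> {in B, forall g, (U *m displ g <= Z)%MS} ->
  (perp U <= U)%MS -> (m0 <= perp U)%MS -> Q m0 = 0 -> (w <= perp Z)%MS -> ~~ (w <= perp m0)%MS ->
  (#|B| <= #|section_cent B w Z| * #|F| ^ (\rank (perp U) - \rank Z).-1)%N.
Proof.
move=> BA ZU UZ BU MU m0M Qm0 wZ wm0.
have ZsB : stable_under B Z by move=> g gB; apply: Zs; apply: (subsetP BA).
pose b (x : 'rV[F]_n.+1) := (x *m G *m w^T) 0 0.
have b0 : b m0 != 0.
  by rewrite /b -perp_rVE; apply: contra wm0; apply: (sub_perpC eps0 Gs).
have bD (x y : 'rV[F]_n.+1) : b (x + y) = b x + b y by rewrite /b !mulmxDl mxE.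
have bZ c (x : 'rV[F]_n.+1) : b (c *: x) = c * b x by rewrite /b -!scalemxAl mxE.
pose f (g : {'GL_n.+1[F]}) := w *m displ g - (b (w *m displ g) / b m0) *: m0.
have tM g : g \in B -> (w *m displ g <= perp U)%MS.
  by move=> gB; apply: (displ_perp eps0 Gs GA Zs (subsetP BA g gB) (BU g gB)).
have Qt g : g \in B -> Q (w *m displ g) = - b (w *m displ g).
  move=> gB; rewrite quad_displ ?(subsetP BA) //; congr (- _).
  exact: form_symE.
have ZM : (Z <= perp U)%MS by apply: (sub_perpC eps0 Gs).
pose R := (perp U :&: perp w)%MS.
have fR g : g \in B -> (f g <= R)%MS.
  move=> gB; rewrite sub_capmx; apply/andP; split.
    by rewrite addmx_sub ?tM // eqmx_opp scalemx_sub.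
  by rewrite perp_rVE -/(b _) /f -scaleNr bD bZ mulNr divfK ?subrr.
have rR : (\rank R < \rank (perp U))%N.
  rewrite ltn_neqAle mxrankS ?capmxSl // andbT; apply/negP => /eqP e.
  have : (perp U <= R)%MS by rewrite -(geq_leqif (mxrank_leqif_sup (capmxSl _ _))) e.
  move/(submx_trans m0M); rewrite sub_capmx => /andP[_].
  by rewrite perp_rVE -/(b m0) (negPf b0).
have ZR : (Z <= R)%MS by rewrite sub_capmx ZM; apply: (sub_perpC eps0 Gs).
have Mp (x y : 'rV[F]_n.+1) : (x <= perp U)%MS -> (y <= perp U)%MS -> (x <= perp y)%MS.
  by move=> xM yM; apply: submx_trans xM (perpS eps0 Gs (submx_trans yM MU)).
have Qf g : g \in B -> Q (f g) = Q (w *m displ g).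
  move=> gB; rewrite /f (quadB_perp QZ QD) ?QZ ?Qm0 ?mulr0 ?addr0 //.
  by apply: Mp; rewrite ?tM ?scalemx_sub.
have ff g h : g \in B -> h \in B -> (f g - f h <= Z)%MS -> (g * h^-1)%g \in section_cent B w Z.
  move=> gB hB fgh; apply/section_centP; split; first by rewrite groupM ?groupV.
  apply: (sub_displ_div ZsB hB).
  (* [Q] takes the same value on vectors congruent modulo [Z], and its value on [f g] recovers the
     coefficient subtracted from the displacement. *)
  have QQ : Q (f g) = Q (f h).
    rewrite -(subrK (f h) (f g)) (quadD_perp QD) ?(Zsing fgh) ?add0r //.
    by apply: Mp; [apply: submx_trans fgh ZM | apply: submx_trans (fR h hB) (capmxSl _ _)].
  move: QQ fgh; rewrite !Qf // !Qt // => /oppr_inj bb; rewrite /f bb.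
  by rewrite opprB addrA subrK.
have := card_submod_le ZR fR ff; rewrite mul1n => /leq_trans; apply.
rewrite leq_mul2l leq_pexp2l ?orbT //; first by apply/card_gt0P; exists 0.
have := mxrankS ZR; rank_lia.
Qed.

(** Adding a vector to [U] should cost one less than the dimension of [perp U / Z]. The cases differ
    in what saves this dimension: the position of [perp U] relative to [U], a singular vector of
    [perp U] outside [Z], or the Dickson invariant. *)
Lemma orthogonal_fix_bound s (B : {group {'GL_n.+1[F]}}) (U : 'M[F]_n.+1) :
  B \subset A -> (Z <= U)%MS -> (U <= perp Z)%MS -> (kermx G <= U)%MS ->
  {in B, forall g, (U *m displ g <= Z)%MS} -> (s + \rank U = \rank (perp Z))%N ->
  (#|B| <= #|cent Z| * #|F| ^ 'C(s + \rank (kermx G), 2))%N.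
Proof.
elim: s B U => [|s IH] B U BA ZU UZ kU BU rU.
  apply: trivial_section_card => // g gB; apply: submx_trans (submxMr _ _) (BU g gB).
  by rewrite -(geq_leqif (mxrank_leqif_sup UZ)) -rU.
have ZsB : stable_under B Z by move=> g gB; apply: Zs; apply: (subsetP BA).
have rM : (\rank (perp U) = \rank Z + (s + \rank (kermx G)).+1)%N.
  by have := mxrank_perp eps0 Gs U; rewrite (capmx_idPr kU); rank_lia.
have ZM : (Z <= perp U)%MS by apply: (sub_perpC eps0 Gs).
have step (w : 'rV_n.+1) : (w <= perp Z)%MS -> ~~ (w <= U)%MS ->
    (#|B| <= #|section_cent B w Z| * #|F| ^ (s + \rank (kermx G)))%N ->
    (#|B| <= #|cent Z| * #|F| ^ 'C(s.+1 + \rank (kermx G), 2))%N.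
  move=> wZ wU /leq_trans; apply; rewrite addSn binS bin1 [(_ ^ (_ + (_ + _)))%N]expnD mulnA leq_mul2r; apply/orP; right.
  apply: (IH (Group (section_cent_group_set w ZsB)) (U + w)%MS).
  - by apply: subset_trans BA; apply/subsetP=> g /section_centP[].
  - exact: submx_trans ZU (addsmxSl _ _).
  - by rewrite addsmx_sub UZ.
  - exact: submx_trans kU (addsmxSl _ _).
  - by move=> g /section_centP[gB wg]; rewrite addsmxMr addsmx_sub BU.
  - by rewrite mxrank_adds_rV //; rank_lia.
have nU : ~~ (perp Z <= U)%MS by apply/negP => /mxrankS; rank_lia.
have [MU|nMU] := boolP (perp U <= U)%MS; last first.
  (* Displacements of a vector fixed modulo [U] lie in [perp U :&: U], strictly smaller than
     [perp U]. *)
  have [||w [wZ wU wd]] := fixed_vector pF (pgroupS BA pA) (abelianS BA cA) _ _ nU.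
  - by move=> g gB; apply: (stable_perp eps0 Gs GA Zs); apply: (subsetP BA).
  - by move=> g gB; apply: submx_trans (BU g gB) ZU.
  apply: (step w) => //; pose R := (perp U :&: U)%MS.
  have ZR : (Z <= R)%MS by rewrite sub_capmx ZM.
  have fR g : g \in B -> (w *m displ g <= R)%MS.
    move=> gB; rewrite sub_capmx wd // andbT.
    exact: (displ_perp eps0 Gs GA Zs (subsetP BA g gB) (BU g gB)).
  have fH g h : g \in B -> h \in B -> (w *m displ g - w *m displ h <= Z)%MS ->
      (g * h^-1)%g \in section_cent B w Z.
    move=> gB hB gh; apply/section_centP; split; first by rewrite groupM ?groupV.
    exact: (sub_displ_div ZsB hB).
  have := card_submod_le ZR fR fH; rewrite mul1n => /leq_trans; apply.
  rewrite leq_mul2l leq_pexp2l ?orbT //; first by apply/card_gt0P; exists 0.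
  have : (\rank R < \rank (perp U))%N.
    rewrite ltn_neqAle mxrankS ?capmxSl // andbT; apply: contra nMU => /eqP e.
    have : (perp U <= R)%MS by rewrite -(geq_leqif (mxrank_leqif_sup (capmxSl _ _))) e.
    by rewrite sub_capmx => /andP[].
  rank_lia.
have Mp (x y : 'rV[F]_n.+1) : (x <= perp U)%MS -> (y <= perp U)%MS -> (x <= perp y)%MS.
  by move=> xM yM; apply: submx_trans xM (perpS eps0 Gs (submx_trans yM MU)).
have [/existsP[m0 /and3P[m0M /eqP Qm0 m0Z]] | nex] :=
  boolP [exists m0 : 'rV[F]_n.+1, [&& (m0 <= perp U)%MS, Q m0 == 0 & ~~ (m0 <= Z)%MS]].
  have [w wZ wm0] : exists2 w : 'rV_n.+1, (w <= perp Z)%MS & ~~ (w <= perp m0)%MS.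
    apply: notsub_rV; apply: contra m0Z => /perp_perp_singular h.
    exact: singular_mod_ker.
  apply: (step w) => //.
    by apply: contra wm0 => /submx_trans; apply; apply: (sub_perpC eps0 Gs).
  have := singular_step_card BA ZU UZ BU MU m0M Qm0 wZ wm0.
  by congr (_ <= _ * _ ^ _)%N; rank_lia.
have singM (x : 'rV_n.+1) : (x <= perp U)%MS -> Q x = 0 -> (x <= Z)%MS.
  move=> xM /eqP Qx; apply: contraNT nex => xZ; apply/existsP; exists x.
  by rewrite xM Qx.
(* A nonzero radical vector [e] is nonsingular and forces characteristic 2. Multiples of [e] make
   any vector of [perp U] singular, so [perp U] lies in [Z + kermx G] and [U] would contain
   [perp Z]. *)
have [kG|/rowV0Pn[e ek e0]] := eqVneq (kermx G) 0; last first.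
  have Qe : Q e != 0 by apply: contraNneq e0 => h; rewrite (Qker ek).
  have ep m (y : 'M_(m, n.+1)) : (e <= perp y)%MS by apply: submx_trans ek (ker_sub_perp _ _).
  have F2 : 2%N \in [pchar F].
    apply: (@mulr2n_eq0_pchar2 _ (Q e)) => //; rewrite -(form_quad QZ QD); apply/eqP.
    by rewrite -perp_rVE ep.
  suff MZ : (perp U <= Z + kermx G)%MS.
    case/negP: nU; rewrite -(perp_perp eps0 Gs kU).
    apply: submx_trans (perpS eps0 Gs MZ); rewrite (sub_perp_adds eps0 Gs) submx_refl.
    by apply: (sub_perpC eps0 Gs); apply: ker_sub_perp.
  apply/rV_subP => x xM.
  have [c Qc] := singular_combination QZ QD F2 (sub_perpC eps0 Gs (ep _ x)) Qe.
  rewrite -(subrK (c *: e) x) addmx_sub_adds ?scalemx_sub //.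
  by apply: singM => //; rewrite addmx_sub ?eqmx_opp ?scalemx_sub.
have [F2|nF2] := boolP (2%N \in [pchar F]); last first.
  have : (perp U <= Z)%MS.
    apply/rV_subP => x xM; apply: singM => //; apply: contraNeq nF2 => Qx.
    apply: (mulr2n_eq0_pchar2 Qx); rewrite -(form_quad QZ QD); apply/eqP.
    by rewrite -perp_rVE Mp.
  by move/mxrankS; rank_lia.
(* Two vectors of [perp U] independent modulo [Z] would combine to a singular one. So [U] has
   codimension 1 in [perp Z], the situation of a transvection. *)
have rM1 : (\rank (perp U) <= (\rank Z).+1)%N.
  rewrite leqNgt; apply/negP => rlt.
  have [a aM aZ] : exists2 a : 'rV_n.+1, (a <= perp U)%MS & ~~ (a <= Z)%MS.
    by apply: notsub_rV; apply/negP => /mxrankS; rank_lia.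
  have [b bM bZ] : exists2 b : 'rV_n.+1, (b <= perp U)%MS & ~~ (b <= Z + a)%MS.
    by apply: notsub_rV; apply/negP => /mxrankS; rewrite mxrank_adds_rV //; rank_lia.
  have Qa : Q a != 0 by apply: contraNneq aZ => h; rewrite singM.
  have [c Qc] := singular_combination QZ QD F2 (Mp _ _ bM aM) Qa.
  case/negP: bZ; rewrite -(subrK (c *: a) b) addmx_sub_adds ?scalemx_sub //.
  by apply: singM => //; rewrite addmx_sub ?eqmx_opp ?scalemx_sub.
apply: trivial_section_card => // g gB.
apply: (involution_section F2 kG (subsetP BA g gB) UZ _ (BU g gB)); rank_lia.
Qed.

(** A displacement [t] of a vector fixed modulo [U] lies in [U] and in [perp U]. If [t] is not
    singular, its self-orthogonality forces characteristic 2, where a vector of [U] outside [Z + t]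
    becomes singular after subtracting a multiple of [t]. *)
Lemma singular_fixed_vector : ~~ (perp Z <= fixmx Z)%MS ->
  (\rank Z + 3 <= \rank (perp Z) + \rank (kermx G))%N ->
  exists v : 'rV_n.+1, [/\ (v <= fixmx Z)%MS, ~~ (v <= Z)%MS & Q v = 0].
Proof.
move=> nfull r3; set U := fixmx Z.
have /fixmxP[UZ Ud] := submx_refl U.
have Us : stable_under A U := fixmx_stable Zs ZZ.
have ZU : (Z <= U)%MS := sub_fixmx Zs ZZ.
have [w [wZ wU wd]] := fixed_vector pF pA cA (stable_perp eps0 Gs GA Zs) Us nfull.
have [g gA tZ] : exists2 g, g \in A & ~~ (w *m displ g <= Z)%MS.
  apply/exists_inP; apply: contraNT wU => /exists_inPn h; apply/fixmxP; split=> // g gA.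
  by have := h g gA; rewrite negbK.
move: tZ (wd g gA) (displ_perp eps0 Gs GA Zs gA (Ud g gA) wZ); set t := w *m displ g.
move=> tZ tU tpU; have [Qt|Qt] := eqVneq (Q t) 0; first by exists t.
have tpZ : (t <= perp Z)%MS := submx_trans tU UZ.
have Upt : (U <= perp t)%MS by apply: (sub_perpC eps0 Gs).
have F2 : 2%N \in [pchar F].
  apply: (mulr2n_eq0_pchar2 Qt); rewrite -(form_quad QZ QD); apply/eqP.
  by rewrite -perp_rVE (submx_trans tU).
have [UZt|/notsub_rV[u uU uZt]] := boolP (U <= Z + t)%MS; last first.
  have [c Qc] := singular_combination QZ QD F2 (submx_trans uU Upt) Qt.
  exists (u - c *: t); split=> //; first by rewrite addmx_sub ?eqmx_opp ?scalemx_sub.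
  by apply: contra uZt => h; rewrite -(subrK (c *: t) u) addmx_sub_adds ?scalemx_sub.
have kZt : (kermx G <= Z + t)%MS by apply: submx_trans (ker_sub_fixmx Z) UZt.
have td : {in A, forall h, (t *m displ h <= Z)%MS}.
  by move=> h hA; apply: submx_trans (submxMr _ tU) (Ud h hA).
have Ps : stable_under A (perp (Z + t)%MS).
  by apply: (stable_perp eps0 Gs GA); apply: stable_adds_rV.
(* Now [U] lies in [Z + t]. The dimension hypothesis excludes the inclusion; otherwise some [y]
   outside [U], orthogonal to [Z + t], has displacements in [Z + t]. These are orthogonal to [y],
   hence singular, hence in [Z], which puts [y] in [U]. *)
have [PU|nPU] := boolP (perp (Z + t)%MS <= U)%MS.
  have := mxrankS (submx_trans PU UZt); have := mxrank_perp eps0 Gs (Z + t)%MS.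
  by rewrite (capmx_idPr kZt) mxrank_adds_rV //; move: rank_perpZ r3; rank_lia.
have [y [yP yU yd]] := fixed_vector pF pA cA Ps Us nPU.
case/negP: yU; apply/fixmxP; split=> [|h hA].
  by apply: submx_trans yP _; rewrite (perpS eps0 Gs) ?addsmxSl.
have yh : (y *m displ h <= Z + t)%MS by apply: submx_trans (yd h hA) UZt.
apply: (singular_sub_adds Gsym QZ QD Zsing tpZ Qt yh); apply: quad_displ_perp => //.
by apply: (sub_perpC eps0 Gs); apply: submx_trans yP (perpS eps0 Gs yh).
Qed.

End SingularSection.

Lemma orthogonal_bound_section s Z k :
  stable_under A Z -> totally_singular Q Z ->
  (\rank Z + \rank Z + s = n.+1 + \rank (kermx G))%N ->
  (k + \rank Z <= \rank (fixmx Z))%N ->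
  (#|A| <= #|cent Z| * #|F| ^ orth_bound s k)%N.
Proof.
elim/ltn_ind: s Z k => s IH Z k Zs Zsing rs kZ.
have ZZ := totally_singular_perp Gsym QD Zsing.
have kerZ := totally_singular_ker Qker Zsing.
have [full|nfull] := boolP (perp Z <= fixmx Z)%MS.
  apply: trivial_section_card => // g gA.
  by have /section_centP[] := subsetP (fixmx_full full) g gA.
have Zfix := sub_fixmx Zs ZZ.
have rpZ : (\rank (perp Z) + \rank Z = n.+1)%N.
  by rewrite (mxrank_perp eps0 Gs) kerZ mxrank0 addn0.
have rfix : (\rank (fixmx Z) < \rank (perp Z))%N.
  have sub : (fixmx Z <= perp Z)%MS by apply: capmxSl.
  rewrite ltn_neqAle mxrankS // andbT; apply: contra nfull => /eqP e.
  by rewrite -(geq_leqif (mxrank_leqif_sup sub)) e.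
have cfix : (#|A| <= #|cent Z| * #|F| ^ 'C(\rank (perp Z) - \rank (fixmx Z) + \rank (kermx G), 2))%N.
  apply: (@orthogonal_fix_bound Z Zs Zsing _ A (fixmx Z)) => //.
  - exact: capmxSl.
  - exact: ker_sub_fixmx.
  - by have /fixmxP[] := submx_refl (fixmx Z).
  - by rewrite subnK // ltnW.
(* For s <= 2 a singular fixed vector may not exist, but any fixed vector outside [Z] brings the
   binomial down to 0. *)
have [s2|s3] := leqP s 2.
  have [v [vZ nvZ vd]] : exists v : 'rV_n.+1,
      [/\ (v <= perp Z)%MS, ~~ (v <= Z)%MS & {in A, forall g, (v *m displ g <= Z)%MS}].
    apply: (fixed_vector pF pA cA) => //; first exact: (stable_perp eps0 Gs GA Zs).
    by apply: contra nfull => /submx_trans; apply.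
  have : (Z + v <= fixmx Z)%MS by rewrite addsmx_sub Zfix; apply/fixmxP.
  move/mxrankS; rewrite mxrank_adds_rV // => rv.
  by apply: card_scale_mono cfix; rewrite bin_small //; rank_lia.
have [|v [vfix vZ Qv]] := singular_fixed_vector Zs Zsing nfull; first by rank_lia.
have /fixmxP[vperp vd] := vfix.
have Z1sing : totally_singular Q (Z + v)%MS by exact: (totally_singular_adds Gsym QZ QD Zsing vperp Qv).
have Z1s : stable_under A (Z + v)%MS by apply: stable_adds_rV.
have kerZ1 := totally_singular_ker Qker Z1sing.
have [w [U [[wZ wv vw] [Z1U Ufix Uperp Urank] cD wg]]] :=
  line_step eps0 Gs cA GA Zs ZZ (singular_self_perp QZ QD Qv) vfix vZ kerZ1.
have rZ1 : \rank (Z + v)%MS = (\rank Z).+1 by apply: mxrank_adds_rV.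
have rpZ1 : (\rank (perp (Z + v)%MS) + \rank (Z + v)%MS = n.+1)%N.
  by rewrite (mxrank_perp eps0 Gs) kerZ1 mxrank0 addn0.
have rUp := mxrankS Uperp; have rZU := mxrankS Z1U.
pose j := (\rank U - \rank (Z + v)%MS)%N.
have e3 : (s = (s - 3).+3)%N by rewrite -addn3 subnK.
have cA1 : (#|A| <= #|section_cent A (perp (Z + v)%MS) (Z + v)%MS| * #|F| ^ orth_bound (s - 3).+1 j)%N.
  apply: IH => //; first by rewrite {2}e3.
    by rewrite rZ1; rank_lia.
  by rewrite /j subnK // mxrankS.
set H := [set g in A | _] in cD.
(* No factor appears: w (g - 1) lies in the totally singular [Z1], so it is orthogonal to [w] and
   therefore in [Z]. *)
have cH : (#|H| <= #|cent Z|)%N.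
  apply: subset_leq_card; apply/subsetP => g; rewrite inE => /and3P[gA gZ wgZ].
  apply/section_centP; split=> //.
  have wgZ' : (w *m displ g <= Z)%MS.
    apply: (sub_adds_perp _ vw wgZ); first exact: (sub_perpC eps0 Gs).
    exact/singular_displ_perp/Z1sing.
  have sub : (perp (Z + v)%MS + w <= perp Z)%MS.
    by rewrite addsmx_sub wZ (perpS eps0 Gs) ?addsmxSl.
  have full : (perp Z <= perp (Z + v)%MS + w)%MS.
    rewrite -(geq_leqif (mxrank_leqif_sup sub)) mxrank_adds_rV; first by rank_lia.
    by rewrite (sub_perp_adds eps0 Gs) negb_and wv orbT.
  by apply: submx_trans (submxMr _ full) _; rewrite addsmxMr addsmx_sub gZ.
rewrite -/j in cD.
have cstep : (#|A| <= #|cent Z| * #|F| ^ (j + orth_bound (s - 3).+1 j))%N.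
  apply: leq_trans cA1 _; apply: leq_trans (leq_mul cD (leqnn _)) _.
  by rewrite expnD mulnA !leq_mul2r cH !orbT.
have js : (j <= (s - 3).+1)%N by rewrite /j; rank_lia.
have kjs : (j == 0)%N || (k + j <= (s - 3).+2)%N.
  by rewrite /j; case: Urank => [->|]; rewrite ?subnn //; rank_lia.
have := orth_bound_rec js kjs; rewrite -e3 => rec.
apply: card_scale_mono rec _.
apply: card_scale_min cstep; apply: card_scale_mono cfix; apply: leq_bin2l; rank_lia.
Qed.

Lemma orthogonal_abelian_card k : (k <= \rank (fixmx 0))%N ->
  (#|A| <= #|F| ^ orth_bound (n.+1 + \rank (kermx G)) k)%N.
Proof.
move=> kfix; have Zs : stable_under A (0 : 'M_n.+1) by move=> g _; rewrite mul0mx.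
have Zsing : totally_singular Q (0 : 'M[F]_n.+1).
  by move=> z; rewrite submx0 => /eqP->; apply: quad0.
have := @orthogonal_bound_section (n.+1 + \rank (kermx G)) 0 k Zs Zsing.
rewrite mxrank0 !add0n addn0 => /(_ erefl kfix) h; apply: leq_trans h _.
by rewrite -[X in (_ <= X)%N]mul1n leq_mul2r cent0_card orbT.
Qed.

(** A vector fixed modulo the radical is fixed: its displacement is radical and singular. This
    provides k = 2 when the radical is a line. *)
Lemma rank_fixmx0 : (\rank (kermx G) < n.+1)%N -> (\rank (kermx G) < \rank (fixmx (0 : 'M_n.+1)))%N.
Proof.
move=> rk; have ks : stable_under A (kermx G).
  move=> g gA; have /fixmxP[_ h] := ker_sub_fixmx 0.
  exact: submx_trans (h g gA) (sub0mx _ _).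
have nk : ~~ ((1%:M : 'M[F]_n.+1) <= kermx G)%MS.
  by apply/negP => /mxrankS; rewrite mxrank1 leqNgt rk.
have [|y [_ yk yd]] := fixed_vector pF pA cA _ ks nk; first by move=> g _; apply: submx1.
rewrite -(mxrank_adds_rV yk); apply: mxrankS; rewrite addsmx_sub ker_sub_fixmx.
apply/fixmxP; split=> [|g gA]; first by apply/perpP; rewrite trmx0 mulmx0.
suff -> : y *m displ g = 0 by apply: sub0mx.
apply: (Qker (yd g gA)); apply: quad_displ_perp => //.
exact: submx_trans (yd g gA) (ker_sub_perp _ _).
Qed.

End Orthogonal.

(** * Elementary abelian subgroups and radicals *)

Section RankBounds.
Variables (F : finFieldType) (n p r : nat).
Hypotheses (pF : p \in [pchar F]) (cardF : #|F| = (p ^ r)%N).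

Let p_pr : prime p := pcharf_prime pF.
Let p_gt1 : (1 < p)%N := prime_gt1 p_pr.

Lemma p_rank_le (X : {set {'GL_n.+1[F]}}) e :
  (forall E : {group {'GL_n.+1[F]}}, E \subset X -> (p.-abelem E)%g -> (#|E| <= #|F| ^ e)%N) ->
  ('r_p(X)%g <= r * e)%N.
Proof.
move=> bound; apply/bigmax_leqP => E; rewrite inE => /andP[EX abE].
have := bound E EX abE; rewrite (card_pgroup (abelem_pgroup abE)) cardF -expnM.
by rewrite (leq_exp2l _ _ p_gt1) pfactorK.
Qed.

Lemma GLval_inj : injective (fun g : {'GL_n.+1[F]} => GLval g : 'M[F]_n.+1).
Proof. exact: val_inj. Qed.

Definition toGL (M : 'M[F]_n.+1) : {'GL_n.+1[F]} := insubd (1%g : {'GL_n.+1[F]}) M.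

Lemma toGLK M : M \in unitmx -> GLval (toGL M) = M.
Proof. by move=> uM; rewrite /toGL; apply: insubdK. Qed.

Lemma mulrn_pchar_mx (N : 'M[F]_n.+1) : N *+ p = 0.
Proof. by rewrite -mulr_natl (pcharf0 (pchar_mx n pF)) mul0r. Qed.

(** Serves both 1 + N and truncated exponentials. [D] is additive only, since the subgroup used in
    characteristic 2 is not stable under scalars in general. Membership may use that p kills the
    image, which yields determinant 1. *)
Lemma p_rank_ge (X : {set {'GL_n.+1[F]}}) (D : {set 'M[F]_n.+1}) (e : 'M[F]_n.+1 -> 'M[F]_n.+1) d :
  0 \in D -> {in D &, forall N N', N + N' \in D} ->
  e 0 = 1 -> {in D &, forall N N', e (N + N') = e N *m e N'} -> {in D &, injective e} ->
  (forall (g : {'GL_n.+1[F]}) N, N \in D -> GLval g = e N -> (g ^+ (p ^ 1))%g = 1%g -> g \in X) ->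
  (#|F| ^ d <= #|D|)%N -> (r * d <= 'r_p(X)%g)%N.
Proof.
move=> D0 DD e0 eD einj eX cD.
have Dn N k : N \in D -> N *+ k \in D.
  by move=> ND; elim: k => [|k IH]; rewrite ?mulr0n // mulrS DD.
have en N k : N \in D -> e (N *+ k) = e N ^+ k.
  by move=> ND; elim: k => [|k IH]; rewrite ?mulr0n ?expr0 // mulrS exprS eD ?Dn ?IH.
have eu N : N \in D -> e N \in unitmx.
  move=> ND; have := en N p ND; rewrite mulrn_pchar_mx e0 => ep.
  have : e N ^+ p \is a GRing.unit by rewrite -ep unitr1.
  by rewrite unitrX_pos // prime_gt0.
have KE N : N \in D -> GLval (toGL (e N)) = e N by move=> ND; apply/toGLK/eu.
have fM N N' : N \in D -> N' \in D -> toGL (e (N + N')) = (toGL (e N) * toGL (e N'))%g.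
  move=> ND ND'; apply: GLval_inj; rewrite KE ?DD // eD //.
  by rewrite -[RHS]/(GLval (toGL (e N)) *m GLval (toGL (e N'))) !KE.
have f0 : toGL (e 0) = 1%g by apply: GLval_inj; rewrite KE // e0.
have fn N k : N \in D -> (toGL (e N) ^+ k)%g = toGL (e (N *+ k)).
  by move=> ND; elim: k => [|k IH]; rewrite ?mulr0n ?expg0 ?f0 // mulrS expgS fM ?Dn ?IH.
have gE : group_set [set toGL (e N) | N in D].
  apply/group_setP; split; first by apply/imsetP; exists 0; rewrite ?f0.
  by move=> _ _ /imsetP[N ND ->] /imsetP[N' ND' ->]; rewrite -fM //; apply/imsetP; exists (N + N'); rewrite ?DD.
pose E := Group gE.
have abE : (p.-abelem E)%g.
  apply/abelemP => //; split.
    apply/centsP => _ /imsetP[N ND ->] _ /imsetP[N' ND' ->].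
    by rewrite /commute -!fM // addrC.
  by move=> _ /imsetP[N ND ->]; rewrite fn // mulrn_pchar_mx f0.
have EX : E \subset X.
  by apply/subsetP => _ /imsetP[N ND ->]; apply: (eX _ N ND (KE N ND)); rewrite expn1 fn // mulrn_pchar_mx f0.
have cE : #|E| = #|D|.
  apply: card_in_imset => N N' ND ND' /(congr1 (fun g => GLval g)); rewrite !KE //.
  exact: einj.
have : (logn p #|E| <= 'r_p(X)%g)%N by apply: logn_le_p_rank; rewrite inE EX.
apply: leq_trans; rewrite -(leq_exp2l _ _ p_gt1) expnM -cardF.
by rewrite -(card_pgroup (abelem_pgroup abE)) cE.
Qed.

(** In characteristic p, 1 is the only root of unity of p-power order. *)
Lemma det_pelem (g : {'GL_n.+1[F]}) k : (g ^+ (p ^ k))%g = 1%g -> \det (GLval g) = 1.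
Proof.
move=> gk; have gk' : GLval g ^+ (p ^ k) = 1.
  move/(congr1 (fun g => GLval g)): gk => /= <-.
  elim: (p ^ k)%N => [|j IH]; first by rewrite expr0.
  by rewrite expgS exprS IH.
have : \det (GLval g) ^+ (p ^ k) = 1.
  rewrite -[RHS](det1 F n.+1) -[1%:M]gk'; elim: (p ^ k)%N => [|j IH].
    by rewrite !expr0 det1.
  by rewrite !exprS det_mulmx IH.
move/eqP; rewrite -subr_eq0 => dk; apply/eqP; rewrite -subr_eq0.
elim: k dk {gk gk'} => [|k IH]; first by rewrite !expr1.
rewrite expnSr exprM => h; apply: IH; move: h.
rewrite -(pFrobenius_autE pF) -[X in _ - X](pFrobenius_aut1 pF) -rmorphB /= pFrobenius_autE.
by rewrite expf_eq0 prime_gt0.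
Qed.

Lemma abelem_expg (X : {group {'GL_n.+1[F]}}) g : (p.-abelem X)%g -> g \in X -> (g ^+ p)%g = 1%g.
Proof. by move=> abX gX; have /abelemP[//|_ ->] := abX. Qed.

End RankBounds.

(** * Subspaces of matrices and the intersection with a radical *)

Section FiniteSubspaces.
Variable F : finFieldType.

Lemma vspace_of_set m n (P : {set 'M[F]_(m, n)}) :
  0 \in P -> (forall c, {in P &, forall u v, c *: u + v \in P}) ->
  exists2 S : {vspace 'M[F]_(m, n)}, (forall u, (u \in S) = (u \in P)) & #|P| = (#|F| ^ \dim S)%N.
Proof.
move=> P0 PZD; have PS : span (enum P) =i P.
  move=> u; apply/idP/idP => [uS|uP]; last by apply: memv_span; rewrite mem_enum.
  rewrite (coord_span (X := in_tuple (enum P)) uS); elim/big_ind: _ => // [v w vP wP|i _].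
    by rewrite -[v]scale1r PZD.
  rewrite -[_ *: _]addr0 PZD // -mem_enum; exact: mem_nth.
exists (span (enum P)) => //.
by rewrite -(@card_vspace F 'M[F]_(m, n)); apply: eq_card => u; rewrite PS.
Qed.

Lemma card_supported (I : finType) (P : {pred I}) :
  #|[set f : {ffun I -> F} | [forall i, (i \notin P) ==> (f i == 0)]]| = (#|F| ^ #|P|)%N.
Proof.
rewrite -(card_pffun_on 0 P (predT : {pred F})) //; apply: eq_card => f.
rewrite inE; apply/forallP/pffun_onP => [h|[h _] i]; last first.
  by apply/implyP => iP; apply: contraNT iP; exact: (subsetP h).
split=> [|x //]; apply/subsetP => i; rewrite inE => fi.
by apply: contraNT fi => iP; apply: (implyP (h i)).
Qed.

End FiniteSubspaces.

Section Radical.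
Variables (F : finFieldType) (n : nat).
Implicit Types (X : {set {'GL_n.+1[F]}}) (W : {vspace 'rV[F]_n.+1}).

Lemma unipotent_radicalP W (g : {'GL_n.+1[F]}) :
  reflect ((forall v : 'rV_n.+1, v \in W -> v *m displ g = 0) /\
           (forall v : 'rV_n.+1, v *m displ g \in W))
          (g \in @unipotent_radical F n.+1 W).
Proof.
have dE (v : 'rV[F]_n.+1) : v *m displ g = v *m GLval g - v by rewrite mulmx_GLval addrK.
apply: (iffP idP) => [|[Wg Vg]].
  rewrite inE => /and3P[_ /forallP h1 /forallP h2]; split=> v.
    by move=> vW; have := h1 v; rewrite vW /= dE => /eqP->; rewrite subrr.
  by rewrite dE; apply: h2.
rewrite inE; apply/and3P; split.
- rewrite inE; apply/forallP => v; apply/implyP => vW.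
  by rewrite mulmx_GLval Wg // add0r.
- by apply/forallP => v; apply/implyP => vW; rewrite -subr_eq0 -dE Wg.
- by apply/forallP => v; rewrite -dE.
Qed.

Lemma mulmx_radical0 W (M N : 'M[F]_n.+1) :
  (forall v : 'rV_n.+1, v *m M \in W) -> (forall v : 'rV_n.+1, v \in W -> v *m N = 0) -> M *m N = 0.
Proof.
by move=> MW WN; apply/row_matrixP => i; rewrite row0 row_mul rowE WN.
Qed.

Lemma unit_add1 (N : 'M[F]_n.+1) : N *m N = 0 -> 1 + N \in unitmx.
Proof.
move=> N0; suff /mulmx1_unit[] : (1 + N) *m (1 - N) = 1%:M by [].
rewrite -[LHS]/((1 + N) * (1 - N)) mulrBr mulr1 mulrDl mul1r [N * N]N0 addr0 addrK //.
Qed.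

Lemma displ_toGL (N : 'M[F]_n.+1) : N *m N = 0 -> displ (toGL (1 + N)) = N.
Proof. by move=> N0; rewrite /displ toGLK ?unit_add1 // addrC addKr. Qed.

Lemma dim_cap_radicalI X W (P : {set 'M[F]_n.+1}) d :
  (forall N, N \in P -> (forall v : 'rV_n.+1, v \in W -> v *m N = 0) /\
                        (forall v : 'rV_n.+1, v *m N \in W)) ->
  (forall g, displ g \in P -> g \in X) ->
  (forall g, g \in X -> g \in @unipotent_radical F n.+1 W -> displ g \in P) ->
  0 \in P -> (forall c, {in P &, forall M N, c *: M + N \in P}) ->
  #|P| = (#|F| ^ d)%N -> @dim_cap_radical F n.+1 X W d.
Proof.
move=> PW PX XP P0 PZ cP; have [S SP cS] := vspace_of_set P0 PZ.
exists S; last by apply/eqP; rewrite -(eqn_exp2l _ _ (finNzRing_gt1 F)) -cS cP.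
apply/setP => N; rewrite inE SP; apply/imsetP/idP => [[g]|NP].
  by rewrite inE => /andP[gX gU] ->; apply: XP.
have [WN VN] := PW N NP; have N0 : N *m N = 0 by apply: mulmx_radical0 VN WN.
exists (toGL (1 + N)); last by rewrite -[LHS](displ_toGL N0).
by rewrite inE PX ?displ_toGL //; apply/unipotent_radicalP; rewrite displ_toGL.
Qed.

(** Products of two displacements from the radical vanish, so N |-> 1 + N is a homomorphism. This is
    the lower bound for SL_m, Sp_2m and SO_2m. *)
Lemma dim_cap_radical_le p r X W d : p \in [pchar F] -> #|F| = (p ^ r)%N ->
  @dim_cap_radical F n.+1 X W d -> (r * d <= 'r_p(X)%g)%N.
Proof.
move=> pF cF [S eS dS].
have SX N : N \in S -> exists2 g, g \in X & N = displ g /\ g \in @unipotent_radical F n.+1 W.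
  move=> NS; have : N \in [set M in S] by rewrite inE.
  by rewrite -eS => /imsetP[g]; rewrite inE => /andP[gX gU] ->; exists g.
apply: (@p_rank_ge F n p r pF cF X [set N in S] (fun N => 1 + N)).
- by rewrite inE mem0v.
- by move=> M N; rewrite !inE; apply: memvD.
- by rewrite addr0.
- move=> M N; rewrite !inE => /SX[g gX [-> /unipotent_radicalP[_ gW]]] /SX[h hX [-> /unipotent_radicalP[hW _]]].
  rewrite -[RHS]/((1 + displ g) * (1 + displ h)) mulrDr mulr1 mulrDl mul1r.
  by rewrite [_ * _](mulmx_radical0 gW hW) addr0 addrA.
- by move=> M N _ _ /addrI.
- move=> g N; rewrite inE => /SX[h hX [-> _]] gh _; suff -> : g = h by [].
  by apply: GLval_inj; rewrite gh (GLvalE h) addrC.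
- by rewrite -dS -(card_vspace S) cardsE.
Qed.

End Radical.

(** * Coordinates adapted to the split forms *)

Section Coordinates.
Variables (F : finFieldType) (n : nat).
Implicit Types (i j k : 'I_n.+1).

(* The pairing of the basis vectors [i] and [rev_ord i] by the split forms makes
   the [low] ones span a maximal totally singular subspace. *)
Definition low i := (i < rev_ord i)%N.

Lemma low_half i : low i = (i < n.+1./2)%N.
Proof. by rewrite /low /=; have := ltn_ord i; lia. Qed.

Lemma low_rev i : low (rev_ord i) = (rev_ord i < i)%N.
Proof. by rewrite /low rev_ordK. Qed.

Lemma rev_low i : low i -> ~~ low (rev_ord i).
Proof. by rewrite low_rev /low -leqNgt => /ltnW. Qed.

Lemma rev_eq_nat i j : (j == rev_ord i) = (rev_ord j == i).
Proof. by apply/eqP/eqP => [->|<-]; rewrite rev_ordK. Qed.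

Lemma low_trichotomy i : [|| low i, i == rev_ord i | low (rev_ord i)].
Proof. by rewrite low_rev /low -val_eqE; case: ltngtP. Qed.

Lemma not_low i : ~~ low i -> i != rev_ord i -> low (rev_ord i).
Proof. by move=> li mi; have := low_trichotomy i; rewrite (negPf li) (negPf mi). Qed.

Lemma low_neq i : low i -> i != rev_ord i.
Proof. by apply: contraTneq => e; rewrite /low -e ltnn. Qed.

Lemma card_low : #|[pred i : 'I_n.+1 | low i]| = n.+1./2.
Proof.
rewrite -sum1_card (eq_bigl (fun i : 'I_n.+1 => (i < n.+1./2)%N)); last exact: low_half.
rewrite -(big_ord_widen n.+1 (fun=> 1%N)) ?sum1_card ?card_ord //.
by lia.
Qed.

Lemma card_lt_low :
  #|[pred ij : 'I_n.+1 * 'I_n.+1 | (ij.1 < ij.2)%N && low ij.2]| = 'C(n.+1./2, 2).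
Proof.
rewrite -sum1_card -(pair_big_dep predT (fun i j : 'I_n.+1 => (i < j)%N && low j) (fun _ _ => 1%N)) /=.
rewrite (exchange_big_dep (fun j => low j)) /=; last by move=> i j _ /andP[].
rewrite (eq_bigr (fun j : 'I_n.+1 => val j)) => [|j lj]; last first.
  rewrite (eq_bigl (fun i : 'I_n.+1 => (i < j)%N)) => [|i]; last by rewrite lj andbT.
  by rewrite -(big_ord_widen n.+1 (fun=> 1%N)) ?sum1_card ?card_ord // ltnW.
rewrite (eq_bigl (fun i : 'I_n.+1 => (i < n.+1./2)%N)) => [|i]; last exact: low_half.
rewrite -(big_ord_widen n.+1 id) -?bin2_sum ?big_mkord //.
by lia.
Qed.

Lemma card_le_low :
  #|[pred ij : 'I_n.+1 * 'I_n.+1 | (ij.1 <= ij.2)%N && low ij.2]| = 'C(n.+1./2 + 1, 2).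
Proof.
rewrite addn1 binS bin1 -card_lt_low -card_low.
rewrite -(cardID [pred ij : 'I_n.+1 * 'I_n.+1 | (ij.1 < ij.2)%N]) /=; congr (_ + _)%N.
  by apply: eq_card => -[i j]; rewrite !inE /=; case: (ltngtP i j); rewrite ?andbF ?andbT.
have diag_inj : injective (fun i : 'I_n.+1 => (i, i)) by move=> i j [].
rewrite -(card_image diag_inj); apply: eq_card => -[i j]; rewrite !inE /=.
apply/idP/imageP => [|[k lk [-> ->]]]; last by rewrite ltnn leqnn.
by case/and3P=> h1 h2 lj; exists j => //; congr (_, _); apply: val_inj => /=; lia.
Qed.

Lemma card_mx_supported (P : {pred 'I_n.+1 * 'I_n.+1}) :
  #|[set N : 'M[F]_n.+1 | [forall i, forall j, ((i, j) \notin P) ==> (N i j == 0)]]| = (#|F| ^ #|P|)%N.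
Proof.
rewrite -card_supported.
pose f (N : 'M[F]_n.+1) := [ffun ij : 'I_n.+1 * 'I_n.+1 => N ij.1 ij.2].
have f_inj : injective f.
  by move=> N N' /ffunP e; apply/matrixP => i j; have := e (i, j); rewrite !ffunE.
rewrite -(card_imset _ f_inj); apply: eq_card => h; rewrite inE; apply/imsetP/forallP.
  case=> N; rewrite inE => /forallP NP -> [i j]; rewrite ffunE; exact: (forallP (NP i)).
move=> hP; exists (\matrix_(i, j) h (i, j)); last by apply/ffunP => -[i j]; rewrite ffunE mxE.
by rewrite inE; apply/forallP => i; apply/forallP => j; rewrite mxE; apply: hP.
Qed.

(** Matrices act on row vectors: zero low rows kill [W], and zero columns elsewhere send everything
    into [W]. In odd dimension the middle index is not low. *)
Definition low_support (N : 'M[F]_n.+1) :=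
  forall i j, ~~ (~~ low i && low j) -> N i j = 0.

Lemma low_space : exists2 W : {vspace 'rV[F]_n.+1},
  (forall v : 'rV_n.+1, v \in W <-> forall i, ~~ low i -> v 0 i = 0) & \dim W = (n.+1)./2.
Proof.
pose P := [set v : 'rV[F]_n.+1 | [forall i, ~~ low i ==> (v 0 i == 0)]].
have PP (v : 'rV_n.+1) : reflect (forall i, ~~ low i -> v 0 i = 0) (v \in P).
  rewrite inE; apply: (iffP forallP) => h i; first by move=> li; apply/eqP/(implyP (h i)).
  by apply/implyP => /h->.
have [||W WP cW] := @vspace_of_set F 1 n.+1 P.
- by apply/PP => i _; rewrite mxE.
- by move=> c u v /PP hu /PP hv; apply/PP => i li; rewrite !mxE hu ?hv // mulr0 addr0.
exists W; first by move=> v; rewrite WP; split=> /PP.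
apply/eqP; rewrite -(eqn_exp2l _ _ (finNzRing_gt1 F)) -cW; apply/eqP.
rewrite -card_low -card_supported.
pose f (v : 'rV[F]_n.+1) := [ffun i : 'I_n.+1 => v 0 i].
have f_inj : injective f.
  by move=> v v' /ffunP e; apply/rowP => i; have := e i; rewrite !ffunE.
rewrite -(card_imset _ f_inj); apply: eq_card => h; rewrite inE; apply/imsetP/forallP.
  by case=> v /PP vP -> i; rewrite ffunE; apply/implyP => /vP->.
move=> hP; exists (\row_i h i); last by apply/ffunP => i; rewrite ffunE mxE.
by apply/PP => i li; rewrite mxE; apply/eqP; apply: (implyP (hP i)).
Qed.

Section LowSpace.
Variable W : {vspace 'rV[F]_n.+1}.
Hypothesis WP : forall v : 'rV_n.+1, v \in W <-> forall i, ~~ low i -> v 0 i = 0.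

Lemma radical_low_support (N : 'M[F]_n.+1) :
  ((forall v : 'rV_n.+1, v \in W -> v *m N = 0) /\ (forall v : 'rV_n.+1, v *m N \in W))
  <-> low_support N.
Proof.
split=> [[WN VN] i j|supp].
  rewrite negb_and negbK => /orP[li|lj]; rewrite -[N i j]/((N) i j).
    have /WN/rowP/(_ j) : delta_mx 0 i \in W.
      by apply/WP => k lk; rewrite mxE eqxx /=; case: eqP lk => // ->; rewrite li.
    by rewrite -rowE !mxE.
  by have /WP/(_ j lj) := VN (delta_mx 0 i); rewrite -rowE mxE.
split=> [v /WP vW|v]; last first.
  apply/WP => j lj; rewrite mxE big1 // => i _.
  by rewrite supp ?mulr0 // negb_and lj orbT.
apply/rowP => j; rewrite !mxE big1 // => i _; have [li|li] := boolP (low i).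
  by rewrite supp ?mulr0 // li.
by rewrite vW ?mul0r.
Qed.

End LowSpace.

(** The common shape of the Gram matrices of both split forms. *)
Definition antidiag (c : 'I_n.+1 -> F) : 'M[F]_n.+1 :=
  \matrix_(i, j) ((j == rev_ord i)%:R * c i).

Lemma antidiag_mull c m (X : 'M[F]_(n.+1, m)) i (j : 'I_m) :
  (antidiag c *m X) i j = c i * X (rev_ord i) j.
Proof.
rewrite mxE (bigD1 (rev_ord i)) //= big1 => [|k ki]; first by rewrite mxE eqxx mul1r addr0.
by rewrite mxE (negPf ki) !mul0r.
Qed.

Lemma antidiag_mulr c m (X : 'M[F]_(m, n.+1)) (i : 'I_m) j :
  (X *m antidiag c) i j = X i (rev_ord j) * c (rev_ord j).
Proof.
rewrite mxE (bigD1 (rev_ord j)) //= big1 => [|k ki]; first by rewrite mxE rev_ordK eqxx mul1r addr0.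
by rewrite mxE rev_eq_nat eq_sym (negPf ki) mul0r mulr0.
Qed.

Lemma antidiag_form c (x y : 'rV[F]_n.+1) :
  (x *m antidiag c *m y^T) 0 0 = \sum_i c i * (x 0 i * y 0 (rev_ord i)).
Proof.
rewrite -mulmxA mxE; apply: eq_bigr => i _.
by rewrite antidiag_mull mxE mulrCA.
Qed.

Lemma antidiag_ker0 c : (forall i, c i != 0) -> kermx (antidiag c) = 0.
Proof.
move=> c0; apply/eqP/rowV0P => x /sub_kermxP /rowP xc; apply/rowP => i.
have := xc (rev_ord i); rewrite antidiag_mulr rev_ordK !mxE => /eqP.
by rewrite mulf_eq0 (negPf (c0 i)) orbF => /eqP.
Qed.

End Coordinates.

(** * The cases of the theorem *)

Section LowRadical.
Variables (F : finFieldType) (n : nat).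
Implicit Types (X : {set {'GL_n.+1[F]}}) (N : 'M[F]_n.+1).

Definition low_supportb N := [forall i, forall j,
  ((i, j) \notin [pred ij : 'I_n.+1 * 'I_n.+1 | ~~ low ij.1 && low ij.2]) ==> (N i j == 0)].

Lemma low_supportP N : reflect (low_support N) (low_supportb N).
Proof.
apply: (iffP forallP) => [h i j ij|h i].
  by apply/eqP; apply: (implyP (forallP (h i) j)); rewrite inE.
by apply/forallP => j; apply/implyP; rewrite inE => /h->.
Qed.

Lemma low_supportZD c N N' : low_support N -> low_support N' -> low_support (c *: N + N').
Proof. by move=> h h' i j ij; rewrite !mxE h ?h' // mulr0 addr0. Qed.

Lemma low_support_mul N N' : low_support N -> low_support N' -> N *m N' = 0.
Proof.
move=> h h'; apply/matrixP => i j; rewrite !mxE big1 // => k _.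
have [lk|lk] := boolP (low k); first by rewrite h' ?mulr0 // lk.
by rewrite h ?mul0r // negb_and lk orbT.
Qed.

Lemma displ_nilp_expg p k (g : {'GL_n.+1[F]}) :
  p \in [pchar F] -> (k <= p)%N -> displ g ^+ k = 0 -> (g ^+ (p ^ 1))%g = 1%g.
Proof.
move=> pF kp gk; apply: GLval_inj; have := subr1_expp pF (GLval g) 1.
rewrite -[GLval g - 1]/(displ g) {1}expn1 -(subnK kp) exprD gk mulr0 subnK //.
move/esym/eqP; rewrite subr_eq0 => /eqP e; rewrite -[RHS]e.
elim: (p ^ 1)%N => [|j IH]; first by rewrite expr0.
by rewrite expgS exprS -IH.
Qed.

Lemma low_support_expg p (g : {'GL_n.+1[F]}) :
  p \in [pchar F] -> low_support (displ g) -> (g ^+ (p ^ 1))%g = 1%g.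
Proof.
move=> pF h; apply: (@displ_nilp_expg p 2) => //; first exact/prime_gt1/(pcharf_prime pF).
exact: low_support_mul.
Qed.

Lemma low_dim_cap X (P : {set 'M[F]_n.+1}) d :
  {in P, forall N, low_support N} ->
  (forall g, displ g \in P -> g \in X) ->
  (forall g, g \in X -> low_support (displ g) -> displ g \in P) ->
  0 \in P -> (forall c, {in P &, forall M N, c *: M + N \in P}) ->
  #|P| = (#|F| ^ d)%N ->
  exists2 W : {vspace 'rV[F]_n.+1}, \dim W = (\dim {: 'rV[F]_n.+1} %/ 2)%N
    & @dim_cap_radical F n.+1 X W d.
Proof.
move=> Psupp PX XP P0 PZ cP; have [W WP dW] := low_space F n.
exists W; first by rewrite dW dimvf -[dim _]/(1 * n.+1)%N; lia.
apply: (dim_cap_radicalI (P := P)) => // [N NP|g gX /unipotent_radicalP gU].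
  by apply/(radical_low_support WP); apply: Psupp.
by apply: XP => //; apply/(radical_low_support WP).
Qed.

End LowRadical.

Section SpecialLinear.
Variables (F : finFieldType) (n p r : nat).
Hypotheses (pF : p \in [pchar F]) (cardF : #|F| = (p ^ r)%N).

Lemma half_sqr m : ((m - m./2) * m./2 = m ^ 2 %/ 4)%N.
Proof.
have e := odd_double_half m; set l := m./2 in e *.
have -> : (m - l = odd m + l)%N by lia.
rewrite -[in (m ^ 2)%N]e; move: (odd m) l {e} => [] l; rewrite ?add0n ?add1n.
  have -> : (l.*2.+1 ^ 2 = l.+1 * l * 4 + 1)%N by rewrite -mul2n expnS expn1; lia.
  by rewrite divnMDl // divn_small ?addn0.
have -> : (l.*2 ^ 2 = l * l * 4)%N by rewrite -mul2n expnS expn1; lia.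
by rewrite mulnK.
Qed.

Lemma SL_radical_rank :
  exists (W : {vspace 'rV[F]_n.+1}) (r' : nat),
    [/\ \dim W = (\dim {: 'rV[F]_n.+1} %/ 2)%N, @dim_cap_radical F n.+1 (SLgroup F n.+1) W r',
        r' = (n.+1 ^ 2 %/ 4)%N & (r * r')%N = 'r_p(SLgroup F n.+1)%g].
Proof.
have [|||||| W dW capW] := @low_dim_cap F n (SLgroup F n.+1) [set N | low_supportb N] (n.+1 ^ 2 %/ 4).
- by move=> N; rewrite inE => /low_supportP.
- move=> g; rewrite inE => /low_supportP h; rewrite inE.
  by rewrite (det_pelem pF (low_support_expg pF h)).
- by move=> g _ /low_supportP; rewrite inE.
- by rewrite inE; apply/low_supportP => i j _; rewrite mxE.
- by move=> c M N; rewrite !inE => /low_supportP hM /low_supportP hN; apply/low_supportP/low_supportZD.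
- rewrite card_mx_supported -half_sqr; congr (_ ^ _)%N.
  have e : #|[pred i : 'I_n.+1 | ~~ low i]| = (n.+1 - n.+1./2)%N.
    by rewrite -(card_low n) -[X in (X - _)%N](card_ord n.+1) -(cardC [pred i | low i]) addKn; apply: eq_card.
  by rewrite -e -[X in (_ * X)%N](card_low n) -cardX; apply: eq_card => -[i j].
exists W, (n.+1 ^ 2 %/ 4)%N; split=> //; apply/eqP; rewrite eqn_leq (dim_cap_radical_le pF cardF capW).
apply: (p_rank_le pF cardF) => E _ abE.
exact: (abelian_GL_card pF (abelem_pgroup abE) (abelem_abelian abE)).
Qed.

End SpecialLinear.

Section AntidiagonalSymmetry.
Variables (F : finFieldType) (n : nat).
Implicit Types (N f : 'M[F]_n.+1).

Definition supported (P : {pred 'I_n.+1 * 'I_n.+1}) : {set 'M[F]_n.+1} :=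
  [set f : 'M[F]_n.+1 | [forall i, forall j, ((i, j) \notin P) ==> (f i j == 0)]].

Lemma supportedP (P : {pred 'I_n.+1 * 'I_n.+1}) f :
  reflect (forall i j, (i, j) \notin P -> f i j = 0) (f \in supported P).
Proof.
rewrite inE; apply: (iffP forallP) => [h i j ij|h i].
  by apply/eqP/(implyP (forallP (h i) j)).
by apply/forallP => j; apply/implyP => /h->.
Qed.

Definition persymmetric N := forall i j, N i j = N (rev_ord j) (rev_ord i).

(** In characteristic 2 the sign rule alone would leave the antidiagonal free; the first clause is
    the difference between symmetric and alternating. *)
Definition antipersymmetric N :=
  (forall i, N i (rev_ord i) = 0) /\ forall i j, N i j = - N (rev_ord j) (rev_ord i).

(** Reversing the row index turns these blocks into symmetric matrices on the low indices,
    determined by the entries with i <= j. *)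
Lemma card_low_persymmetric (P : {set 'M[F]_n.+1}) :
  (forall N, N \in P <-> low_support N /\ persymmetric N) ->
  #|P| = (#|F| ^ 'C(n.+1./2 + 1, 2))%N.
Proof.
move=> PE; rewrite -card_le_low -(card_mx_supported F).
set T := [pred ij | _]; rewrite -/(supported T).
pose h f : 'M[F]_n.+1 := \matrix_(i, j) if (rev_ord i <= j)%N then f (rev_ord i) j else f j (rev_ord i).
have h_inj : {in supported T &, injective h}.
  move=> f f' /supportedP fT /supportedP fT' /matrixP e; apply/matrixP => i j.
  have [ij|ij] := leqP i j; first by have := e (rev_ord i) j; rewrite !mxE !rev_ordK ij.
  by rewrite fT ?fT' // inE leqNgt ij.
rewrite -(card_in_imset h_inj); apply: eq_card => N; apply/idP/imsetP.
  move=> /PE[Ns Np]; exists (\matrix_(i, j) if (i, j) \in T then N (rev_ord i) j else 0).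
    by apply/supportedP => i j ij; rewrite mxE (negPf ij).
  apply/matrixP => i j; rewrite !mxE !inE /=; case: leqP => ij.
    by rewrite /= rev_ordK; case: ifPn => // lj; rewrite Ns // negb_and lj orbT.
  rewrite (ltnW ij) /= Np; case: ifPn => // li.
  by rewrite Ns // negb_and li orbT.
case=> f /supportedP fT ->; apply/PE; split=> i j.
  move=> ij; rewrite mxE; case: leqP => le; apply: fT; rewrite inE /=.
    apply: contra ij => /andP[_ lj]; rewrite lj andbT.
    rewrite -(rev_ordK i); apply: rev_low; move: le lj; rewrite !low_half; exact: leq_ltn_trans.
  apply: contra ij => /andP[_ li]; rewrite -[X in ~~ low X](rev_ordK i) (rev_low li) /=.
  by move: le li; rewrite !low_half; apply: ltn_trans.
rewrite !mxE !rev_ordK; case: (ltngtP (rev_ord i) j) => // e.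
by have -> : rev_ord i = j by apply: val_inj.
Qed.

Lemma card_low_antipersymmetric (P : {set 'M[F]_n.+1}) :
  (forall N, N \in P <-> low_support N /\ antipersymmetric N) ->
  #|P| = (#|F| ^ 'C(n.+1./2, 2))%N.
Proof.
move=> PE; rewrite -card_lt_low -(card_mx_supported F).
set T := [pred ij | _]; rewrite -/(supported T).
pose h f : 'M[F]_n.+1 := \matrix_(i, j) (f (rev_ord i) j - f j (rev_ord i)).
have h_inj : {in supported T &, injective h}.
  move=> f f' /supportedP fT /supportedP fT' /matrixP e; apply/matrixP => i j.
  have [ij|ij] := ltnP i j; last by rewrite fT ?fT' // inE ltnNge ij.
  have := e (rev_ord i) j; rewrite !mxE !rev_ordK (fT j i) ?(fT' j i) ?subr0 //.
    by rewrite inE /= ltnNge (ltnW ij).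
  by rewrite inE /= ltnNge (ltnW ij).
rewrite -(card_in_imset h_inj); apply: eq_card => N; apply/idP/imsetP.
  move=> /PE[Ns [Nd Np]]; exists (\matrix_(i, j) if (i, j) \in T then N (rev_ord i) j else 0).
    by apply/supportedP => i j ij; rewrite mxE (negPf ij).
  apply/matrixP => i j; rewrite !mxE !inE /=; case: (ltngtP (rev_ord i) j) => ij /=.
  - by rewrite rev_ordK subr0; case: ifPn => // lj; rewrite Ns // negb_and lj orbT.
  - rewrite sub0r Np; case: ifPn => // li.
    by rewrite Ns // negb_and li orbT.
  - by rewrite subr0 -(val_inj ij) Nd.
case=> f /supportedP fT ->; apply/PE; split; last first.
  by split=> [i|i j]; rewrite !mxE ?rev_ordK ?subrr // opprB.
move=> i j ij; rewrite mxE; suff [-> ->] : f (rev_ord i) j = 0 /\ f j (rev_ord i) = 0 by rewrite subrr.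
split; apply: fT; rewrite inE /=; apply: contra ij => /andP[le lk].
  rewrite lk andbT -(rev_ordK i); apply: rev_low; move: lk le; rewrite !low_half => lk le.
  exact: ltn_trans le lk.
rewrite -[X in ~~ low X](rev_ordK i) (rev_low lk) /=.
by move: le lk; rewrite !low_half; apply: ltn_trans.
Qed.

End AntidiagonalSymmetry.

Lemma rev_ord_neq n m (i : 'I_n.+1) : n.+1 = m.*2 -> i != rev_ord i.
Proof. by rewrite -val_eqE /=; have := ltn_ord i; lia. Qed.

Section SymplecticGroup.
Variables (F : finFieldType) (n p r : nat).
Hypotheses (pF : p \in [pchar F]) (cardF : #|F| = (p ^ r)%N).
Variable m : nat.
Hypotheses (n2m : n.+1 = m.*2) (m2 : (2 <= m)%N).

Definition alt_sign (i : 'I_n.+1) : F := if low i then 1 else -1.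

Local Notation AG := (antidiag alt_sign).

Lemma split_altE (x y : 'rV[F]_n.+1) : split_alt x y = (x *m AG *m y^T) 0 0.
Proof.
rewrite antidiag_form [RHS](bigID (@low n)) /= /split_alt sumrB; congr (_ + _).
  by apply: eq_bigr => i li; rewrite /alt_sign [low i]li mul1r.
rewrite -sumrN (reindex_inj rev_ord_inj); apply: eq_big => [i|i].
  rewrite rev_ordK -low_rev; apply/idP/idP => [/rev_low|/not_low->//].
    by rewrite rev_ordK.
  exact: (rev_ord_neq _ n2m).
rewrite rev_ordK -low_rev => /rev_low; rewrite rev_ordK /alt_sign => /negPf->.
by rewrite mulN1r.
Qed.

Lemma alt_sign_rev i : alt_sign (rev_ord i) = - alt_sign i.
Proof.
rewrite /alt_sign; case: (boolP (low i)) => [/rev_low/negPf-> //|li].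
by rewrite (not_low li (rev_ord_neq i n2m)) opprK.
Qed.

Lemma alt_formT : AG^T = -1 *: AG.
Proof.
apply/matrixP => i j; rewrite !mxE mulN1r; case: (eqVneq i (rev_ord j)) => [->|ij].
  by rewrite rev_ordK eqxx !mul1r alt_sign_rev opprK.
by rewrite (negPf (_ : j != rev_ord i)) ?mul0r ?oppr0 // rev_eq_nat eq_sym.
Qed.

Lemma SpgroupP (g : {'GL_n.+1[F]}) :
  reflect (GLval g *m AG *m (GLval g)^T = AG) (g \in Spgroup F n.+1).
Proof.
rewrite inE; apply: (iffP idP) => [/forallP h|h].
  apply: bilinear_ext => x y; have /forallP/(_ y)/eqP := h x.
  by rewrite !split_altE trmx_mul !mulmxA.
apply/forallP => x; apply/forallP => y; rewrite !split_altE; apply/eqP.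
by rewrite -[in RHS]h trmx_mul !mulmxA.
Qed.

Lemma low_support_Sp (g : {'GL_n.+1[F]}) : low_support (displ g) ->
  reflect (persymmetric (displ g)) (g \in Spgroup F n.+1).
Proof.
(* The low span is isotropic, so the quadratic term of the invariance equation vanishes and a linear
   condition remains. *)
move=> Ns; have NN0 : displ g *m AG *m (displ g)^T = 0.
  apply/matrixP => i j; rewrite !mxE big1 // => k _; rewrite antidiag_mulr [(_^T) _ _]mxE.
  have [lk|lk] := boolP (low k); last by rewrite [X in _ * X]Ns ?mulr0 // negb_and lk orbT.
  by rewrite Ns ?mul0r // negb_and (rev_low lk) orbT.
have E : GLval g *m AG *m (GLval g)^T = AG + (displ g *m AG + AG *m (displ g)^T).
  rewrite GLvalE linearD /= mulmxDl mulmxDr mulmxDl NN0 add0r trmx1 !mul1mx.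
  by rewrite mulmxDl !mulmx1 addrC -addrA addrC -addrA [_ + displ g *m _]addrC addrA addrC.
have E2 i j : (displ g *m AG + AG *m (displ g)^T) i j = displ g i (rev_ord j) - displ g j (rev_ord i).
  rewrite [LHS]mxE antidiag_mulr antidiag_mull [(_^T) _ _]mxE; congr (_ + _).
    have [lj|lj] := boolP (low (rev_ord j)); first by rewrite /alt_sign lj mulr1.
    by rewrite Ns ?mul0r // negb_and lj orbT.
  have [li|li] := boolP (low (rev_ord i)).
    by have := rev_low li; rewrite rev_ordK /alt_sign => /negPf->; rewrite mulN1r.
  by rewrite Ns ?mulr0 ?oppr0 // negb_and li orbT.
apply: (iffP (SpgroupP g)) => [|h].
  rewrite E -[RHS]addr0 => /addrI /matrixP h i j; have := h i (rev_ord j).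
  by rewrite E2 rev_ordK [X in _ = X]mxE => /eqP; rewrite subr_eq0 => /eqP.
by rewrite E; apply/matrixP => i j; rewrite [LHS]mxE E2 h rev_ordK subrr addr0.
Qed.

Lemma Sp_radical_rank :
  exists (W : {vspace 'rV[F]_n.+1}) (r' : nat),
    [/\ \dim W = (\dim {: 'rV[F]_n.+1} %/ 2)%N, @dim_cap_radical F n.+1 (Spgroup F n.+1) W r',
        r' = 'C(m + 1, 2) & (r * r')%N = 'r_p(Spgroup F n.+1)%g].
Proof.
pose P := [set N : 'M[F]_n.+1 | low_supportb N & [forall i, forall j, N i j == N (rev_ord j) (rev_ord i)]].
have PP N : N \in P <-> low_support N /\ persymmetric N.
  rewrite inE; split=> [/andP[/low_supportP Ns /forallP h]|[/low_supportP -> h]].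
    by split=> // i j; apply/eqP; apply: (forallP (h i)).
  by apply/forallP => i; apply/forallP => j; rewrite -h.
have hm : n.+1./2 = m by rewrite n2m doubleK.
have [|||||| W dW capW] := @low_dim_cap F n (Spgroup F n.+1) P 'C(m + 1, 2).
- by move=> N /PP[].
- by move=> g /PP[Ns h]; apply/low_support_Sp.
- by move=> g gS Ns; apply/PP; split=> //; apply/low_support_Sp.
- by apply/PP; split=> i j; rewrite !mxE.
- move=> c M N /PP[hM sM] /PP[hN sN]; apply/PP; split; first exact: low_supportZD.
  by move=> i j; rewrite !mxE sM sN.
- by rewrite (card_low_persymmetric PP) hm.
exists W, 'C(m + 1, 2); split=> //; apply/eqP.
rewrite eqn_leq (dim_cap_radical_le pF cardF capW); apply: (p_rank_le pF cardF) => E ES abE.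
have EA : {in E, forall g : {'GL_n.+1[F]}, GLval g *m AG *m (GLval g)^T = AG}.
  by move=> g gE; apply/SpgroupP/(subsetP ES).
have AGk : kermx AG = 0.
  by apply: antidiag_ker0 => i; rewrite /alt_sign; case: ifP; rewrite ?oppr_eq0 oner_neq0.
have alt (v : 'rV[F]_n.+1) : (v <= perp AG v)%MS.
  apply/perpP/matrixP => i j; rewrite !ord1 -split_altE mxE /split_alt big1 // => k _.
  by rewrite mulrC subrr.
have N1 : (-1 : F) != 0 by rewrite oppr_eq0 oner_neq0.
have := symplectic_abelian_card N1 alt_formT pF (abelem_pgroup abE) (abelem_abelian abE) EA AGk alt.
move/leq_trans; apply; rewrite leq_pexp2l //; first by apply/card_gt0P; exists 0.
have -> : n.+3 = (m + 1).*2 by rewrite doubleD -n2m; lia.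
(* For m = 2 the value [orth_bound 6 2] is 3 by evaluation; with second argument 0 or 1 it would be
   4. *)
move: m2; rewrite leq_eqVlt => /predU1P[<- //|m3].
by apply: orth_bound_even; rewrite addn1.
Qed.

End SymplecticGroup.

Lemma alternating_formP (R : fieldType) n (S : 'M[R]_n) :
  (forall x : 'rV_n, (x *m S *m x^T) 0 0 = 0) <->
  (forall i, S i i = 0) /\ forall i j, S i j = - S j i.
Proof.
have mxD (X Y : 'M[R]_1) : (X + Y) 0 0 = X 0 0 + Y 0 0 by rewrite mxE.
have mxB (X Y : 'M[R]_1) : (X - Y) 0 0 = X 0 0 - Y 0 0 by rewrite !mxE.
split=> [h|[Sd Sa] x].
  have e i j : ((delta_mx 0 i : 'rV[R]_n) *m S *m (delta_mx 0 j : 'rV[R]_n)^T) 0 0 = S i j.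
    by rewrite -!rowE trmx_delta -!colE !mxE.
  split=> [i|i j]; first by rewrite -e h.
  have := h (delta_mx 0 i + delta_mx 0 j); rewrite linearD /= mulmxDr !mulmxDl.
  rewrite !mxD !h !e add0r addr0 => /eqP.
  by rewrite addrC addr_eq0 => /eqP.
(* The strict upper triangle writes [S] as U - U^T in every characteristic, whereas halving [S]
   would exclude 2. *)
pose U := \matrix_(i, j) if (i < j)%N then S i j else 0.
have -> : S = U - U^T.
  apply/matrixP => i j; rewrite !mxE; case: ltngtP => [ij|ij|/val_inj ->]; rewrite ?subr0 ?sub0r //.
rewrite mulmxBr mulmxBl mxB.
have -> : x *m U^T *m x^T = (x *m U *m x^T)^T by rewrite !trmx_mul trmxK mulmxA.
by rewrite [X in _ - X]mxE subrr.
Qed.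

(** * Split orthogonal groups *)

Section OrthogonalGroup.
Variables (F : finFieldType) (n p r : nat).
Hypotheses (pF : p \in [pchar F]) (cardF : #|F| = (p ^ r)%N).

Local Notation Q := (@split_quad F n.+1).

(** The weight is 1 except at a middle index, where it is 2; in characteristic 2 this zero is the
    radical of the polar form. *)
Definition quad_weight (i : 'I_n.+1) : F := (i <= rev_ord i)%N%:R + (rev_ord i <= i)%N%:R.

Local Notation QG := (antidiag quad_weight).

Lemma quad_weight1 i : i != rev_ord i -> quad_weight i = 1.
Proof.
by rewrite -val_eqE /quad_weight; case: ltngtP; rewrite ?addr0 ?add0r.
Qed.

Lemma quad_weight2 i : i = rev_ord i -> quad_weight i = 2%:R.
Proof. by move=> e; rewrite /quad_weight -e leqnn -natrD. Qed.

Lemma quad_weight_rev i : quad_weight (rev_ord i) = quad_weight i.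
Proof. by rewrite /quad_weight rev_ordK addrC. Qed.

Lemma split_quadZ c x : Q (c *: x) = c ^+ 2 * Q x.
Proof.
rewrite /split_quad mulr_sumr; apply: eq_bigr => i _.
by rewrite !mxE mulrACA expr2.
Qed.

Lemma split_quadD x y : Q (x + y) = Q x + Q y + (x *m QG *m y^T) 0 0.
Proof.
have -> : (x *m QG *m y^T) 0 0 =
    \sum_(i < n.+1 | (i <= rev_ord i)%N) (x 0 i * y 0 (rev_ord i) + x 0 (rev_ord i) * y 0 i).
  rewrite antidiag_form big_split.
  rewrite [X in _ = _ + X](reindex_inj rev_ord_inj).
  under [X in _ = _ + X]eq_bigl => i do rewrite rev_ordK.
  under [X in _ = _ + X]eq_bigr => i _ do rewrite rev_ordK.
  rewrite [X in _ = X + _]big_mkcond [X in _ = _ + X]big_mkcond -big_split; apply: eq_bigr => i _.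
  by rewrite /quad_weight mulrDl; case: (_ <= _)%N; case: (_ <= _)%N; rewrite ?mul1r ?mul0r.
rewrite /split_quad -!big_split; apply: eq_bigr => i _; rewrite !mxE.
rewrite -[RHS]/(_ + _ + _); ring.
Qed.

Lemma quad_formT : QG^T = QG.
Proof.
apply/matrixP => i j; rewrite !mxE; case: (eqVneq i (rev_ord j)) => [->|ij].
  by rewrite rev_ordK eqxx quad_weight_rev.
by rewrite (negPf (_ : j != rev_ord i)) ?mul0r // rev_eq_nat eq_sym.
Qed.

Lemma OgroupP (g : {'GL_n.+1[F]}) : reflect (forall x, Q (x *m GLval g) = Q x) (g \in Ogroup F n.+1).
Proof.
rewrite inE; apply: (iffP forallP) => h x; first by apply/eqP.
by rewrite h.
Qed.

Lemma low_support_quad0 (N : 'M[F]_n.+1) x : low_support N -> Q (x *m N) = 0.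
Proof.
move=> Ns; rewrite /split_quad big1 // => i le.
rewrite [X in _ * X]mxE big1 ?mulr0 // => k _; rewrite Ns ?mulr0 //.
by rewrite negb_and orbC low_rev -leqNgt le.
Qed.

Lemma low_support_O (g : {'GL_n.+1[F]}) : low_support (displ g) ->
  reflect (antipersymmetric (displ g)) (g \in Ogroup F n.+1).
Proof.
(* The image of the displacement is totally singular, so only the bilinear term remains, and it has
   to be alternating in [x]. *)
move=> Ns; have QE x : (Q (x *m GLval g) = Q x) <-> (x *m (QG *m (displ g)^T) *m x^T) 0 0 = 0.
  rewrite mulmx_GLval addrC split_quadD low_support_quad0 // addr0 trmx_mul !mulmxA.
  by split=> [/eqP|->]; rewrite ?addr0 // -subr_eq0 addrC addKr => /eqP.
have SE i j : (QG *m (displ g)^T) i j = displ g j (rev_ord i).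
  rewrite antidiag_mull [(_^T) _ _]mxE; have [li|li] := boolP (low (rev_ord i)).
    by rewrite quad_weight1 ?mul1r //; have := low_neq li; rewrite rev_ordK eq_sym.
  by rewrite Ns ?mulr0 // negb_and li orbT.
apply: (iffP (OgroupP g)) => [h|[Nd Na] x].
  have [Sd Sa] := (alternating_formP (QG *m (displ g)^T)).1 (fun x => (QE x).1 (h x)).
  split=> [i|i j]; first by rewrite -SE Sd.
  by have := Sa (rev_ord j) i; rewrite !SE rev_ordK.
apply/QE; apply: (alternating_formP _).2; split=> [i|i j]; rewrite !SE //.
by rewrite Na rev_ordK.
Qed.

(** Required by the Dickson condition in [SOgroup]: multiplication by the reversal matrix makes [N]
    alternating without changing its rank. *)
Lemma low_antipersymmetric_rank (N : 'M[F]_n.+1) :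
  antipersymmetric N -> ~~ odd (\rank N).
Proof.
case=> Nd Na; pose J := antidiag (fun _ : 'I_n.+1 => 1 : F).
have Jf : row_free J by rewrite -kermx_eq0 antidiag_ker0 // => i; apply: oner_neq0.
rewrite -(mxrankMfree N Jf).
have JE i j : (N *m J) i j = N i (rev_ord j) by rewrite antidiag_mulr mulr1.
apply: alternating_rank_even => [|x].
  by apply/matrixP => i j; rewrite [LHS]mxE [RHS]mxE !JE Na rev_ordK.
apply/matrixP => i j; rewrite !ord1 [RHS]mxE; apply: (alternating_formP (N *m J)).2.
by split=> [k|k l]; rewrite !JE ?Nd // Na rev_ordK.
Qed.

Lemma SO_dim_cap : exists2 W : {vspace 'rV[F]_n.+1}, \dim W = (\dim {: 'rV[F]_n.+1} %/ 2)%N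
    & @dim_cap_radical F n.+1 (SOgroup F n.+1) W 'C(n.+1./2, 2).
Proof.
pose P := [set N : 'M[F]_n.+1 | [&& low_supportb N, [forall i, N i (rev_ord i) == 0] &
  [forall i, forall j, N i j == - N (rev_ord j) (rev_ord i)]]].
have PP N : N \in P <-> low_support N /\ antipersymmetric N.
  rewrite inE; split=> [/and3P[/low_supportP Ns /forallP hd /forallP h]|[/low_supportP -> [hd h]]].
    by split=> //; split=> [i|i j]; apply/eqP => //; apply: (forallP (h i)).
  apply/and3P; split=> //; apply/forallP => i; first by rewrite hd.
  by apply/forallP => j; rewrite -h.
apply: (low_dim_cap (P := P)).
- by move=> N /PP[].
- move=> g /PP[Ns h]; rewrite inE; apply/and3P; split; first exact/low_support_O.
    by rewrite (det_pelem pF (low_support_expg pF Ns)).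
  by apply/implyP => _; apply: low_antipersymmetric_rank.
- move=> g; rewrite inE => /andP[gO _] Ns; apply/PP; split=> //; exact/low_support_O.
- by apply/PP; split=> [i j _|]; [|split=> [i|i j]]; rewrite !mxE ?oppr0.
- move=> c M N /PP[hM [dM sM]] /PP[hN [dN sN]]; apply/PP; split; first exact: low_supportZD.
  split=> [i|i j]; rewrite !mxE; first by rewrite dM dN mulr0 addr0.
  by rewrite sM sN opprD mulrN.
- exact: card_low_antipersymmetric PP.
Qed.

Lemma abelem_quad (E : {group {'GL_n.+1[F]}}) : E \subset SOgroup F n.+1 ->
  {in E, forall (g : {'GL_n.+1[F]}) x, Q (x *m GLval g) = Q x}.
Proof.
by move=> /subsetP ES g /ES; rewrite inE => /andP[/OgroupP].
Qed.

Lemma abelem_dickson (E : {group {'GL_n.+1[F]}}) : ~~ odd n.+1 -> (p.-abelem E)%g ->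
  E \subset SOgroup F n.+1 -> 2%N \in [pchar F] ->
  {in E, forall g, (g^-1 = g)%g /\ ~~ odd (\rank (displ g))}.
Proof.
move=> n2 abE /subsetP ES F2 g gE; have := ES g gE; rewrite inE F2 n2 /= => /and3P[_ _ ev].
split=> //; have p2 : p = 2%N by apply/eqP; have := pcharf_eq pF 2; rewrite F2 inE eq_sym.
have := abelem_expg pF abE gE; rewrite p2 expgS expg1 => gg.
by apply: (mulgI g); rewrite mulgV gg.
Qed.

End OrthogonalGroup.

Section OrthogonalRank.
Variables (F : finFieldType) (n p r : nat).
Hypotheses (pF : p \in [pchar F]) (cardF : #|F| = (p ^ r)%N).

Local Notation Q := (@split_quad F n.+1).
Local Notation QG := (antidiag (@quad_weight F n)).

Lemma SO_rank_le k e : (forall x, (x <= kermx QG)%MS -> Q x = 0 -> x = 0) ->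
  (kermx QG = 0 -> 2%N \in [pchar F] -> ~~ odd n.+1) ->
  (\rank (kermx QG) < n.+1)%N -> (k <= (\rank (kermx QG)).+1)%N ->
  (orth_bound (n.+1 + \rank (kermx QG)) k <= e)%N ->
  ('r_p(SOgroup F n.+1)%g <= r * e)%N.
Proof.
move=> Qker nev rk kk be; apply: (p_rank_le pF cardF) => E ES abE.
have pE := abelem_pgroup abE; have cE := abelem_abelian abE.
have QE := abelem_quad ES.
have dickson : 2%N \in [pchar F] -> kermx QG = 0 ->
    {in E, forall g, (g^-1 = g)%g /\ ~~ odd (\rank (displ g))}.
  by move=> F2 k0; apply: (abelem_dickson pF (nev k0 F2) abE ES F2).
have kfix : (k <= \rank (fixmx QG E 0))%N.
  apply: leq_trans kk _.
  exact: (rank_fixmx0 (@quad_formT F n) (@split_quadD F n) Qker pF pE cE QE rk).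
have := orthogonal_abelian_card (@quad_formT F n) (@split_quadZ F n) (@split_quadD F n) Qker pF pE cE QE dickson kfix.
move/leq_trans; apply; rewrite leq_pexp2l //; by apply/card_gt0P; exists 0.
Qed.

Lemma quad_weight_ker0 : (forall i : 'I_n.+1, i != rev_ord i) \/ 2%N \notin [pchar F] ->
  kermx QG = 0.
Proof.
move=> h; apply: antidiag_ker0 => i; have [e|/quad_weight1 ->] := eqVneq i (rev_ord i).
  by rewrite (quad_weight2 F e); case: h => [/(_ i)/eqP //|]; rewrite inE.
exact: oner_neq0.
Qed.

Section OddCharacteristic.
Hypothesis F2 : 2%N \notin [pchar F].
Variables (T : {pred 'I_n.+1 * 'I_n.+1}) (o : 'I_n.+1).
Let S i j := ((i, j) \in T) || ((j, i) \in T).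
Hypothesis T_lt : forall i j, (i, j) \in T -> (i < j)%N.
Hypothesis T_mul : forall i k j, S i k -> S (rev_ord k) j -> i = o /\ j = o.
Hypothesis T_rev : forall j, ~~ S (rev_ord o) j.

(** The matrices [QG *m alt f] form an abelian Lie algebra of skew endomorphisms: [T_mul] confines
    [alt f *m (QG *m alt f')] to the entry (o, o), where it equals its transpose, and [T_rev] kills
    triple products. *)
Let alt (f : 'M[F]_n.+1) := f - f^T.

Let alt_supp f i j : f \in supported F T -> ~~ S i j -> alt f i j = 0.
Proof.
by move=> /supportedP fT; rewrite negb_or => /andP[h h']; rewrite !mxE !fT ?subrr.
Qed.

Let altT f : (alt f)^T = - alt f.
Proof. by rewrite /alt linearB /= trmxK opprB. Qed.

Let mul_o f f' i j : f \in supported F T -> f' \in supported F T ->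
  ~~ ((i == o) && (j == o)) -> (alt f *m (QG *m alt f')) i j = 0.
Proof.
move=> fT fT' ij; rewrite mxE big1 // => k _; rewrite antidiag_mull.
have [ik|ik] := boolP (S i k); last by rewrite alt_supp // mul0r.
have [kj|kj] := boolP (S (rev_ord k) j); last by rewrite (alt_supp fT' kj) !mulr0.
by have [ei ej] := T_mul ik kj; rewrite ei ej !eqxx in ij.
Qed.

Let mulC f f' : f \in supported F T -> f' \in supported F T ->
  alt f *m (QG *m alt f') = alt f' *m (QG *m alt f).
Proof.
move=> fT fT'; have e : alt f' *m (QG *m alt f) = (alt f *m (QG *m alt f'))^T.
  by rewrite !trmx_mul !altT quad_formT !mulNmx mulmxN opprK mulmxA.
rewrite e; apply/matrixP => i j; rewrite [RHS]mxE.
have [/andP[/eqP-> /eqP->] //|ij] := boolP ((i == o) && (j == o)).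
by rewrite !mul_o // andbC.
Qed.

Let mul3 f f' f'' : f \in supported F T -> f' \in supported F T -> f'' \in supported F T ->
  alt f *m (QG *m alt f') *m (QG *m alt f'') = 0.
Proof.
move=> fT fT' fT''; apply/matrixP => i j; rewrite [RHS]mxE [LHS]mxE big1 // => k _.
rewrite antidiag_mull; have [ko|ko] := eqVneq k o.
  by rewrite ko (alt_supp fT'' (T_rev j)) !mulr0.
by rewrite mul_o ?mul0r // negb_and ko orbT.
Qed.

Let D := [set QG *m alt f | f in supported F T].

Let DP N : reflect (exists2 f, f \in supported F T & N = QG *m alt f) (N \in D).
Proof. exact: imsetP. Qed.

Let DZ c N N' : N \in D -> N' \in D -> c *: N + N' \in D.
Proof.
move=> /DP[f fT ->] /DP[f' fT' ->]; apply/DP; exists (c *: f + f').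
  move/supportedP: fT => fT; move/supportedP: fT' => fT'.
  by apply/supportedP => i j ij; rewrite !mxE fT ?fT' // mulr0 addr0.
rewrite scalemxAr -mulmxDr; congr (_ *m _).
by apply/matrixP => i j; rewrite !mxE; ring.
Qed.

Let D0 : 0 \in D.
Proof.
apply/DP; exists 0; first by apply/supportedP => i j _; rewrite mxE.
by rewrite /alt trmx0 subrr mulmx0.
Qed.

Let DC N N' : N \in D -> N' \in D -> N * N' = N' * N.
Proof.
move=> /DP[f fT ->] /DP[f' fT' ->]; rewrite -[LHS]/(_ *m _) -[RHS]/(_ *m _).
by rewrite -!mulmxA (mulC fT fT').
Qed.

Let D3 N N' N'' : N \in D -> N' \in D -> N'' \in D -> N * N' * N'' = 0.
Proof.
move=> /DP[f fT ->] /DP[f' fT' ->] /DP[f'' fT'' ->].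
by rewrite -[LHS]/(_ *m _ *m _) -(mulmxA QG) -mulmxA mul3 // mulmx0.
Qed.

Let DG N : N \in D -> N *m QG = - (QG *m N^T).
Proof.
by move=> /DP[f fT ->]; rewrite trmx_mul altT quad_formT mulNmx mulmxN opprK mulmxA.
Qed.

Let two_neq0 : (2%:R : F) != 0. Proof. by move: F2; rewrite inE. Qed.

(* The exponential, truncated since the products of three elements of [D] vanish. *)
Let expN (N : 'M[F]_n.+1) : 'M[F]_n.+1 := 1 + N + 2%:R^-1 *: (N * N).

Let expND N N' : N \in D -> N' \in D -> expN (N + N') = expN N *m expN N'.
Proof.
move=> ND ND'; rewrite -[RHS]/(_ * _) /expN.
have sq : (N + N') * (N + N') = N * N + (N * N') *+ 2 + N' * N'.
  by rewrite mulrDl !mulrDr (DC ND' ND) mulr2n !addrA.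
have z1 : N * (N' * N') = 0 by rewrite mulrA D3.
have z2 : N * N * N' = 0 by rewrite D3.
have z3 : N * N * (N' * N') = 0 by rewrite mulrA z2 mul0r.
rewrite sq !mulrDl !mulrDr !mul1r !mulr1 -!scalerAl -!scalerAr z1 z2 z3 !scaler0.
move: (N * N) (N' * N') (N * N') => P P' R; apply/matrixP => i j; rewrite !mxE.
by field.
Qed.

Let expN0 : expN 0 = 1. Proof. by rewrite /expN mulr0 scaler0 !addr0. Qed.

Let DN N : N \in D -> - N \in D.
Proof. by move=> ND; rewrite -[- N]addr0 -scaleN1r DZ. Qed.

Let expN_inj : {in D &, injective expN}.
Proof.
move=> N N' ND ND' e; apply/eqP; rewrite -subr_eq0; apply/eqP.
have NND : N - N' \in D by rewrite -[N]scale1r DZ ?DN.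
have : expN (N - N') = 1 by rewrite expND ?DN // e -expND ?DN // subrr expN0.
move: (N - N') NND => M MD eM.
(* Multiplication by [M] kills the cubic term, so M * M = 0 and then M = 0. *)
have M1 : M + 2%:R^-1 *: (M * M) = 0 by apply: (addrI 1); rewrite addr0 addrA.
have MM : M * M = 0.
  by have := congr1 (fun X => M * X) M1; rewrite mulrDr -scalerAr mulrA D3 // scaler0 addr0 mulr0.
by move: M1; rewrite MM scaler0 addr0.
Qed.

Let expN_O (g : {'GL_n.+1[F]}) N : N \in D -> GLval g = expN N -> g \in Ogroup F n.+1.
Proof.
move=> ND gN; apply/OgroupP => x.
have eT : QG *m (expN N)^T = expN (- N) *m QG.
  rewrite /expN !linearD /= linearZ /= trmx1 -[N * N]/(N *m N) trmx_mul.
  rewrite !mulmxDl mulmx1 mul1mx mulNmx DG // opprK -scalemxAr -scalemxAl.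
  have h : QG *m N^T = - (N *m QG) by rewrite DG // opprK.
  congr (_ + _ + _ *: _); rewrite mulrNN -[N * N]/(N *m N) mulmxA h mulNmx -mulmxA h.
  by rewrite mulmxN opprK mulmxA.
have inv : GLval g *m QG *m (GLval g)^T = QG.
  rewrite gN -mulmxA eT mulmxA -expND ?DN // subrr expN0; exact: mul1mx.
have Q2 y : Q y *+ 2 = (y *m QG *m y^T) 0 0.
  by rewrite (form_quad (@split_quadZ F n) (@split_quadD F n)).
apply: (mulfI two_neq0); rewrite !mulr_natl !Q2 trmx_mul mulmxA -[in RHS]inv.
by rewrite !mulmxA.
Qed.

Lemma odd_orthogonal_rank_ge : odd n.+1 -> (r * #|T| <= 'r_p(SOgroup F n.+1)%g)%N.
Proof.
move=> nodd; apply: (p_rank_ge pF cardF D0 _ expN0 expND expN_inj).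
- by move=> N N' ND ND'; rewrite -[N]scale1r DZ.
- move=> g N ND gN gp; rewrite inE (expN_O ND gN) (det_pelem pF gp) eqxx nodd.
  by rewrite andbF.
- rewrite card_in_imset ?(card_mx_supported F T) // => f f' /supportedP fT /supportedP fT' /matrixP e.
  have {}e i j : alt f i j = alt f' i j.
    have := e (rev_ord i) j; rewrite !antidiag_mull rev_ordK; apply: mulfI.
    rewrite quad_weight_rev; have [h|/quad_weight1 -> //] := eqVneq i (rev_ord i).
      by rewrite (quad_weight2 F h).
    exact: oner_neq0.
  apply/matrixP => i j; have [ij|ij] := boolP ((i, j) \in T); last by rewrite fT ?fT'.
  have nji : (j, i) \notin T by apply/negP => /T_lt; rewrite ltnNge (ltnW (T_lt ij)).
  by have := e i j; rewrite !mxE (fT j i) // (fT' j i) // !subr0.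
Qed.

End OddCharacteristic.

End OrthogonalRank.

(** * Orthogonal groups in odd dimension *)

Section OddDimension.
Variables (F : finFieldType) (n p r m : nat).
Hypotheses (pF : p \in [pchar F]) (cardF : #|F| = (p ^ r)%N).
Hypotheses (n2m : n = m.*2) (m2 : (2 <= m)%N).

Local Notation Q := (@split_quad F n.+1).
Local Notation QG := (antidiag (@quad_weight F n)).

Let mid : 'I_n.+1 := inord m.

Lemma val_mid : mid = m :> nat. Proof. by rewrite inordK //; move: n2m; clear; lia. Qed.

Lemma rev_mid : rev_ord mid = mid.
Proof. by apply: val_inj; rewrite /= val_mid n2m -addnn subSS addnK. Qed.

Lemma rev_neq_mid (i : 'I_n.+1) : i != mid -> i != rev_ord i.
Proof.
rewrite -!val_eqE /= val_mid; have := ltn_ord i; move: n2m; clear; lia.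
Qed.

Lemma low_mid : ~~ low mid. Proof. by rewrite /low rev_mid ltnn. Qed.

Lemma half_dim : n.+1./2 = m. Proof. by rewrite n2m /= uphalf_double. Qed.

Section EvenCharacteristic.
Hypothesis F2 : 2%N \in [pchar F].

Lemma quad_mid (z : 'rV[F]_n.+1) : (forall i, low (rev_ord i) -> z 0 i = 0) -> Q z = z 0 mid ^+ 2.
Proof.
move=> zh; rewrite /split_quad (bigD1 mid) ?rev_mid //= big1 ?addr0 // => i /andP[le im].
rewrite [X in _ * X]zh ?mulr0 // rev_ordK /low ltn_neqAle le andbT.
exact: rev_neq_mid.
Qed.

Lemma ker_quad_mid (x : 'rV[F]_n.+1) : (x <= kermx QG)%MS = [forall i, (i != mid) ==> (x 0 i == 0)].
Proof.
apply/sub_kermxP/forallP => [/rowP xQ i|xi].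
  apply/implyP => im; have := xQ (rev_ord i).
  by rewrite antidiag_mulr rev_ordK quad_weight1 ?rev_neq_mid // mulr1 mxE => /eqP.
apply/rowP => i; rewrite antidiag_mulr mxE; have [->|im] := eqVneq (rev_ord i) mid.
  by rewrite (quad_weight2 F (esym rev_mid)) (pcharf0 F2) mulr0.
by rewrite (eqP (implyP (xi (rev_ord i)) im)) mul0r.
Qed.

Lemma rank_ker_quad : \rank (kermx QG) = 1%N.
Proof.
have -> : \rank (kermx QG) = \rank (delta_mx 0 mid : 'rV[F]_n.+1).
  apply: eqmx_rank; apply/andP; split; last first.
    rewrite ker_quad_mid; apply/forallP => i; apply/implyP => /negPf im.
    by rewrite mxE im andbF.
  apply/rV_subP => x; rewrite ker_quad_mid => /forallP xi; apply/sub_rVP; exists (x 0 mid).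
  apply/rowP => i; rewrite !mxE /=; have [->|im] := eqVneq i mid; first by rewrite mulr1.
  by rewrite mulr0; apply/eqP; apply: (implyP (xi i)).
by rewrite mxrank_delta.
Qed.

Lemma even_SO_rank_le : ('r_p(SOgroup F n.+1)%g <= r * 'C(m + 1, 2))%N.
Proof.
(* The fixed space contains the radical and one more dimension. For m = 2 this second dimension is
   what lowers the bound from 4 to 3. *)
apply: (SO_rank_le (k := 2) pF cardF) => //.
- move=> x; rewrite ker_quad_mid => /forallP xi.
  rewrite quad_mid => [/eqP|i li]; last first.
    apply/eqP; apply: (implyP (xi i)); apply: contraL li => /eqP->.
    by rewrite rev_mid low_mid.
  rewrite sqrf_eq0 => /eqP xm; apply/rowP => i; rewrite mxE.
  by have [-> //|im] := eqVneq i mid; apply/eqP; apply: (implyP (xi i)).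
- by move=> k0; have := rank_ker_quad; rewrite k0 mxrank0.
- by rewrite rank_ker_quad n2m; move: m2; lia.
- by rewrite rank_ker_quad.
rewrite rank_ker_quad; have -> : (n.+1 + 1 = (m + 1).*2)%N by rewrite n2m; lia.
move: m2; rewrite leq_eqVlt => /predU1P[<- //|m3].
by apply: orth_bound_even; rewrite addn1.
Qed.

(** Removing its diagonal makes a symmetric matrix alternating in characteristic 2. *)
Lemma symmetric_form_pchar2 (S : 'M[F]_n.+1) (x : 'rV_n.+1) : S^T = S ->
  (x *m S *m x^T) 0 0 = \sum_i x 0 i ^+ 2 * S i i.
Proof.
move=> St; have /(_ x) : forall y : 'rV_n.+1, (y *m (S - diag_mx (\row_i S i i)) *m y^T) 0 0 = 0.
  apply/alternating_formP; split=> [i|i j]; first by rewrite !mxE eqxx subrr.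
  have Sij : S i j = S j i by rewrite -{1}St mxE.
  have [->|ij] := eqVneq i j; first by rewrite (oppr_pchar2 F2).
  by rewrite (oppr_pchar2 F2) !mxE Sij [j == i]eq_sym (negPf ij).
have mxB (X Y : 'M[F]_1) : (X - Y) 0 0 = X 0 0 - Y 0 0 by rewrite !mxE.
rewrite mulmxBr mulmxBl mxB => /eqP; rewrite subr_eq0 => /eqP ->.
rewrite mxE; apply: eq_bigr => i _; rewrite mul_mx_diag !mxE expr2.
by rewrite mulrAC.
Qed.

Let sqr_sum (I : finType) (f : I -> F) : (\sum_i f i) ^+ 2 = \sum_i f i ^+ 2.
Proof.
rewrite -(pFrobenius_autE F2) rmorph_sum; apply: eq_bigr => i _; exact: pFrobenius_autE.
Qed.

(* In characteristic 2 a symmetric matrix is not alternating; the entries in the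
   middle column, square roots of its diagonal, compensate for the defect. *)
Definition even_nilradical : {set 'M[F]_n.+1} :=
  [set N : 'M[F]_n.+1 |
    [&& [forall i, forall j, ~~ (low (rev_ord i) && ~~ low (rev_ord j)) ==> (N i j == 0)],
        [forall i, forall j, low (rev_ord i) && low j ==> (N i j == N (rev_ord j) (rev_ord i))]
      & [forall i, low (rev_ord i) ==> (N i mid ^+ 2 == N i (rev_ord i))]]].

Lemma even_nilradicalP (N : 'M[F]_n.+1) : reflect
  [/\ forall i j, ~~ (low (rev_ord i) && ~~ low (rev_ord j)) -> N i j = 0,
      forall i j, low (rev_ord i) -> low j -> N i j = N (rev_ord j) (rev_ord i)
    & forall i, low (rev_ord i) -> N i mid ^+ 2 = N i (rev_ord i)] (N \in even_nilradical).
Proof.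
rewrite inE; apply: (iffP and3P) => -[h1 h2 h3]; split.
- by move=> i j ij; apply/eqP; apply: (implyP (forallP (forallP h1 i) j)).
- by move=> i j li lj; apply/eqP; apply: (implyP (forallP (forallP h2 i) j)); rewrite li.
- by move=> i li; apply/eqP; apply: (implyP (forallP h3 i)).
- by apply/forallP => i; apply/forallP => j; apply/implyP => ij; rewrite h1.
- by apply/forallP => i; apply/forallP => j; apply/implyP => /andP[li lj]; rewrite h2.
- by apply/forallP => i; apply/implyP => li; rewrite h3.
Qed.

Lemma even_nilradical_O (g : {'GL_n.+1[F]}) N : N \in even_nilradical -> GLval g = 1 + N ->
  g \in Ogroup F n.+1.
Proof.
move=> /even_nilradicalP[N0 Nsym Nsq] gN; apply/OgroupP => x.
have -> : x *m GLval g = x + x *m N by rewrite gN mulmxDr; congr (_ + _); apply: mulmx1.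
have QN : Q (x *m N) = \sum_i x 0 i ^+ 2 * N i mid ^+ 2.
  rewrite quad_mid => [|i li]; last by rewrite mxE big1 // => k _; rewrite N0 ?mulr0 // li andbF.
  by rewrite mxE sqr_sum; apply: eq_bigr => i _; rewrite exprMn.
have S0 i j : ~~ low (rev_ord j) -> (QG *m N^T) i j = 0.
  by move=> lj; rewrite antidiag_mull [(_^T) _ _]mxE N0 ?mulr0 // (negPf lj).
have S1 i j : low (rev_ord i) -> (QG *m N^T) i j = N j (rev_ord i).
  move=> li; rewrite antidiag_mull [(_^T) _ _]mxE quad_weight1 ?mul1r //.
  by have := low_neq li; rewrite rev_ordK eq_sym.
have Smid j : (QG *m N^T) mid j = 0.
  by rewrite antidiag_mull (quad_weight2 F (esym rev_mid)) (pcharf0 F2) mul0r.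
have Slow i j : low i -> (QG *m N^T) i j = 0.
  by move=> li; rewrite antidiag_mull [(_^T) _ _]mxE N0 ?mulr0 // rev_ordK li andbF.
have Sz i j : ~~ low (rev_ord i) -> (QG *m N^T) i j = 0.
  move=> li; have [->|im] := eqVneq i mid; first exact: Smid.
  apply: Slow; have := not_low (i := rev_ord i) li; rewrite rev_ordK; apply.
  by rewrite eq_sym rev_neq_mid.
have St : (QG *m N^T)^T = QG *m N^T.
  apply/matrixP => i j; rewrite mxE.
  have [li|li] := boolP (low (rev_ord i)); last by rewrite S0 // Sz.
  have [lj|lj] := boolP (low (rev_ord j)); last by rewrite Sz // S0.
  by rewrite !S1 // Nsym // rev_ordK.
(* The middle column contributes the sum of x_i ^ 2 [N i mid] ^ 2 and the polar term the sum of x_i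
   ^ 2 [N i (rev_ord i)]; by the choice of square roots the two are equal and cancel. *)
rewrite split_quadD QN trmx_mul !mulmxA -(mulmxA x) (symmetric_form_pchar2 x St) -addrA -big_split.
rewrite big1 ?addr0 // => i _ /=; rewrite -mulrDr.
have [li|li] := boolP (low (rev_ord i)); last by rewrite Sz // N0 ?(negPf li) // expr0n addr0 mulr0.
by rewrite S1 // Nsq // addrr_pchar2 // mulr0.
Qed.

Lemma card_even_nilradical : (#|F| ^ 'C(m + 1, 2) <= #|even_nilradical|)%N.
Proof.
have [s sE] : exists s : F -> F, forall a, s a ^+ 2 = a by apply: (fin_all_exists (P := fun a c => c ^+ 2 = a)) => a; apply: pchar2_sqrt.
rewrite -half_dim -card_le_low -(card_mx_supported F).
set T := [pred ij | _]; rewrite -/(supported F T).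
pose h (f : 'M[F]_n.+1) : 'M[F]_n.+1 := \matrix_(i, j)
  if low (rev_ord i) then
    if low j then (if (rev_ord i <= j)%N then f (rev_ord i) j else f j (rev_ord i))
    else if j == mid then s (f (rev_ord i) (rev_ord i)) else 0
  else 0.
have h_inj : {in supported F T &, injective h}.
  move=> f f' /supportedP fT /supportedP fT' /matrixP e; apply/matrixP => i j.
  have [/andP[ij lj]|ij] := boolP ((i <= j)%N && low j); last by rewrite fT ?fT'.
  have li : low i by move: lj; rewrite !low_half; apply: leq_ltn_trans.
  by have := e (rev_ord i) j; rewrite !mxE !rev_ordK li lj ij.
rewrite -(card_in_imset h_inj); apply: subset_leq_card; apply/subsetP => _ /imsetP[f fT ->].
apply/even_nilradicalP; split=> [i j|i j li lj|i li]; rewrite !mxE.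
- case: (boolP (low _)) => //= li; rewrite negbK => lj.
  have jm : j != mid by apply: contraTneq lj => ->; rewrite rev_mid low_mid.
  by have := rev_low lj; rewrite rev_ordK (negPf jm) => /negPf->.
- rewrite !rev_ordK li lj; case: ltngtP => // e.
  by have -> : rev_ord i = j by apply: val_inj.
- by rewrite li (negPf low_mid) eqxx leqnn sE.
Qed.

Lemma even_SO_rank_ge : (r * 'C(m + 1, 2) <= 'r_p(SOgroup F n.+1)%g)%N.
Proof.
apply: (p_rank_ge (e := fun N => 1 + N) pF cardF _ _ _ _ _ _ card_even_nilradical).
- by apply/even_nilradicalP; split=> *; rewrite !mxE ?expr0n.
- move=> N N' /even_nilradicalP[N0 Nsym Nsq] /even_nilradicalP[N0' Nsym' Nsq'].
  apply/even_nilradicalP; split=> [i j ij|i j li lj|i li]; rewrite !mxE.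
  + by rewrite N0 ?N0' ?addr0.
  + by rewrite (Nsym i j li lj) (Nsym' i j li lj).
  + by rewrite sqrrD (Nsq i li) (Nsq' i li) mulr2n addrr_pchar2 // addr0.
- exact: addr0.
- move=> N N' /even_nilradicalP[N0 _ _] /even_nilradicalP[N0' _ _].
  have NN : N * N' = 0.
    apply/matrixP => i j; rewrite !mxE big1 // => k _.
    have [lk|lk] := boolP (low (rev_ord k)); first by rewrite N0 ?mul0r // lk andbF.
    by rewrite N0' ?mulr0 // (negPf lk).
  by rewrite -[RHS]/(_ * _) mulrDr mulr1 mulrDl mul1r NN addr0 addrA.
- by move=> N N' _ _ /addrI.
- move=> g N ND gN gp; have nodd : odd n.+1 by rewrite n2m /= odd_double.
  by rewrite inE (even_nilradical_O ND gN) (det_pelem pF gp) eqxx nodd andbF.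
Qed.

End EvenCharacteristic.

Section OddCharacteristic.
Hypothesis F2 : 2%N \notin [pchar F].

Lemma odd_SO_rank_le : ('r_p(SOgroup F n.+1)%g <=
  r * (if 4 <= m then 'C(m, 2) + 1 else if m == 3 then 5 else 3))%N.
Proof.
have k0 : kermx QG = 0 by apply: quad_weight_ker0; right.
apply: (SO_rank_le (k := 0) pF cardF) => //.
- by move=> x; rewrite k0 submx0 => /eqP.
- by rewrite (negPf F2).
- by rewrite k0 mxrank0.
rewrite k0 mxrank0 addn0 n2m; case: ifP => m4; first by rewrite addn1 orth_bound_odd.
(* Evaluation: [orth_bound 5 0] is 3 and [orth_bound 7 0] is 5. *)
by case: m m2 m4 => [|[|[|[|]]]].
Qed.

(** The positions in the first row describe the unipotent radical of the stabiliser of the singular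
    line spanned by the first basis vector. *)
Lemma odd_SO_rank_ge_line : (r * n.-1 <= 'r_p(SOgroup F n.+1)%g)%N.
Proof.
pose T := [pred ij : 'I_n.+1 * 'I_n.+1 | [&& val ij.1 == 0%N, (0 < ij.2)%N & (ij.2 < n)%N]].
have cT : #|T| = n.-1.
  have inj : injective (fun j : 'I_n.+1 => (ord0 : 'I_n.+1, j)) by move=> i j [].
  have -> : n.-1 = #|predC (pred2 (ord0 : 'I_n.+1) ord_max)|.
    have ne : (ord0 : 'I_n.+1) != ord_max by rewrite -val_eqE /=; move: n2m m2; lia.
    have := cardC (pred2 (ord0 : 'I_n.+1) ord_max); rewrite card2 ne card_ord => e.
    by rewrite -[RHS](addKn 2) e subSS subn1.
  rewrite -(card_image inj); apply: eq_card => -[i j]; rewrite !inE /=.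
  apply/idP/imageP => [/and3P[/eqP i0 j0 jn]|[k]].
    exists j; last by congr (_, _); apply: val_inj.
    by rewrite !inE -!val_eqE /= negb_or -lt0n j0 neq_ltn jn.
  rewrite !inE -!val_eqE /= negb_or => /andP[k0 kn] [-> ->] /=.
  by rewrite lt0n k0 ltn_neqAle kn -ltnS ltn_ord.
rewrite -cT; apply: (odd_orthogonal_rank_ge pF cardF F2 (o := ord0)); last by rewrite /= n2m odd_double.
- by move=> i j; rewrite inE /= => /and3P[/eqP->].
- move=> i k j; rewrite !inE /= !subSS => h1 h2.
  have hk := ltn_ord k.
  suff [e e'] : i = 0%N :> nat /\ j = 0%N :> nat by split; apply: val_inj.
  by move: h1 h2 hk n2m m2; lia.
- by move=> j; rewrite !inE /=; have := ltn_ord j; move: n2m m2; lia.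
Qed.

(** To the C(m, 2) positions of the radical of [W] is added one that pairs the first basis vector
    with the nonsingular middle one. Two positions of the latter kind would not commute. *)
Lemma odd_SO_rank_ge_plane : (r * ('C(m, 2) + 1) <= 'r_p(SOgroup F n.+1)%g)%N.
Proof.
pose T := [pred ij : 'I_n.+1 * 'I_n.+1 |
  (ij == (ord0, mid)) || ((ij.1 < ij.2)%N && low ij.2)].
have cT : #|T| = ('C(m, 2) + 1)%N.
  rewrite -half_dim -card_lt_low addnC.
  set L := [pred ij | _]; have nL : (ord0 : 'I_n.+1, mid) \notin L by rewrite inE /= (negPf low_mid) andbF.
  by have := cardU1 (ord0 : 'I_n.+1, mid) L; rewrite nL => <-; apply: eq_card.
rewrite -cT; apply: (odd_orthogonal_rank_ge pF cardF F2 (o := ord0)); last by rewrite /= n2m odd_double.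
- move=> i j; rewrite inE /= xpair_eqE -!val_eqE /= val_mid.
  by move: m2; lia.
- move=> i k j; rewrite !inE /= !xpair_eqE -!val_eqE !low_half half_dim /= val_mid !subSS => h1 h2.
  have hk := ltn_ord k.
  suff [e e'] : i = 0%N :> nat /\ j = 0%N :> nat by split; apply: val_inj.
  by move: h1 h2 hk n2m m2; lia.
- move=> j; rewrite !inE /= !xpair_eqE -!val_eqE !low_half half_dim /= val_mid.
  by have := ltn_ord j; move: n2m m2; lia.
Qed.

End OddCharacteristic.

End OddDimension.

Section EvenOrthogonal.
Variables (F : finFieldType) (n p r m : nat).
Hypotheses (pF : p \in [pchar F]) (cardF : #|F| = (p ^ r)%N).
Hypotheses (n2m : n.+1 = m.*2) (m4 : (4 <= m)%N).

Lemma SO_even_radical_rank :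
  exists (W : {vspace 'rV[F]_n.+1}) (r' : nat),
    [/\ \dim W = (\dim {: 'rV[F]_n.+1} %/ 2)%N, @dim_cap_radical F n.+1 (SOgroup F n.+1) W r',
        r' = 'C(m, 2) & (r * r')%N = 'r_p(SOgroup F n.+1)%g].
Proof.
have hm : n.+1./2 = m by rewrite n2m doubleK.
have [W dW] := SO_dim_cap n pF; rewrite hm => capW.
exists W, 'C(m, 2); split=> //; apply/eqP; rewrite eqn_leq (dim_cap_radical_le pF cardF capW).
have k0 : kermx (antidiag (@quad_weight F n)) = 0.
  by apply: quad_weight_ker0; left => i; exact: (rev_ord_neq _ n2m).
apply: (SO_rank_le (k := 0) pF cardF) => //.
- by move=> x; rewrite k0 submx0 => /eqP.
- by move=> _ _; rewrite n2m odd_double.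
- by rewrite k0 mxrank0.
- by rewrite k0 mxrank0 addn0 n2m orth_bound_even.
Qed.

End EvenOrthogonal.

Local Close Scope ring_scope.

Theorem proposition3p3p1 (p r : nat) (p_prime : prime p) (r_gt0 : 0 < r)
    (F : finFieldType) (card_F : #|F| = p ^ r) (m : nat) :
  [/\ 2 <= m ->
        exists (W : {vspace 'rV[F]_(m.-1.+1)}) (r' : nat),
        [/\ \dim W = (\dim {: 'rV[F]_(m.-1.+1)}) %/ 2,
            dim_cap_radical (SLgroup F m) W r',
            r' = m ^ 2 %/ 4
          & r * r' = 'r_p(SLgroup F m)%g],
      2 <= m ->
        exists (W : {vspace 'rV[F]_((2 * m).-1.+1)}) (r' : nat),
        [/\ \dim W = (\dim {: 'rV[F]_((2 * m).-1.+1)}) %/ 2,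
            dim_cap_radical (Spgroup F (2 * m)) W r',
            r' = m * (m + 1) %/ 2
          & r * r' = 'r_p(Spgroup F (2 * m))%g],
      4 <= m ->
        exists (W : {vspace 'rV[F]_((2 * m).-1.+1)}) (r' : nat),
        [/\ \dim W = (\dim {: 'rV[F]_((2 * m).-1.+1)}) %/ 2,
            dim_cap_radical (SOgroup F (2 * m)) W r',
            r' = m * (m - 1) %/ 2
          & r * r' = 'r_p(SOgroup F (2 * m))%g]
    & 2 <= m ->
        exists (W : {vspace 'rV[F]_((2 * m + 1).-1.+1)}) (r' : nat),
        [/\ \dim W = (\dim {: 'rV[F]_((2 * m + 1).-1.+1)}) %/ 2,
            dim_cap_radical (SOgroup F (2 * m + 1)) W r',
            r' = m * (m - 1) %/ 2
          & 'r_p(SOgroup F (2 * m + 1))%g =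
              r * (if ~~ odd (p ^ r) then m * (m + 1) %/ 2
                   else if 4 <= m then m * (m - 1) %/ 2 + 1
                   else if m == 3 then 5 else 3)]].
Proof.
have pF := card_finPcharP card_F p_prime.
have binD : 'C(m + 1, 2) = m * (m + 1) %/ 2 by rewrite bin2 addn1 divn2 mulnC.
have binB : 'C(m, 2) = m * (m - 1) %/ 2 by rewrite bin2 subn1 divn2.
split=> m_ge.
- case: m m_ge {binD binB} => [//|n] _; exact: SL_radical_rank.
- have : 2 * m = m.*2 by rewrite mul2n.
  case: (2 * m) => [|n] e; first by move: e m_ge; lia.
  have [W [r' [dW capW er' rk]]] := Sp_radical_rank pF card_F e m_ge.
  by exists W, r'; split; rewrite // er' binD.
- have : 2 * m = m.*2 by rewrite mul2n.
  case: (2 * m) => [|n] e; first by move: e m_ge; lia.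
  have [W [r' [dW capW er' rk]]] := SO_even_radical_rank pF card_F e m_ge.
  by exists W, r'; split; rewrite // er' binB.
have : 2 * m + 1 = m.*2.+1 by rewrite mul2n addn1.
case: (2 * m + 1) => [|n] // [] e.
have [W dW] := SO_dim_cap n pF; rewrite (half_dim e) => capW.
exists W, 'C(m, 2); split=> //; rewrite -binD -binB.
have [F2|F2] := boolP (2 \in [pchar F]%R).
  have p2 : p = 2 by apply/eqP; have := pcharf_eq pF 2; rewrite F2 inE eq_sym.
  have -> : odd (p ^ r) = false by rewrite p2 oddX orbF eqn0Ngt r_gt0.
  by apply/eqP; rewrite eqn_leq; apply/andP; split; [apply: even_SO_rank_le | apply: even_SO_rank_ge].
have podd : odd p by case: (even_prime p_prime) => // p2; move: F2; rewrite -p2 pF.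
rewrite oddX podd orbT /=; apply/eqP.
rewrite eqn_leq; apply/andP; split; first exact: odd_SO_rank_le.
case: ifP => m4; first exact: odd_SO_rank_ge_plane.
(* For m = 2 and m = 3 the dimension 2m - 1 of the line radical is 3 and 5. *)
have := odd_SO_rank_ge_line pF card_F e m_ge F2; rewrite e.
by case: m m_ge m4 {binD binB e capW} => [|[|[|[|]]]].
Qed.
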